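(* Let $k$ be a field and let $A$, $B$ be Hopf algebras over $k$ such that $\mathcal{M}^A \simeq^{\otimes} \mathcal{M}^B$, i.e. such that $A$ and $B$ have equivalent linear tensor categories of comodules. If $\mathrm{gldim}(A)$ and $\mathrm{gldim}(B)$ are finite, then $\mathrm{gldim}(A)=\mathrm{gldim}(B)$.
   Context: We work over a fixed base field $k$. For a Hopf algebra $A$ over $k$ (no assumption that the antipode is bijective), $\mathcal{M}^A$ denotes the $k$-linear tensor (monoidal) category of right $A$-comodules. The notation $\mathcal{M}^A \simeq^{\otimes} \mathcal{M}^B$ means that there is a $k$-linear monoidal equivalence of categories between $\mathcal{M}^A$ and $\mathcal{M}^B$. $\mathrm{gldim}(A)$ denotes the global dimension of the algebra $A$ (for a Hopf algebra the left and right global dimensions coincide, both being equal to the projective dimension of the trivial left, or right, $A$-module $k$, with action through the counit). *)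

(* Defs.v *)
From HB Require Import structures.
From mathcomp Require Import all_boot all_order all_algebra sesquilinear.
From mathcomp Require Import boolp functions.

Set Implicit Arguments.
Unset Strict Implicit.
Unset Printing Implicit Defensive.

Import GRing.Theory.
Local Open Scope ring_scope.
Local Open Scope quotient_scope.

(* [tensor V W] is the quotient of the formal sums of pairs (v, w) by the     *)
(* relation identifying two sums on which all bilinear maps agree.  The       *)
(* universal property is given by [tliftE], [tlift_is_linear], [tensor_ext].  *)
Section Tensor.
Variables (k : fieldType) (V W : lmodType k).
Implicit Types (s t : seq (V * W)) (U : lmodType k).

Definition tsum U (f : V -> W -> U) s : U := \sum_(p <- s) f p.1 p.2.

Definition tensor_rel : rel (seq (V * W)) := fun s t =>
  `[< forall U (f : {bilinear V -> W -> U}), tsum f s = tsum f t >].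

Lemma tensor_relP s t :
  reflect (forall U (f : {bilinear V -> W -> U}), tsum f s = tsum f t)
    (tensor_rel s t).
Proof. exact: asboolP. Qed.

Lemma tensor_rel_refl : reflexive tensor_rel.
Proof. by move=> s; apply/tensor_relP. Qed.

Lemma tensor_rel_sym : symmetric tensor_rel.
Proof.
by move=> s t; apply/tensor_relP/tensor_relP => st U f; rewrite st.
Qed.

Lemma tensor_rel_trans : transitive tensor_rel.
Proof.
move=> t s u /tensor_relP st /tensor_relP tu.
by apply/tensor_relP => U f; rewrite st tu.
Qed.

Canonical tensor_equiv :=
  EquivRel tensor_rel tensor_rel_refl tensor_rel_sym tensor_rel_trans.

Definition tensor : Type := {eq_quot tensor_equiv}.
HB.instance Definition _ := Choice.on tensor.
HB.instance Definition _ := EqQuotient.on tensor.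

Implicit Types x y z : tensor.

Definition tlift U (f : V -> W -> U) x : U := tsum f (repr x).

Lemma tlift_pi U (f : {bilinear V -> W -> U}) s :
  tlift f (\pi_tensor s) = tsum f s.
Proof. by rewrite /tlift; case: piP => t /eqmodP /tensor_relP ->. Qed.

Lemma tensor_sep x y :
  (forall U (f : {bilinear V -> W -> U}), tlift f x = tlift f y) -> x = y.
Proof.
move=> xy; rewrite -[x]reprK -[y]reprK; apply/eqmodP/tensor_relP => U f.
exact: xy.
Qed.

Definition ptens (v : V) (w : W) : tensor := \pi_tensor [:: (v, w)].
Definition tens0 : tensor := \pi_tensor [::].
Definition tens_add x y : tensor := \pi_tensor (repr x ++ repr y).
Definition tens_scale (a : k) x : tensor :=
  \pi_tensor [seq (a *: p.1, p.2) | p <- repr x].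
Definition tens_opp x : tensor := tens_scale (- 1) x.

Section Lift.
Variables (U : lmodType k) (f : {bilinear V -> W -> U}).

Lemma tliftE v w : tlift f (ptens v w) = f v w.
Proof. by rewrite tlift_pi /tsum big_seq1. Qed.

Fact tlift0 : tlift f tens0 = 0.
Proof. by rewrite tlift_pi /tsum big_nil. Qed.

Fact tlift_add x y : tlift f (tens_add x y) = tlift f x + tlift f y.
Proof. by rewrite tlift_pi /tsum big_cat. Qed.

Fact tlift_scale a x : tlift f (tens_scale a x) = a *: tlift f x.
Proof.
rewrite tlift_pi /tsum big_map scaler_sumr.
by apply: eq_bigr => p _; rewrite linearZl_LR.
Qed.

Fact tlift_opp x : tlift f (tens_opp x) = - tlift f x.
Proof. by rewrite tlift_scale scaleN1r. Qed.
End Lift.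

Local Definition tliftEE := (tlift0, tlift_add, tlift_scale, tlift_opp).

Fact tens_addA : associative tens_add.
Proof. by move=> x y z; apply: tensor_sep => U f; rewrite !tliftEE addrA. Qed.
Fact tens_addC : commutative tens_add.
Proof. by move=> x y; apply: tensor_sep => U f; rewrite !tliftEE addrC. Qed.
Fact tens_add0 : left_id tens0 tens_add.
Proof. by move=> x; apply: tensor_sep => U f; rewrite !tliftEE add0r. Qed.
Fact tens_addN : left_inverse tens0 tens_opp tens_add.
Proof. by move=> x; apply: tensor_sep => U f; rewrite !tliftEE addNr. Qed.

HB.instance Definition _ :=
  GRing.isZmodule.Build tensor tens_addA tens_addC tens_add0 tens_addN.

Fact tens_scaleA a b x :
  tens_scale a (tens_scale b x) = tens_scale (a * b) x.
Proof. by apply: tensor_sep => U f; rewrite !tliftEE scalerA. Qed.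
Fact tens_scale1 : left_id 1 tens_scale.
Proof. by move=> x; apply: tensor_sep => U f; rewrite !tliftEE scale1r. Qed.
Fact tens_scaleDr : right_distributive tens_scale +%R.
Proof.
by move=> a x y; apply: tensor_sep => U f; rewrite !tliftEE scalerDr.
Qed.
Fact tens_scaleDl x : {morph tens_scale^~ x : a b / a + b}.
Proof.
by move=> a b; apply: tensor_sep => U f; rewrite !tliftEE scalerDl.
Qed.

HB.instance Definition _ := GRing.Zmodule_isLmodule.Build k tensor
  tens_scaleA tens_scale1 tens_scaleDr tens_scaleDl.

Fact tlift_is_linear U (f : {bilinear V -> W -> U}) : linear (tlift f).
Proof. by move=> a x y; rewrite tlift_add tlift_scale. Qed.

HB.instance Definition _ U (f : {bilinear V -> W -> U}) :=
  GRing.isLinear.Build k tensor U _ (tlift f) (tlift_is_linear f).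

Fact ptens_is_bilinear : bilinear_for *:%R *:%R ptens.
Proof.
split=> [w a v v'|v a w w']; apply: tensor_sep => U f;
  by rewrite tlift_is_linear !tliftE ?linearPl ?linearPr.
Qed.

HB.instance Definition _ :=
  bilinear_isBilinear.Build k V W tensor _ _ ptens ptens_is_bilinear.
HB.instance Definition _ v :=
  GRing.isLinear.Build k W tensor _ (ptens v) (ptens_is_bilinear.2 v).

Lemma tensor_sum x : exists s, x = \sum_(p <- s) ptens p.1 p.2.
Proof.
exists (repr x); apply: tensor_sep => U f.
rewrite (linear_sum (tlift f)) /= {1}/tlift /tsum.
by apply: eq_bigr => p _; rewrite tliftE.
Qed.

Lemma tensor_ind (P : tensor -> Prop) :
  (forall v w, P (ptens v w)) ->
  (forall a x y, P x -> P y -> P (a *: x + y)) -> forall x, P x.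
Proof.
move=> Pp PD x; have [s ->] := tensor_sum x.
elim: s => [|p s IHs]; last by rewrite big_cons -[X in X + _]scale1r; apply: PD.
by rewrite big_nil -(linear0l _ (0 : W) : ptens 0 0 = 0).
Qed.

Lemma tensor_indD (P : tensor -> Prop) :
  (forall v w, P (ptens v w)) -> (forall x y, P x -> P y -> P (x + y)) ->
  forall x, P x.
Proof.
move=> Pp PD x; have [s ->] := tensor_sum x.
elim: s => [|p s IHs]; last by rewrite big_cons; apply: PD.
by rewrite big_nil -(linear0l _ (0 : W) : ptens 0 0 = 0).
Qed.

Lemma tensor_ext U (f g : {linear tensor -> U}) :
  (forall v w, f (ptens v w) = g (ptens v w)) -> f =1 g.
Proof.
by move=> fg; elim/tensor_ind => // a x y IHx IHy; rewrite !linearP IHx IHy.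
Qed.

End Tensor.

Notation "v ⊗ w" := (ptens v w) (at level 40, left associativity) : ring_scope.

Section TensorMaps.
Variable k : fieldType.

Let linear_comm (V : lmodType k) a b (x y z t : V) :
  b *: (a *: x + y) + (a *: z + t) = a *: (b *: x + z) + (b *: y + t).
Proof. by rewrite !scalerDr !scalerA addrACA mulrC. Qed.

Section Map.
Variables V V' W W' : lmodType k.

Definition tpair (f : V -> V') (g : W -> W') (v : V) (w : W) := f v ⊗ g w.

Fact tpair_is_bilinear (f : {linear V -> V'}) (g : {linear W -> W'}) :
  bilinear_for *:%R *:%R (tpair f g).
Proof.
by split=> [w a v v'|v a w w']; rewrite /tpair linearP ?linearPl ?linearPr.
Qed.
HB.instance Definition _ (f : {linear V -> V'}) (g : {linear W -> W'}) :=
  bilinear_isBilinear.Build k V W (tensor V' W') _ _ (tpair f g)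
    (tpair_is_bilinear f g).

Definition tmap (f : V -> V') (g : W -> W') : tensor V W -> tensor V' W' :=
  tlift (tpair f g).
HB.instance Definition _ (f : {linear V -> V'}) (g : {linear W -> W'}) :=
  GRing.Linear.copy (tmap f g) (tlift (tpair f g)).

Lemma tmapE (f : {linear V -> V'}) (g : {linear W -> W'}) v w :
  tmap f g (v ⊗ w) = f v ⊗ g w.
Proof. exact: tliftE. Qed.

Lemma tmap_linearl a (f g fg : {linear V -> V'}) (h : {linear W -> W'}) x :
  (forall v, fg v = a *: f v + g v) ->
  tmap fg h x = a *: tmap f h x + tmap g h x.
Proof.
move=> fgE; elim/tensor_ind: x => [v w|b x y IHx IHy].
  by rewrite !tmapE fgE linearPl.
by rewrite !linearP /= IHx IHy scalerDr addrACA.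
Qed.

Lemma tmap_linearr a (f : {linear V -> V'}) (g h gh : {linear W -> W'}) x :
  (forall w, gh w = a *: g w + h w) ->
  tmap f gh x = a *: tmap f g x + tmap f h x.
Proof.
move=> ghE; elim/tensor_ind: x => [v w|b x y IHx IHy].
  by rewrite !tmapE ghE linearPr.
by rewrite !linearP /= IHx IHy scalerDr addrACA.
Qed.
End Map.

(* v ⊗ w, v' ⊗ w' |-> f v v' ⊗ g w w'                                         *)
Section Map2.
Variables V V' V'' W W' W'' : lmodType k.

Definition tpair2 (f : V -> V' -> V'') (g : W -> W' -> W'')
    (y : tensor V' W') (v : V) (w : W) : tensor V'' W'' :=
  tmap (f v) (g w) y.

Definition tmap2 (f : V -> V' -> V'') (g : W -> W' -> W'')
    (x : tensor V W) (y : tensor V' W') : tensor V'' W'' :=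
  tlift (tpair2 f g y) x.

Variables (f : {bilinear V -> V' -> V''}) (g : {bilinear W -> W' -> W''}).

Fact tpair2_is_bilinear y : bilinear_for *:%R *:%R (tpair2 f g y).
Proof.
split=> [w a v v'|v a w w']; rewrite /tpair2.
  elim/tensor_ind: y => [v1 w1|b y z IHy IHz].
    by rewrite !tmapE /= !linearPl.
  by rewrite !linearP /= IHy IHz linear_comm.
elim/tensor_ind: y => [v1 w1|b y z IHy IHz].
  by rewrite !tmapE /= !linearPl linearPr.
by rewrite !linearP /= IHy IHz linear_comm.
Qed.
HB.instance Definition _ y :=
  bilinear_isBilinear.Build k V W (tensor V'' W'') _ _ (tpair2 f g y)
    (tpair2_is_bilinear y).

Fact tmap2_is_bilinear : bilinear_for *:%R *:%R (tmap2 f g).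
Proof.
split=> [y a x x'|x a y y']; rewrite /tmap2; first by rewrite linearP.
elim/tensor_ind: x => [v w|b x z IHx IHz].
  by rewrite !tliftE /= /tpair2 linearP.
by rewrite !linearP /= IHx IHz linear_comm.
Qed.
HB.instance Definition _ :=
  bilinear_isBilinear.Build k (tensor V W) (tensor V' W') (tensor V'' W'') _ _
    (tmap2 f g) tmap2_is_bilinear.

Lemma tmap2E v w v' w' : tmap2 f g (v ⊗ w) (v' ⊗ w') = f v v' ⊗ g w w'.
Proof. by rewrite /tmap2 tliftE /= /tpair2 tmapE. Qed.
End Map2.

Section Assoc.
Variables U V W : lmodType k.

Definition tassoc_fun (x : tensor U V) (w : W) : tensor U (tensor V W) :=
  tmap idfun (applyr (@ptens k V W) w) x.
Fact tassoc_is_bilinear : bilinear_for *:%R *:%R tassoc_fun.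
Proof.
split=> [w a x x'|x a w w']; rewrite /tassoc_fun; first by rewrite linearP.
elim/tensor_ind: x => [u v|b x z IHx IHz].
  by rewrite !tmapE /= !linearPr.
by rewrite !linearP /= IHx IHz linear_comm.
Qed.
HB.instance Definition _ := bilinear_isBilinear.Build k (tensor U V) W
  (tensor U (tensor V W)) _ _ tassoc_fun tassoc_is_bilinear.

Definition tassoc : tensor (tensor U V) W -> tensor U (tensor V W) :=
  tlift tassoc_fun.
HB.instance Definition _ := GRing.Linear.copy tassoc (tlift tassoc_fun).

Lemma tassocE u v w : tassoc (u ⊗ v ⊗ w) = u ⊗ (v ⊗ w).
Proof. by rewrite /tassoc tliftE /= /tassoc_fun tmapE. Qed.

Definition tassocV_fun (u : U) (y : tensor V W) : tensor (tensor U V) W :=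
  tmap (ptens u) idfun y.
Fact tassocV_is_bilinear : bilinear_for *:%R *:%R tassocV_fun.
Proof.
split=> [y a u u'|u a y y']; rewrite /tassocV_fun; last by rewrite linearP.
elim/tensor_ind: y => [v w|b y z IHy IHz].
  by rewrite !tmapE /= !linearPl.
by rewrite !linearP /= IHy IHz linear_comm.
Qed.
HB.instance Definition _ := bilinear_isBilinear.Build k U (tensor V W)
  (tensor (tensor U V) W) _ _ tassocV_fun tassocV_is_bilinear.

Definition tassocV : tensor U (tensor V W) -> tensor (tensor U V) W :=
  tlift tassocV_fun.
HB.instance Definition _ := GRing.Linear.copy tassocV (tlift tassocV_fun).

Lemma tassocVE u v w : tassocV (u ⊗ (v ⊗ w)) = u ⊗ v ⊗ w.
Proof. by rewrite /tassocV tliftE /= /tassocV_fun tmapE. Qed.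
End Assoc.

Section Unit.
Variable V : lmodType k.

Definition scalel (c : k^o) (v : V) : V := c *: v.
Definition scaler (v : V) (c : k^o) : V := c *: v.

Fact scalel_is_bilinear : bilinear_for *:%R *:%R scalel.
Proof.
split=> [v a c c'|c a v v']; rewrite /scalel.
  by rewrite scalerDl (_ : a *: c = a * c :> k) // -scalerA.
by rewrite scalerDr scalerA mulrC -scalerA.
Qed.
Fact scaler_is_bilinear : bilinear_for *:%R *:%R scaler.
Proof. by split=> [c|v]; [apply: scalel_is_bilinear.2|apply: scalel_is_bilinear.1]. Qed.
HB.instance Definition _ :=
  bilinear_isBilinear.Build k k^o V V _ _ scalel scalel_is_bilinear.
HB.instance Definition _ :=
  bilinear_isBilinear.Build k V k^o V _ _ scaler scaler_is_bilinear.

Definition tlunit : tensor k^o V -> V := tlift scalel.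
Definition trunit : tensor V k^o -> V := tlift scaler.
HB.instance Definition _ := GRing.Linear.copy tlunit (tlift scalel).
HB.instance Definition _ := GRing.Linear.copy trunit (tlift scaler).

Lemma tlunitE c v : tlunit (c ⊗ v) = c *: v. Proof. exact: tliftE. Qed.
Lemma trunitE v c : trunit (v ⊗ c) = c *: v. Proof. exact: tliftE. Qed.
End Unit.

Section Algebra.
Variable A : algType k.

Fact mulr_is_bilinear : bilinear_for *:%R *:%R (@GRing.mul A).
Proof.
split=> [b a x y|x a b c]; first by rewrite mulrDl -scalerAl.
by rewrite mulrDr -scalerAr.
Qed.
HB.instance Definition _ :=
  bilinear_isBilinear.Build k A A A _ _ (@GRing.mul A) mulr_is_bilinear.
End Algebra.
End TensorMaps.

(* The antipode is not assumed to be bijective.                               *)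
Record hopfAlg (k : fieldType) := HopfAlg {
  halg :> algType k;
  hcomul : {linear halg -> tensor halg halg};
  hcounit : {lrmorphism halg -> k^o};
  hantipode : {linear halg -> halg};
  hcomulA : forall a,
    tassoc (tmap hcomul idfun (hcomul a)) = tmap idfun hcomul (hcomul a);
  hcounitl : forall a, tlunit (tmap hcounit idfun (hcomul a)) = a;
  hcounitr : forall a, trunit (tmap idfun hcounit (hcomul a)) = a;
  hcomul1 : hcomul 1 = 1 ⊗ 1;
  hcomulM : forall a b, hcomul (a * b) = tmap2 *%R *%R (hcomul a) (hcomul b);
  hantipodel : forall a,
    tlift *%R (tmap hantipode idfun (hcomul a)) = hcounit a *: 1;
  hantipoder : forall a,
    tlift *%R (tmap idfun hantipode (hcomul a)) = hcounit a *: 1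
}.

Section Categories.
Variable k : fieldType.

Record lincat := LinCat {
  obj :> Type;
  hom : obj -> obj -> lmodType k;
  idm : forall X, hom X X;
  comp : forall X Y Z, hom Y Z -> hom X Y -> hom X Z;
  comp1m : forall X Y (f : hom X Y), comp (idm Y) f = f;
  compm1 : forall X Y (f : hom X Y), comp f (idm X) = f;
  compA : forall X Y Z T (h : hom Z T) (g : hom Y Z) (f : hom X Y),
    comp h (comp g f) = comp (comp h g) f;
  comp_linearl : forall X Y Z (f : hom X Y), linear (fun g : hom Y Z => comp g f);
  comp_linearr : forall X Y Z (g : hom Y Z), linear (fun f : hom X Y => comp g f)
}.

Local Notation "g ∘ f" := (comp g f) (at level 40, left associativity).

Definition is_iso (C : lincat) (X Y : C) (f : hom X Y) : Prop :=
  exists g : hom Y X, g ∘ f = idm X /\ f ∘ g = idm Y.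

Record moncat := MonCat {
  mbase :> lincat;
  tobj : mbase -> mbase -> mbase;
  thom : forall X X' Y Y' : mbase,
    hom X X' -> hom Y Y' -> hom (tobj X Y) (tobj X' Y');
  tunit : mbase;
  assoc : forall X Y Z : mbase,
    hom (tobj (tobj X Y) Z) (tobj X (tobj Y Z));
  lunit : forall X : mbase, hom (tobj tunit X) X;
  runit : forall X : mbase, hom (tobj X tunit) X;
  thom1 : forall X Y : mbase, thom (idm X) (idm Y) = idm (tobj X Y);
  thom_comp : forall (X X' X'' Y Y' Y'' : mbase)
      (f' : hom X' X'') (f : hom X X') (g' : hom Y' Y'') (g : hom Y Y'),
    thom (f' ∘ f) (g' ∘ g) = thom f' g' ∘ thom f g;
  thom_linearl : forall (X X' Y Y' : mbase) (g : hom Y Y'),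
    linear (fun f : hom X X' => thom f g);
  thom_linearr : forall (X X' Y Y' : mbase) (f : hom X X'),
    linear (fun g : hom Y Y' => thom f g);
  assoc_iso : forall X Y Z, is_iso (assoc X Y Z);
  lunit_iso : forall X, is_iso (lunit X);
  runit_iso : forall X, is_iso (runit X);
  assoc_nat : forall (X X' Y Y' Z Z' : mbase)
      (f : hom X X') (g : hom Y Y') (h : hom Z Z'),
    assoc X' Y' Z' ∘ thom (thom f g) h = thom f (thom g h) ∘ assoc X Y Z;
  lunit_nat : forall (X Y : mbase) (f : hom X Y),
    lunit Y ∘ thom (idm tunit) f = f ∘ lunit X;
  runit_nat : forall (X Y : mbase) (f : hom X Y),
    runit Y ∘ thom f (idm tunit) = f ∘ runit X;
  pentagon : forall X Y Z T : mbase,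
    assoc X Y (tobj Z T) ∘ assoc (tobj X Y) Z T =
    thom (idm X) (assoc Y Z T) ∘ assoc X (tobj Y Z) T
      ∘ thom (assoc X Y Z) (idm T);
  triangle : forall X Y : mbase,
    thom (idm X) (lunit Y) ∘ assoc X tunit Y = thom (runit X) (idm Y)
}.

Record linfunctor (C D : lincat) := LinFunctor {
  fobj :> C -> D;
  fhom : forall X Y : C, hom X Y -> hom (fobj X) (fobj Y);
  fhom1 : forall X, fhom (idm X) = idm (fobj X);
  fhom_comp : forall (X Y Z : C) (g : hom Y Z) (f : hom X Y),
    fhom (g ∘ f) = fhom g ∘ fhom f;
  fhom_linear : forall X Y : C, linear (@fhom X Y)
}.

Program Definition idfunctor (C : lincat) : linfunctor C C :=
  @LinFunctor C C id (fun X Y f => f) _ _ _.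
Next Obligation. by []. Qed.

Program Definition compfunctor (C D E : lincat)
    (G : linfunctor D E) (F : linfunctor C D) : linfunctor C E :=
  @LinFunctor C E (fun X => G (F X)) (fun X Y f => fhom G (fhom F f)) _ _ _.
Next Obligation. by rewrite !fhom1. Qed.
Next Obligation. by rewrite !fhom_comp. Qed.
Next Obligation. by move=> a f g; rewrite !fhom_linear. Qed.

Definition nat_isomorphic (C D : lincat) (F G : linfunctor C D) : Prop :=
  exists eta : forall X : C, hom (F X) (G X),
    (forall X, is_iso (eta X)) /\
    (forall (X Y : C) (f : hom X Y), eta Y ∘ fhom F f = fhom G f ∘ eta X).

Definition is_equivalence (C D : lincat) (F : linfunctor C D) : Prop :=
  exists G : linfunctor D C,
    nat_isomorphic (compfunctor G F) (idfunctor C) /\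
    nat_isomorphic (compfunctor F G) (idfunctor D).

Record monfunctor (C D : moncat) := MonFunctor {
  mfun :> linfunctor C D;
  mon2 : forall X Y : C, hom (tobj (mfun X) (mfun Y)) (mfun (tobj X Y));
  mon0 : hom (tunit D) (mfun (tunit C));
  mon2_iso : forall X Y, is_iso (mon2 X Y);
  mon0_iso : is_iso mon0;
  mon2_nat : forall (X X' Y Y' : C) (f : hom X X') (g : hom Y Y'),
    mon2 X' Y' ∘ thom (fhom mfun f) (fhom mfun g) =
    fhom mfun (thom f g) ∘ mon2 X Y;
  mon_assoc : forall X Y Z : C,
    fhom mfun (assoc X Y Z) ∘ mon2 (tobj X Y) Z
      ∘ thom (mon2 X Y) (idm (mfun Z)) =
    mon2 X (tobj Y Z) ∘ thom (idm (mfun X)) (mon2 Y Z)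
      ∘ assoc (mfun X) (mfun Y) (mfun Z);
  mon_lunit : forall X : C,
    fhom mfun (lunit X) ∘ mon2 (tunit C) X ∘ thom mon0 (idm (mfun X)) =
    lunit (mfun X);
  mon_runit : forall X : C,
    fhom mfun (runit X) ∘ mon2 X (tunit C) ∘ thom (idm (mfun X)) mon0 =
    runit (mfun X)
}.

Definition monoidally_equivalent (C D : moncat) : Prop :=
  exists F : monfunctor C D, is_equivalence F.

End Categories.

Section Comodule.
Variables (k : fieldType) (A : hopfAlg k).

Record comod := Comod {
  cmod :> lmodType k;
  coact : {linear cmod -> tensor cmod A};
  coactA : forall v,
    tassoc (tmap coact idfun (coact v)) = tmap idfun (hcomul A) (coact v);
  coact1 : forall v, trunit (tmap idfun (hcounit A) (coact v)) = v
}.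

Section Hom.
Variables V W : comod.

Definition comod_hom_pred : {pred V -> W} := fun f =>
  `[< linear f /\ forall v, coact W (f v) = tmap f idfun (coact V v) >].

Record comod_hom := ComodHom {
  hom_fun :> V -> W;
  hom_funP : hom_fun \in comod_hom_pred
}.
HB.instance Definition _ := [isSub for hom_fun].
HB.instance Definition _ := [Choice of comod_hom by <:].

Lemma comod_hom_linear (f : comod_hom) : linear f.
Proof. by have /asboolP[] := hom_funP f. Qed.
HB.instance Definition _ (f : comod_hom) :=
  GRing.isLinear.Build k V W _ (hom_fun f) (comod_hom_linear f).

Lemma comod_homP (f : comod_hom) v : coact W (f v) = tmap f idfun (coact V v).
Proof. by have /asboolP[] := hom_funP f. Qed.

Lemma comod_hom_eq (f g : comod_hom) : f =1 g -> f = g.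
Proof. by move=> fg; apply/val_inj/funext. Qed.

Lemma comod_hom_mem (f : {linear V -> W}) :
  (forall v, coact W (f v) = tmap f idfun (coact V v)) ->
  (f : V -> W) \in comod_hom_pred.
Proof. by move=> fP; apply/asboolP; split=> //; apply: linearP. Qed.

Fact comod_hom_submod : submod_closed comod_hom_pred.
Proof.
split=> [|a f g /asboolP[lf cf] /asboolP[lg cg]].
  apply: (@comod_hom_mem \0) => v; rewrite linear0.
  rewrite (@tmap_linearl _ _ _ _ _ (-1) \0 \0 \0 idfun).
    by rewrite scaleN1r addNr.
  by move=> w; rewrite /= scaler0 addr0.
pose F : {linear V -> W} := HB.pack f (GRing.isLinear.Build k V W _ f lf).
pose G : {linear V -> W} := HB.pack g (GRing.isLinear.Build k V W _ g lg).
apply: (@comod_hom_mem (a \*: F \+ G)) => v.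
by rewrite (@tmap_linearl _ _ _ _ _ a F G) //= linearP /= cf cg.
Qed.
HB.instance Definition _ :=
  GRing.isSubmodClosed.Build k (V -> W) comod_hom_pred
    (GRing.submod_closed_semi comod_hom_submod).
HB.instance Definition _ := [SubChoice_isSubLmodule of comod_hom by <:].
End Hom.

Fact comod_idmP (V : comod) v :
  coact V (@idfun V v) = tmap idfun idfun (coact V v).
Proof.
rewrite /=; elim/tensor_indD: (coact V v) => [w a|x y IHx IHy].
  by rewrite tmapE.
by rewrite linearD /= -IHx -IHy.
Qed.
Definition comod_idm (V : comod) : comod_hom V V :=
  ComodHom (comod_hom_mem (@comod_idmP V)).

Fact comod_compP (U V W : comod) (g : comod_hom V W) (f : comod_hom U V) u :
  coact W ((g \o f) u) = tmap (g \o f) idfun (coact U u).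
Proof.
rewrite /= !comod_homP.
elim/tensor_indD: (coact U u) => [v a|x y IHx IHy]; first by rewrite !tmapE.
by rewrite !linearD /= IHx IHy.
Qed.
Definition comod_comp (U V W : comod) (g : comod_hom V W) (f : comod_hom U V) :
    comod_hom U W :=
  ComodHom (comod_hom_mem (comod_compP g f)).

Program Definition comod_lincat : lincat k :=
  @LinCat k comod comod_hom comod_idm comod_comp _ _ _ _ _.
Next Obligation. by apply: comod_hom_eq. Qed.
Next Obligation. by apply: comod_hom_eq. Qed.
Next Obligation. by apply: comod_hom_eq. Qed.
Next Obligation. by move=> a g g'; apply: comod_hom_eq. Qed.
Next Obligation.
by move=> a f f'; apply: comod_hom_eq => x /=; rewrite linearP.
Qed.

Lemma comod_iso (V W : comod) (f : comod_hom V W) (g : {linear W -> V}) :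
  cancel f g -> cancel g f -> is_iso (f : hom (V : comod_lincat) W).
Proof.
move=> fK gK.
have gP w : coact V (g w) = tmap g idfun (coact W w).
  rewrite -{2}[w]gK comod_homP.
  elim/tensor_indD: (coact V (g w)) => [v a|x y IHx IHy].
    by rewrite !tmapE /= fK.
  by rewrite !linearD /= -IHx -IHy.
exists (ComodHom (comod_hom_mem gP)).
by split; apply: comod_hom_eq.
Qed.

Section Tensor.
Variables V W : comod.

Definition tcoact_fun (v : V) (w : W) : tensor (tensor V W) A :=
  tmap2 (@ptens k V W) *%R (coact V v) (coact W w).
Fact tcoact_is_bilinear : bilinear_for *:%R *:%R tcoact_fun.
Proof.
by split=> [w a v v'|v a w w']; rewrite /tcoact_fun linearP ?linearPl ?linearPr.
Qed.
HB.instance Definition _ := bilinear_isBilinear.Build k V W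
  (tensor (tensor V W) A) _ _ tcoact_fun tcoact_is_bilinear.

Definition tcoact : tensor V W -> tensor (tensor V W) A := tlift tcoact_fun.
HB.instance Definition _ := GRing.Linear.copy tcoact (tlift tcoact_fun).

Lemma tcoactE v w :
  tcoact (v ⊗ w) = tmap2 (@ptens k V W) *%R (coact V v) (coact W w).
Proof. exact: tliftE. Qed.

Local Notation mul2 := (tmap2 ( *%R : A -> A -> A) ( *%R : A -> A -> A)).

Fact tcoactA x :
  tassoc (tmap tcoact idfun (tcoact x)) = tmap idfun (hcomul A) (tcoact x).
Proof.
elim/tensor_indD: x => [v w|x y IHx IHy]; last by rewrite !linearD /= IHx IHy.
have mL x y : tassoc (tmap tcoact idfun (tmap2 (@ptens k V W) *%R x y)) =
    tmap2 (@ptens k V W) mul2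
      (tassoc (tmap (coact V) idfun x)) (tassoc (tmap (coact W) idfun y)).
  elim/tensor_indD: x => [v1 a|x x' IHx IHx']; last first.
    by rewrite !(linearDl, linearD) /= IHx IHx'.
  elim/tensor_indD: y => [w1 b|y y' IHy IHy']; last first.
    by rewrite !(linearDr, linearD) /= IHy IHy'.
  rewrite tmap2E !tmapE /= tcoactE.
  elim/tensor_indD: (coact V v1) => [v2 c|p p' IHp IHp']; last first.
    by rewrite !(linearDl, linearD) /= IHp IHp'.
  elim/tensor_indD: (coact W w1) => [w2 d|q q' IHq IHq']; last first.
    by rewrite linearDr !(linearDl, linearD) /= IHq IHq' linearDr.
  by rewrite tmap2E !tassocE tmap2E /= tmap2E.
have mR x y : tmap idfun (hcomul A) (tmap2 (@ptens k V W) *%R x y) =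
    tmap2 (@ptens k V W) mul2
      (tmap idfun (hcomul A) x) (tmap idfun (hcomul A) y).
  elim/tensor_indD: x => [v1 a|x x' IHx IHx']; last first.
    by rewrite !(linearDl, linearD) /= IHx IHx'.
  elim/tensor_indD: y => [w1 b|y y' IHy IHy']; last first.
    by rewrite !(linearDr, linearD) /= IHy IHy'.
  by rewrite tmap2E !tmapE tmap2E hcomulM.
by rewrite tcoactE mL mR !coactA.
Qed.

Fact tcoact1 x : trunit (tmap idfun (hcounit A) (tcoact x)) = x.
Proof.
elim/tensor_indD: x => [v w|x y IHx IHy]; last by rewrite !linearD /= IHx IHy.
rewrite tcoactE -[in RHS](coact1 v) -[in RHS](coact1 w).
elim/tensor_indD: (coact V v) => [v1 a|x x' IHx IHx']; last first.
  by rewrite !(linearDl, linearD) /= IHx IHx'.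
elim/tensor_indD: (coact W w) => [w1 b|y y' IHy IHy']; last first.
  by rewrite !(linearDr, linearD) /= IHy IHy'.
by rewrite tmap2E !tmapE !trunitE /= rmorphM linearZl_LR linearZr_LR /= scalerA.
Qed.

Definition comod_tensor : comod := Comod tcoactA tcoact1.
End Tensor.

Definition ucoact (c : k^o) : tensor k^o A := c ⊗ (1 : A).
Fact ucoact_is_linear : linear ucoact.
Proof. by move=> a c c'; rewrite /ucoact linearPl. Qed.
HB.instance Definition _ :=
  GRing.isLinear.Build k k^o (tensor k^o A) _ ucoact ucoact_is_linear.

Fact ucoactA c :
  tassoc (tmap ucoact idfun (ucoact c)) = tmap idfun (hcomul A) (ucoact c).
Proof. by rewrite !tmapE /= tassocE hcomul1. Qed.
Fact ucoact1 c : trunit (tmap idfun (hcounit A) (ucoact c)) = c.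
Proof. by rewrite tmapE trunitE /= rmorph1 scale1r. Qed.

Definition comod_unit : comod := Comod ucoactA ucoact1.

Fact comod_thomP (V V' W W' : comod)
    (f : comod_hom V V') (g : comod_hom W W') x :
  coact (comod_tensor V' W') (tmap f g x) =
  tmap (tmap f g) idfun (coact (comod_tensor V W) x).
Proof.
elim/tensor_indD: x => [v w|x y IHx IHy]; last by rewrite !linearD /= IHx IHy.
rewrite tmapE /= !tcoactE !comod_homP.
elim/tensor_indD: (coact V v) => [v1 a|x x' IHx IHx']; last first.
  by rewrite !(linearDl, linearD) /= IHx IHx'.
elim/tensor_indD: (coact W w) => [w1 b|y y' IHy IHy']; last first.
  by rewrite !(linearDr, linearD) /= IHy IHy'.
by rewrite !tmapE !tmap2E !tmapE /= tmapE.
Qed.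
Definition comod_thom (V V' W W' : comod)
    (f : comod_hom V V') (g : comod_hom W W') :
    comod_hom (comod_tensor V W) (comod_tensor V' W') :=
  ComodHom (comod_hom_mem (V := comod_tensor V W) (W := comod_tensor V' W') (f := tmap f g)
    (comod_thomP f g)).

Fact comod_assocP (U V W : comod) x :
  coact (comod_tensor U (comod_tensor V W)) (tassoc x) =
  tmap (@tassoc k U V W) idfun (coact (comod_tensor (comod_tensor U V) W) x).
Proof.
elim/tensor_indD: x => [x w|x y IHx IHy]; last by rewrite !linearD /= IHx IHy.
elim/tensor_indD: x => [u v|x y IHx IHy]; last first.
  by rewrite !(linearDl, linearD) /= IHx IHy.
rewrite tassocE /= !tcoactE /= !tcoactE.
elim/tensor_indD: (coact U u) => [u1 a|x x' IHx IHx']; last first.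
  by rewrite !(linearDl, linearD) /= IHx IHx'.
elim/tensor_indD: (coact V v) => [v1 b|y y' IHy IHy']; last first.
  by rewrite !(linearDl, linearDr, linearD) /= IHy IHy'.
elim/tensor_indD: (coact W w) => [w1 c|z z' IHz IHz']; last first.
  by rewrite !(linearDr, linearD) /= IHz IHz'.
by rewrite !tmap2E tmapE /= tassocE mulrA.
Qed.
Definition comod_assoc (U V W : comod) :
    comod_hom (comod_tensor (comod_tensor U V) W)
              (comod_tensor U (comod_tensor V W)) :=
  ComodHom (comod_hom_mem (V := comod_tensor (comod_tensor U V) W)
    (W := comod_tensor U (comod_tensor V W)) (f := @tassoc k U V W)
    (@comod_assocP U V W)).

Fact comod_lunitP (V : comod) x :
  coact V (tlunit x) =
  tmap (@tlunit k V) idfun (coact (comod_tensor comod_unit V) x).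
Proof.
elim/tensor_indD: x => [c v|x y IHx IHy]; last by rewrite !linearD /= IHx IHy.
rewrite tlunitE /= tcoactE linearZ /=.
elim/tensor_indD: (coact V v) => [v1 a|y y' IHy IHy']; last first.
  by rewrite scalerDr !(linearDr, linearD) /= IHy IHy'.
by rewrite tmap2E tmapE /= tlunitE mul1r linearZl_LR.
Qed.
Definition comod_lunit (V : comod) : comod_hom (comod_tensor comod_unit V) V :=
  ComodHom (comod_hom_mem (V := comod_tensor comod_unit V) (f := @tlunit k V)
    (@comod_lunitP V)).

Fact comod_runitP (V : comod) x :
  coact V (trunit x) =
  tmap (@trunit k V) idfun (coact (comod_tensor V comod_unit) x).
Proof.
elim/tensor_indD: x => [v c|x y IHx IHy]; last by rewrite !linearD /= IHx IHy.
rewrite trunitE /= tcoactE linearZ /=.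
elim/tensor_indD: (coact V v) => [v1 a|y y' IHy IHy']; last first.
  by rewrite scalerDr !(linearDl, linearD) /= IHy IHy'.
by rewrite tmap2E tmapE /= trunitE mulr1 linearZl_LR.
Qed.
Definition comod_runit (V : comod) : comod_hom (comod_tensor V comod_unit) V :=
  ComodHom (comod_hom_mem (V := comod_tensor V comod_unit) (f := @trunit k V)
    (@comod_runitP V)).

Program Definition comod_moncat : moncat k :=
  @MonCat k comod_lincat comod_tensor comod_thom comod_unit
    comod_assoc comod_lunit comod_runit _ _ _ _ _ _ _ _ _ _ _ _.
Next Obligation.
apply: comod_hom_eq => x /=.
by elim/tensor_indD: x => [v w|x y IHx IHy];
  rewrite ?tmapE // linearD /= IHx IHy.
Qed.
Next Obligation.
apply: comod_hom_eq => x /=.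
by elim/tensor_indD: x => [v w|x y IHx IHy];
  rewrite ?tmapE //= !linearD /= IHx IHy.
Qed.
Next Obligation.
by move=> a f f'; apply: comod_hom_eq => x /=; apply: tmap_linearl.
Qed.
Next Obligation.
by move=> a g g'; apply: comod_hom_eq => x /=; apply: tmap_linearr.
Qed.
Next Obligation.
apply: (@comod_iso (comod_tensor (comod_tensor X Y) Z)
  (comod_tensor X (comod_tensor Y Z)) (comod_assoc X Y Z) (@tassocV k X Y Z)) => x /=.
  elim/tensor_indD: x => [x w|x y IHx IHy]; last first.
    by rewrite !linearD /= IHx IHy.
  elim/tensor_indD: x => [u v|x y IHx IHy]; last first.
    by rewrite linearDl !linearD /= IHx IHy.
  by rewrite tassocE tassocVE.
elim/tensor_indD: x => [u x|x y IHx IHy]; last first.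
  by rewrite !linearD /= IHx IHy.
elim/tensor_indD: x => [v w|x y IHx IHy]; last first.
  by rewrite linearDr !linearD /= IHx IHy.
by rewrite tassocVE tassocE.
Qed.
Next Obligation.
apply: (@comod_iso (comod_tensor comod_unit X) X (comod_lunit X)
  (ptens (1 : k^o))) => x /=.
  elim/tensor_indD: x => [c v|x y IHx IHy]; last first.
    by rewrite !linearD /= IHx IHy.
  rewrite tlunitE linearZr_LR /= -linearZl_LR /=; congr (_ ⊗ _).
  exact: mulr1.
by rewrite tlunitE scale1r.
Qed.
Next Obligation.
apply: (@comod_iso (comod_tensor X comod_unit) X (comod_runit X)
  (applyr (@ptens k X k^o) 1)) => x /=.
  elim/tensor_indD: x => [v c|x y IHx IHy]; last first.
    by rewrite linearD linearDl /= IHx IHy.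
  rewrite trunitE linearZl_LR /= -linearZr_LR /=; congr (_ ⊗ _).
  exact: mulr1.
by rewrite trunitE scale1r.
Qed.
Next Obligation.
apply: comod_hom_eq => x /=.
elim/tensor_indD: x => [x w|x y IHx IHy]; last by rewrite !linearD /= IHx IHy.
elim/tensor_indD: x => [u v|x y IHx IHy]; last first.
  by rewrite linearDl !linearD /= IHx IHy.
by rewrite tassocE !tmapE /= !tmapE tassocE.
Qed.
Next Obligation.
apply: comod_hom_eq => x /=.
elim/tensor_indD: x => [c v|x y IHx IHy]; last by rewrite !linearD /= IHx IHy.
by rewrite tmapE !tlunitE linearZ.
Qed.
Next Obligation.
apply: comod_hom_eq => x /=.
elim/tensor_indD: x => [v c|x y IHx IHy]; last by rewrite !linearD /= IHx IHy.
by rewrite tmapE !trunitE linearZ.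
Qed.
Next Obligation.
apply: comod_hom_eq => x /=.
elim/tensor_indD: x => [x t|x y IHx IHy]; last by rewrite !linearD /= IHx IHy.
elim/tensor_indD: x => [x z|x y IHx IHy]; last first.
  by rewrite linearDl !linearD /= IHx IHy.
elim/tensor_indD: x => [x y|x y IHx IHy]; last first.
  by rewrite !linearDl !linearD /= IHx IHy.
by rewrite !(tassocE, tmapE) /= !(tassocE, tmapE) /= tassocE.
Qed.
Next Obligation.
apply: comod_hom_eq => x /=.
elim/tensor_indD: x => [x v|x y IHx IHy]; last by rewrite !linearD /= IHx IHy.
elim/tensor_indD: x => [u c|x y IHx IHy]; last first.
  by rewrite linearDl !linearD /= IHx IHy.
by rewrite tassocE !tmapE /= tlunitE trunitE linearZl_LR linearZr_LR.
Qed.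

End Comodule.

(* None stands for infinity.                                                  *)
Definition least (P : nat -> Prop) : option nat :=
  if pselect (exists n, `[< P n >]) is left exP then Some (ex_minn exP)
  else None.

Lemma leastP (P : nat -> Prop) n :
  least P = Some n <-> P n /\ forall m, P m -> (n <= m)%N.
Proof.
rewrite /least; case: pselect => [exP|noP]; last first.
  by split=> // -[Pn _]; case: noP; exists n; apply/asboolP.
case: ex_minnP => i /asboolP Pi imin.
split=> [[<-]|[Pn nmin]]; first by split=> // m /asboolP; apply: imin.
congr Some; apply/eqP; rewrite eqn_leq nmin // andbT.
by apply: imin; apply/asboolP.
Qed.

Lemma leastNP (P : nat -> Prop) : least P = None <-> forall n, ~ P n.
Proof.
rewrite /least; case: pselect => [exP|noP].
  split=> // nP; have [n Pn] := exP.
  by case: (nP n); apply/asboolP.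
by split=> // _ n Pn; apply: noP; exists n; apply/asboolP.
Qed.

Section GlobalDimension.
Variable R : nzRingType.

Definition projective (P : lmodType R) : Prop :=
  forall (M N : lmodType R) (g : {linear M -> N}) (f : {linear P -> N}),
    (forall y, exists x, g x = y) ->
    exists h : {linear P -> M}, forall x, g (h x) = f x.

(* There is an exact sequence 0 -> P_n -> ... -> P_0 -> M -> 0 with all P_i   *)
(* projective.                                                                *)
Definition projdim_le (M : lmodType R) (n : nat) : Prop :=
  exists (P : nat -> lmodType R) (d : forall i, {linear P i.+1 -> P i})
    (e : {linear P 0%N -> M}),
    [/\ forall i, projective (P i),
        forall i, (n < i)%N -> forall x : P i, x = 0,
        forall y, exists x, e x = y,
        forall x, e x = 0 <-> exists y, d 0%N y = x &
        forall i (x : P i.+1), d i x = 0 <-> exists y, d i.+1 y = x].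

(* Supremum of the projective dimensions of the left modules.                 *)
Definition gldim : option nat :=
  least (fun n => forall M : lmodType R, projdim_le M n).
End GlobalDimension.

(* Main.v *)
From HB Require Import structures.
Require Import Defs.
From mathcomp Require Import all_boot all_algebra sesquilinear.
From mathcomp Require Import boolp.
From mathcomp Require classical_sets.
Import Defs.
Set Implicit Arguments.
Unset Strict Implicit.
Unset Printing Implicit Defensive.
Import GRing.Theory.
Local Open Scope ring_scope.

(** The global dimension of a Hopf algebra A is the projective dimension of its
    trivial module k: a module M is k ⊗ M with the diagonal action, and tensoring
    with M over k is exact and preserves projectives ([pd_le_triv_all]).  So the
    trivial modules of A and B have to be compared.

    A monoidal equivalence F sends the regular A-comodule, an algebra in the
    category of comodules, to an algebra R with a right B-coaction; the
    comultiplication of A becomes a left A-coaction on R, and R is a bi-Galois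
    algebra for A and B ([monoidally_equivalent_bigalois]).  This is where the
    monoidal structure enters: X ⊗ A with the diagonal coaction is a copower of A
    ([theta_iso]), and equivalences preserve copowers ([cmap_bij]).

    Regard R as a module over Q = R ⊗ R^op.  The left coaction makes N ⊗ R a
    Q-module for every A-module N, and by the Galois property N |-> N ⊗ R is
    induction along an algebra embedding A -> Q.  It is exact, preserves
    projectives, and sends k to R, so pd_Q(R) <= pd_A(k).  For the converse,
    suppose that 0 -> K -> P -> L -> 0 is exact with P and L ⊗ R projective.  The
    induced sequence splits over Q.  If moreover K is a summand of a restricted
    Q-module, adjunction carries the splitting back to A, and L is projective
    ([ind_projective_descent]).  Projective modules are summands of restricted ones
    because Q is free over A ([projective_restriction]).  Hence, if pd_A(k) is
    finite, one starts at the last term of a finite resolution and obtains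
    pd_A(k) <= pd_Q(R) ([pd_le_descent]).

    The same applies to B on the right, that is, to the left modules of the Hopf
    algebra with opposite product and coproduct.  Passing between left and right
    is one more instance, with R = A: here A -> A ⊗ A^op has a retraction of
    algebras, every module is a restricted bimodule, and the descent applies to all
    of them ([pd_le_op]). *)

(** * Linear retractions over a field *)

Definition mklin (R : nzRingType) (V W : lmodType R) (f : V -> W)
    (fL : linear f) : {linear V -> W} :=
  HB.pack f (GRing.isLinear.Build R V W _ f fL).

Section Retraction.
Import classical_sets.
Local Open Scope classical_set_scope.
Variables (k : fieldType) (V W : lmodType k) (i : {linear V -> W}).
Hypothesis i_inj : injective i.

(** Graphs of linear partial retractions of [i]. The last clause is conditional
    so that the empty set, the union of the empty chain in Zorn's lemma,
    qualifies. *)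
Let good (S : set (W * V)) :=
  [/\ forall c p q, S p -> S q -> S (c *: p + q),
      forall v, S (0, v) -> v = 0 &
      S !=set0 -> forall v, S (i v, v)].

(** A maximal partial retraction is total: a vector outside its domain could
    still be sent to 0. *)
Lemma linear_retraction : exists r : {linear W -> V}, cancel i r.
Proof.
have [F Fgood Ftot|S [[Slin Sfun Si] Smax]] := @Zorn_bigcup _ good.
  split=> [c p q [X FX Xp] [Y FY Yq]|v [X FX X0v]|[p [X FX Xp]] v].
  - have [XY|YX] := Ftot _ _ FX FY.
      by exists Y => //; have [Ylin _ _] := Fgood _ FY; apply: Ylin => //; apply: XY.
    by exists X => //; have [Xlin _ _] := Fgood _ FX; apply: Xlin => //; apply: YX.
  - by have [_ + _] := Fgood _ FX; apply.
  - by exists X => //; have [_ _ Xi] := Fgood _ FX; apply: Xi; exists p.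
(* A maximal graph is not empty: the graph of the inverse of [i] is good. *)
have {}Si v : S (i v, v).
  apply: Si; apply: contrapT => S0.
  pose T : set (W * V) := [set p | p.1 = i p.2].
  have TP p : T p -> p.1 = i p.2 by [].
  apply: (Smax T).
    rewrite properEneq; split; last by move=> p Sp; case: S0; exists p.
    apply/eqP => ST; case: S0; exists (0, 0).
    by rewrite ST /T /= linear0.
  split=> [c p q /TP pE /TP qE|u /TP /= uE|_ u]; rewrite /T //=.
    by rewrite pE qE linearP.
  by apply: i_inj; rewrite -uE linear0.
have S0 : S (0, 0) by rewrite -{1}(linear0 i).
have eqS p q : p = q -> S p -> S q by move=> ->.
(* Otherwise the graph extends to the span of [w], with [w] sent to 0. *)
have Sdom w : exists v, S (w, v).
  apply: contrapT => Sw.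
  pose T : set (W * V) := [set p | exists c, S (p.1 - c *: w, p.2)].
  apply: (Smax T).
    rewrite properEneq; split.
      apply/eqP => ST; apply: Sw; exists 0; rewrite ST /T; exists 1 => /=.
      by rewrite scale1r subrr.
    by move=> [w' v'] Sp; exists 0; rewrite scale0r subr0.
  split=> [a p q [b Sp] [c Sq]|v [c /= Sv]|_ v].
  - exists (a * b + c).
    rewrite /T /=; apply: eqS (Slin a _ _ Sp Sq); congr (_, _) => /=.
    by rewrite scalerBr scalerDl opprD addrACA -scalerA.
  - have [c0|c0] := eqVneq c 0.
      by apply: Sfun; move: Sv; rewrite c0 scale0r subr0.
    case: Sw; exists (- c^-1 *: v).
    apply: eqS (Slin (- c^-1) _ _ Sv S0); congr (_, _) => /=; rewrite ?addr0 //.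
    by rewrite sub0r scalerN scaleNr opprK scalerA mulVf // scale1r.
  - by exists 0; rewrite scale0r subr0; exact: Si.
have [r rP] := choice Sdom.
have Suniq w v v' : S (w, v) -> S (w, v') -> v = v'.
  move=> Sv Sv'; have := Slin (-1) _ _ Sv' Sv.
  have -> : -1 *: (w, v') + (w, v) = (0, v - v') :> W * V.
    by congr (_, _) => /=; rewrite scaleN1r ?addNr // addrC.
  by move/Sfun/eqP; rewrite subr_eq0 => /eqP.
have rL : linear r.
  by move=> a x y; apply: Suniq (rP _) _; exact: Slin (rP x) (rP y).
by exists (mklin rL) => v /=; apply: Suniq (rP _) (Si v).
Qed.
End Retraction.

Lemma functional_at (k : fieldType) (V : lmodType k) (v : V) :
  v != 0 -> exists f : {linear V -> k^o}, f v = 1.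
Proof.
move=> v0.
have iL : linear (fun c : k^o => c *: v).
  by move=> a x y; rewrite scalerDl scalerA.
have [|r rK] := @linear_retraction _ _ _ (mklin iL).
  move=> x y /= /eqP; rewrite -subr_eq0 -scalerBl scaler_eq0 (negPf v0) orbF.
  by rewrite subr_eq0 => /eqP.
by exists r; have := rK 1; rewrite /= scale1r.
Qed.

(** * Projective dimension by syzygies *)

Section Kernel.
Variables (R : nzRingType) (M N : lmodType R) (f : {linear M -> N}).

Definition ker_pred : {pred M} := fun x => f x == 0.
Record kermod := KerMod { ker_val : M; ker_valP : ker_val \in ker_pred }.
HB.instance Definition _ := [isSub for ker_val].
HB.instance Definition _ := [Choice of kermod by <:].

Fact ker_submod : submod_closed ker_pred.
Proof.
split=> [|a x y /eqP fx /eqP fy]; apply/eqP; first exact: linear0.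
by rewrite linearP fx fy scaler0 addr0.
Qed.
HB.instance Definition _ :=
  GRing.isSubmodClosed.Build R M ker_pred
    (GRing.submod_closed_semi ker_submod).
HB.instance Definition _ := [SubChoice_isSubLmodule of kermod by <:].

Fact ker_val_linear : linear ker_val.
Proof. by []. Qed.
HB.instance Definition _ :=
  GRing.isLinear.Build R kermod M _ ker_val ker_val_linear.

Lemma ker_val0 (x : kermod) : f (ker_val x) = 0.
Proof. exact/eqP/(ker_valP x). Qed.

Lemma ker_val_inj : injective ker_val. Proof. exact: val_inj. Qed.

Lemma ker_lift (L : lmodType R) (g : {linear L -> M}) :
  (forall x, f (g x) = 0) ->
  exists h : {linear L -> kermod}, forall x, ker_val (h x) = g x.
Proof.
move=> fg; have gP x : g x \in ker_pred by apply/eqP.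
have hL : linear (fun x => KerMod (gP x)).
  by move=> a x y; apply: val_inj; rewrite /= linearP.
by exists (mklin hL).
Qed.
End Kernel.
Arguments ker_val {R M N f}.

Section ProjectiveDimension.
Variable R : nzRingType.
Implicit Types K L M N P X : lmodType R.

Definition surj (S T : Type) (f : S -> T) := forall y, exists x, f x = y.

Definition short_exact K P M (i : {linear K -> P}) (p : {linear P -> M}) :=
  [/\ injective i, surj p & forall x, p x = 0 <-> exists y, i y = x].

Lemma ker_short_exact P M (p : {linear P -> M}) :
  surj p -> short_exact (ker_val : {linear kermod p -> P}) p.
Proof.
move=> ps; split=> // [|x]; first exact: ker_val_inj.
split=> [px|[y <-]]; last exact: ker_val0.
by exists (KerMod (introT eqP px : x \in ker_pred p)).
Qed.

Lemma short_exact_factor K P M X (i : {linear K -> P}) (p : {linear P -> M})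
    (f : {linear X -> P}) :
  short_exact i p -> (forall x, p (f x) = 0) ->
  exists g : {linear X -> K}, forall x, i (g x) = f x.
Proof.
case=> i_inj _ ex pf0; have fi x : exists y, i y = f x by apply/ex.
have [g gP] := choice fi.
have gL : linear g by move=> a x y; apply: i_inj; rewrite linearP !gP linearP.
by exists (mklin gL).
Qed.

Lemma short_exact_descend K P M X (i : {linear K -> P}) (p : {linear P -> M})
    (f : {linear P -> X}) :
  short_exact i p -> (forall y, f (i y) = 0) ->
  exists g : {linear M -> X}, forall x, g (p x) = f x.
Proof.
case=> _ ps ex fi0; have [s sP] := choice ps.
have fE x y : p x = p y -> f x = f y.
  move=> pxy; have [z zE] : exists z, i z = x - y.
    by apply/ex; rewrite linearB /= pxy subrr.
  by apply/eqP; rewrite -subr_eq0 -linearB /= -zE fi0.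
have gL : linear (f \o s).
  by move=> a x y /=; rewrite -linearP; apply: fE; rewrite sP linearP /= !sP.
by exists (mklin gL) => x /=; apply: fE; rewrite sP.
Qed.

Definition retract N M :=
  exists (s : {linear N -> M}) (r : {linear M -> N}), cancel s r.

Lemma retract_trans N M L : retract N M -> retract M L -> retract N L.
Proof.
move=> [s [r rK]] [s' [r' rK']]; exists (s' \o s), (r \o r') => x /=.
by rewrite rK' rK.
Qed.

Lemma linear_inverse M N (f : {linear M -> N}) :
  injective f -> surj f -> exists g : {linear N -> M}, cancel f g /\ cancel g f.
Proof.
move=> fi fs; have [g gP] := choice fs.
have gL : linear g by move=> a x y; apply: fi; rewrite linearP !gP.
by exists (mklin gL); split=> [x|x] //=; apply: fi; rewrite gP.
Qed.

Lemma retract_bij M N (f : {linear M -> N}) :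
  injective f -> surj f -> retract N M.
Proof.
by move=> fi fs; have [g [fK gK]] := linear_inverse fi fs; exists g, f.
Qed.

Lemma projective_retract N M : retract N M -> projective M -> projective N.
Proof.
move=> [s [r rK]] Mp X Y g f gs.
have [h hP] := Mp X Y g (f \o r) gs.
by exists (h \o s) => x; rewrite /= hP /= rK.
Qed.

Lemma projective_section P M (p : {linear M -> P}) :
  projective P -> surj p -> exists s : {linear P -> M}, cancel s p.
Proof. by move=> Pp ps; have [s sP] := Pp _ _ p idfun ps; exists s. Qed.

Lemma split_retraction K P M (i : {linear K -> P}) (p : {linear P -> M})
    (s : {linear M -> P}) :
  short_exact i p -> cancel s p ->
  exists r : {linear P -> K}, cancel i r /\ forall x, x = i (r x) + s (p x).
Proof.
move=> ex sK; have [i_inj _ kerP] := ex.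
have fL : linear (fun x => x - s (p x)).
  by move=> a x y; rewrite (linearP p) (linearP s) scalerBr opprD addrACA.
have [|r rP] := short_exact_factor (f := mklin fL) ex.
  by move=> x; rewrite /= linearB /= sK subrr.
exists r; split=> [y|x]; last by rewrite rP /= addrNK.
apply: i_inj; rewrite rP /= (_ : p (i y) = 0) ?(linear0 s) ?subr0 //.
by apply/kerP; exists y.
Qed.

(** A form of [projdim_le] suited to induction: it peels off one syzygy instead
    of giving a whole resolution. *)
Fixpoint pd_le (m : nat) M : Prop :=
  if m is m'.+1 then
    exists (P K : lmodType R) (i : {linear K -> P}) (p : {linear P -> M}),
      [/\ short_exact i p, projective P & pd_le m' K]
  else projective M.

Lemma pd_le_iso m M N (f : {linear M -> N}) :
  injective f -> surj f -> pd_le m M -> pd_le m N.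
Proof.
move=> fi fs; case: m => [|m] /=; first exact/projective_retract/(retract_bij fi).
move=> [P [K [i [p [[ii ps ker] Pp Km]]]]].
exists P, K, i, (f \o p); split=> //; split=> // [y|x] /=.
  by have [x <-] := fs y; have [z <-] := ps x; exists z.
rewrite -ker; split=> [|->]; last by rewrite linear0.
by rewrite -[in X in X -> _](linear0 f) => /fi.
Qed.

(** As the sequence splits, X is K ⊕ P; if a projective T maps onto K, then T ⊕
    P maps onto X with the same kernel. *)
Lemma pd_le_extension m K X P (i : {linear K -> X}) (p : {linear X -> P}) :
  short_exact i p -> projective P -> pd_le m K -> pd_le m X.
Proof.
move=> ex Pp; have [_ ps _] := ex; have [s sK] := projective_section Pp ps.
have [r [rK rP]] := split_retraction ex sK.
have [_ _ kerP] := ex; have pi y : p (i y) = 0 by apply/kerP; exists y.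
case: m => [Kp Y Z g f gs|m [T [L [j [q [[ji qs jq] Tp Lm]]]]]] /=.
  have [h1 h1P] := Kp _ _ g (f \o i) gs.
  have [h2 h2P] := Pp _ _ g (f \o s) gs.
  have hL : linear (fun x => h1 (r x) + h2 (p x)).
    by move=> a x y; rewrite !linearP scalerDr addrACA.
  exists (mklin hL) => x /=.
  by rewrite linearD h1P h2P /= -linearD -rP.
have fL : linear (fun z : T * P => i (q z.1) + s z.2).
  by move=> a x y; rewrite !linearP scalerDr addrACA.
have jL : linear (fun l => (j l, 0) : T * P).
  by move=> a x y; congr (_, _) => /=; rewrite ?linearP // scaler0 addr0.
exists (T * P : lmodType R)%type, L, (mklin jL), (mklin fL); split=> //.
  split=> [x y /= [] /ji //|x|[t u]] /=.
    have [t tE] := qs (r x); exists (t, p x).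
    by rewrite /= tE -rP.
  have [ii _ _] := ex.
  split=> [tu0|[l [<- <-]]]; last first.
    by rewrite (_ : q (j l) = 0) ?linear0 ?addr0 //; apply/jq; exists l.
  have u0 : u = 0 by have := congr1 p tu0; rewrite linearD pi add0r sK linear0.
  move: tu0; rewrite u0 linear0 addr0 -(linear0 i) => /ii /jq[l <-].
  by exists l.
move=> Y Z g f gs.
have L1 : linear (fun t : T => (t, 0) : T * P).
  by move=> a x y; congr (_, _) => /=; rewrite scaler0 addr0.
have L2 : linear (fun u : P => (0, u) : T * P).
  by move=> a x y; congr (_, _) => /=; rewrite scaler0 addr0.
have [h1 h1P] := Tp _ _ g (f \o mklin L1) gs.
have [h2 h2P] := Pp _ _ g (f \o mklin L2) gs.
have hL : linear (fun x : T * P => h1 x.1 + h2 x.2).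
  by move=> a x y; rewrite !linearP scalerDr addrACA.
exists (mklin hL) => -[t u] /=; rewrite linearD h1P h2P /= -linearD.
by congr (f (_, _)) => /=; rewrite ?addr0 ?add0r.
Qed.

(** Let a projective T map onto X. The preimage of K in T is the kernel of the
    surjection T -> P, hence a summand of T, and it maps onto K with the kernel
    of T -> X. *)
Lemma pd_le_kernel m K X P (i : {linear K -> X}) (p : {linear X -> P}) :
  short_exact i p -> projective P -> pd_le m X -> pd_le m K.
Proof.
elim: m K X P i p => [|m IHm] K X P i p ex Pp /=.
  have [_ ps _] := ex; have [s sK] := projective_section Pp ps.
  have [r [rK _]] := split_retraction ex sK.
  by apply: projective_retract; exists i, r.
move=> [T [L [j [q [[ji qs jq] Tp Lm]]]]].
have [ii ps ip] := ex.
have pqs : surj (p \o q).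
  by move=> y; have [x <-] := ps y; have [z <-] := qs x; exists z.
have exT := ker_short_exact pqs.
have exq (t : kermod (p \o q)) : p (q (ker_val t)) = 0 by exact: (ker_val0 t).
have [q' q'P] := short_exact_factor (f := q \o ker_val) ex exq.
have [j' j'P] : exists j' : {linear L -> kermod (p \o q)},
    forall x, ker_val (j' x) = j x.
  apply: ker_lift => x /=.
  by rewrite (_ : q (j x) = 0) ?linear0 //; apply/jq; exists x.
exists (kermod (p \o q)), L, j', q'; split=> //; last first.
  have [s sK] := projective_section Pp pqs.
  have [r [rK _]] := split_retraction exT sK.
  by apply: projective_retract Tp; exists ker_val, r.
split=> [x y /(congr1 ker_val)|y|x].
- by rewrite !j'P => /ji.
- have [t tE] := qs (i y).
  have pt : t \in ker_pred (p \o q).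
    by apply/eqP; rewrite /= tE; apply/ip; exists y.
  by exists (KerMod pt); apply: ii; rewrite q'P.
- have -> : q' x = 0 <-> q (ker_val x) = 0.
    have <- : i (q' x) = q (ker_val x) := q'P x.
    split=> [->|]; first exact: linear0.
    by rewrite -[in X in X -> _](linear0 i) => /ii.
  rewrite jq; split=> -[l lE]; exists l.
    by apply: ker_val_inj; rewrite j'P.
  by rewrite -j'P lE.
Qed.

(** Schanuel's argument: the pullback of two surjections from projectives to M
    is an extension of each of them by the kernel of the other. *)
Lemma pd_le_syzygy m K P M (i : {linear K -> P}) (p : {linear P -> M}) :
  short_exact i p -> projective P -> pd_le m.+1 M -> pd_le m K.
Proof.
move=> ex Pp [P' [K' [i' [p' [ex' Pp' K'm]]]]].
have [ii ps ip] := ex; have [ii' ps' ip'] := ex'.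
have dL : linear (fun x : P * P' => p x.1 - p' x.2).
  by move=> a x y; rewrite /= (linearP p) (linearP p') scalerBr opprD addrACA.
pose X := kermod (mklin dL).
have XE (x : X) : p (ker_val x).1 = p' (ker_val x).2.
  by apply/eqP; rewrite -subr_eq0; apply/eqP/(ker_val0 x).
have fL : linear (fun x : X => (ker_val x).1) by [].
have gL : linear (fun x : X => (ker_val x).2) by [].
have mkX u v : p u = p' v -> (u, v) \in ker_pred (mklin dL).
  by move=> uv; apply/eqP; rewrite /= uv subrr.
have p'i' y : p' (i' y) = 0 by apply/ip'; exists y.
have pi y : p (i y) = 0 by apply/ip; exists y.
have iL : linear (fun y => (0, i' y) : P * P').
  by move=> a x y; congr (_, _) => /=; rewrite ?linearP // scaler0 addr0.
have jL : linear (fun y => (i y, 0) : P * P').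
  by move=> a x y; congr (_, _) => /=; rewrite ?linearP // scaler0 addr0.
have [|i'' i''P] := @ker_lift _ _ _ (mklin dL) _ (mklin iL).
  by move=> x; rewrite /= linear0 p'i' subrr.
have [|j'' j''P] := @ker_lift _ _ _ (mklin dL) _ (mklin jL).
  by move=> x; rewrite /= linear0 pi subrr.
have exf : short_exact i'' (mklin fL).
  split=> [x y|u|x].
  - by move/(congr1 ker_val); rewrite !i''P => -[] /ii'.
  - by have [v vE] := ps' (p u); exists (KerMod (mkX _ _ (esym vE))).
  - split=> [/= x10|[y <-]]; last by rewrite /= i''P.
    have [|y yE] := (ip' (ker_val x).2).1; first by rewrite -XE x10 linear0.
    exists y; apply: ker_val_inj; rewrite i''P /= yE -x10.
    by case: (ker_val x).
have exg : short_exact j'' (mklin gL).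
  split=> [x y|u|x].
  - by move/(congr1 ker_val); rewrite !j''P => -[] /ii.
  - by have [v vE] := ps (p' u); exists (KerMod (mkX _ _ vE)).
  - split=> [/= x10|[y <-]]; last by rewrite /= j''P.
    have [|y yE] := (ip (ker_val x).1).1; first by rewrite XE x10 linear0.
    exists y; apply: ker_val_inj; rewrite j''P /= yE -x10.
    by case: (ker_val x).
exact: pd_le_kernel exg Pp' (pd_le_extension exf Pp K'm).
Qed.

Lemma pd_leS m M : pd_le m M -> pd_le m.+1 M.
Proof.
elim: m M => [M Mp|m IHm M [P [K [i [p [ex Pp Km]]]]]].
  have ids : surj (idfun : {linear M -> M}) by move=> y; exists y.
  exists M, (kermod (idfun : {linear M -> M})), ker_val, idfun; split=> //.
    exact: ker_short_exact ids.
  move=> X Y g f gs; exists \0 => x.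
  suff -> : x = 0 by rewrite !linear0.
  by apply: ker_val_inj; rewrite linear0; apply: (ker_val0 x).
by exists P, K, i, p; split=> //; apply: IHm.
Qed.

Lemma pd_le_projdim m M : pd_le m M -> projdim_le M m.
Proof.
elim: m M => [M Mp|m IHm M [P [K [i [p [[ii ps ip] Pp Km]]]]]].
  (* The resolution is continued by zero modules. *)
  pose Z : lmodType R := 'rV[R]_0.
  have Z0 (x : Z) : x = 0 by apply: thinmx0.
  pose T n : lmodType R := if n is _.+1 then Z else M.
  exists T, (fun n => \0 : {linear T n.+1 -> T n}), idfun; split=> //.
  - case=> [//|n] X Y g f gs; exists \0 => x.
    by rewrite (Z0 x) !linear0.
  - by case.
  - by move=> y; exists y.
  - move=> x /=; split=> [->|[y <-]] //.
    by exists 0.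
  - by case=> [|n] x; split=> _ //; [exists 0|exists 0]; rewrite linear0 [RHS]Z0.
have [Q [d [e [Qp Qm es e0 dd]]]] := IHm K Km.
pose T n : lmodType R := if n is n'.+1 then Q n' else P.
pose dT n : {linear T n.+1 -> T n} :=
  match n with 0%N => i \o e | n'.+1 => d n' end.
exists T, dT, p; split=> //.
- by case.
- by case=> // n nm; apply: Qm.
- move=> x; rewrite ip /=; split=> -[y <-].
    by have [z <-] := es y; exists z.
  by exists (e y).
- case=> [|n] x /=; last exact: dd.
  rewrite -e0; split=> [|->]; last by rewrite linear0.
  by rewrite -[in X in X -> _](linear0 i) => /ii.
Qed.

Lemma projdim_pd_le m M : projdim_le M m -> pd_le m M.
Proof.
elim: m M => [|m IHm] M [P [d [e [Pp Pm es e0 dd]]]].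
  apply: projective_retract (Pp 0%N); apply: (retract_bij (f := e)) => //.
  move=> x y exy; apply/eqP; rewrite -subr_eq0; apply/eqP.
  have [|z <-] := (e0 (x - y)).1; first by rewrite linearB exy subrr.
  by rewrite (Pm 1%N isT z) linear0.
have [|d' d'P] := @ker_lift _ _ _ e _ (d 0%N).
  by move=> x; apply/e0; exists x.
exists (P 0%N), (kermod e), ker_val, e; split=> //.
  exact: ker_short_exact.
apply: IHm; exists (fun n => P n.+1), (fun n => d n.+1), d'; split=> //.
- by move=> n nm; apply: Pm.
- move=> y; have [z zE] := (e0 (ker_val y)).1 (ker_val0 y).
  by exists z; apply: ker_val_inj; rewrite d'P.
- move=> x; rewrite -dd -d'P; split=> [->|d'x]; first exact: linear0.
  exact: ker_val_inj.
Qed.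
End ProjectiveDimension.

(** * Linearity predicates and tensor products *)

Section LinearityPredicates.
Variable k : fieldType.
Implicit Types U V W X Y : lmodType k.

(** A predicate, so that a map given by an expression can be lifted to the
    tensor product without declaring a structure on it. *)
Definition bilin U V W (F : U -> V -> W) :=
  (forall v, linear (fun u => F u v)) /\ (forall u, linear (fun v => F u v)).

Definition mkbilin U V W (F : U -> V -> W) (FB : bilin F) :
    {bilinear U -> V -> W} :=
  HB.pack F (bilinear_isBilinear.Build k U V W _ _ F FB).

Lemma lin_id V : linear (fun x : V => x). Proof. by []. Qed.

Lemma lin_app V W X (g : {linear W -> X}) (f : V -> W) :
  linear f -> linear (fun x => g (f x)).
Proof. by move=> fL a x y; rewrite fL linearP. Qed.

Lemma lin_comp V W X (g : W -> X) (f : V -> W) :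
  linear g -> linear f -> linear (fun x => g (f x)).
Proof. by move=> gL fL a x y; rewrite fL gL. Qed.

Lemma linZ V W (g : V -> W) : linear g -> forall c v, g (c *: v) = c *: g v.
Proof. by move=> gL c v; apply: (linearZZ (mklin gL)). Qed.

Lemma linD V W (g : V -> W) : linear g -> {morph g : u v / u + v}.
Proof. by move=> gL u v; apply: (linearD (mklin gL)). Qed.

Lemma lin_bil1 U V W X (g : {bilinear U -> V -> W}) (f : X -> U) v :
  linear f -> linear (fun x => g (f x) v).
Proof. by move=> fL a x y; rewrite fL linearPl. Qed.

Lemma lin_bil2 U V W X (g : {bilinear U -> V -> W}) (f : X -> V) u :
  linear f -> linear (fun x => g u (f x)).
Proof. by move=> fL a x y; rewrite fL linearPr. Qed.

Lemma lin_add V W (f g : V -> W) :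
  linear f -> linear g -> linear (fun x => f x + g x).
Proof. by move=> fL gL a x y; rewrite fL gL scalerDr addrACA. Qed.

Lemma lin_opp V W (f : V -> W) : linear f -> linear (fun x => - f x).
Proof. by move=> fL a x y; rewrite fL opprD scalerN. Qed.

Lemma lin_scale V W c (f : V -> W) : linear f -> linear (fun x => c *: f x).
Proof. by move=> fL a x y; rewrite fL scalerDr !scalerA mulrC. Qed.

Lemma lin_scalel V W (f : V -> k^o) (w : W) :
  linear f -> linear (fun x => (f x : k) *: w).
Proof. by move=> fL a x y; rewrite fL scalerDl -scalerA. Qed.

Lemma lin_tlift U V W X (F : U -> V -> W) (f : X -> tensor U V) :
  bilin F -> linear f -> linear (fun x => tlift F (f x)).
Proof. by move=> FB fL a x y; rewrite fL (linearP (tlift (mkbilin FB))). Qed.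

Lemma lin_tliftF U V W X (F : X -> U -> V -> W) t :
  (forall u v, linear (fun x => F x u v)) -> linear (fun x => tlift (F x) t).
Proof.
move=> FL a x y; rewrite /tlift /tsum scaler_sumr -big_split /=.
by apply: eq_bigr => p _; rewrite FL.
Qed.

Lemma tliftP U V W (F : U -> V -> W) u v : bilin F -> tlift F (u ⊗ v) = F u v.
Proof. by move=> FB; rewrite (tliftE (mkbilin FB)). Qed.

Lemma tliftD U V W (F : U -> V -> W) s t :
  bilin F -> tlift F (s + t) = tlift F s + tlift F t.
Proof. by move=> FB; rewrite (linearD (tlift (mkbilin FB))). Qed.

Lemma eq_tlift U V W (F G : U -> V -> W) t :
  (forall u v, F u v = G u v) -> tlift F t = tlift G t.
Proof. by move=> FG; rewrite /tlift /tsum; apply: eq_bigr => p _; apply: FG. Qed.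

Lemma tlift_app U V W X (g : {linear W -> X}) (F : U -> V -> W) t :
  g (tlift F t) = tlift (fun u v => g (F u v)) t.
Proof. by rewrite /tlift /tsum linear_sum. Qed.

Lemma tlift_lin U V W X (g : W -> X) (F : U -> V -> W) t :
  linear g -> g (tlift F t) = tlift (fun u v => g (F u v)) t.
Proof. by move=> gL; apply: (tlift_app (mklin gL)). Qed.

Lemma tlift_ptens U V (t : tensor U V) : tlift (fun u v => u ⊗ v) t = t.
Proof.
elim/tensor_indD: t => [u v|x y IHx IHy]; first by rewrite (tliftE (@ptens _ _ _)).
by rewrite (linearD (tlift (@ptens k U V))) /= IHx IHy.
Qed.

Lemma tmap_tlift U V U' V' (f : {linear U -> U'}) (g : {linear V -> V'}) t :
  tmap f g t = tlift (fun u v => f u ⊗ g v) t.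
Proof. by []. Qed.

Lemma tlift_tmap U V U' V' W (F : U' -> V' -> W)
    (f : {linear U -> U'}) (g : {linear V -> V'}) t :
  bilin F -> tlift F (tmap f g t) = tlift (fun u v => F (f u) (g v)) t.
Proof.
move=> FB; rewrite tmap_tlift (tlift_app (tlift (mkbilin FB))).
by apply: eq_tlift => u v; exact: tliftP.
Qed.

(** Both bracketings of a threefold tensor evaluate a trilinear expression
    alike; coassociativity in Sweedler notation comes down to this. *)
Lemma tlift_tassoc U V W X (F : U -> V -> W -> X) t :
  (forall w, bilin (fun u v => F u v w)) ->
  (forall u v, linear (F u v)) ->
  tlift (fun u y => tlift (F u) y) (tassoc t) =
  tlift (fun x w => tlift (fun u v => F u v w) x) t.
Proof.
move=> FB FL.
have FB' u : bilin (F u).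
  by split=> [w a x y|v a x y]; [apply: (FB w).2|apply: FL].
have B1 : bilin (fun u y => tlift (F u) y).
  split=> [y|u]; first by apply: lin_tliftF => v w; apply: (FB w).1.
  by apply: lin_tlift.
have B2 : bilin (fun x w => tlift (fun u v => F u v w) x).
  split=> [w|x]; first by apply: lin_tlift.
  by apply: lin_tliftF => u v; apply: FL.
elim/tensor_indD: t => [x w|t s IHt IHs]; last first.
  by rewrite linearD (tliftD _ _ B1) (tliftD _ _ B2) IHt IHs.
rewrite [RHS]tliftP //.
elim/tensor_indD: x => [u v|x y IHx IHy]; last first.
  by rewrite linearDl linearD (tliftD _ _ B1) (tliftD _ _ (FB w)) IHx IHy.
by rewrite tassocE tliftP // !tliftP.
Qed.

Lemma tensor_extL U V X (f g : tensor U V -> X) :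
  linear f -> linear g -> (forall u v, f (u ⊗ v) = g (u ⊗ v)) ->
  forall t, f t = g t.
Proof. by move=> fL gL; apply: (@tensor_ext _ _ _ _ (mklin fL) (mklin gL)). Qed.

Lemma tensor_ext3 U V W X (f g : {linear tensor (tensor U V) W -> X}) :
  (forall u v w, f (u ⊗ v ⊗ w) = g (u ⊗ v ⊗ w)) -> f =1 g.
Proof.
move=> fg; apply: tensor_ext => t w.
elim/tensor_indD: t => [u v|s t IHs IHt]; first exact: fg.
by rewrite linearDl !linearD IHs IHt.
Qed.

Lemma tassocK U V W : cancel (@tassoc k U V W) (@tassocV k U V W).
Proof.
move=> t.
elim/tensor_indD: t => [x w|t s IHt IHs]; last by rewrite !linearD /= IHt IHs.
elim/tensor_indD: x => [u v|x y IHx IHy]; first by rewrite tassocE tassocVE.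
by rewrite linearDl !linearD /= IHx IHy.
Qed.

Lemma tassoc_inj U V W : injective (@tassoc k U V W).
Proof. exact: can_inj (@tassocK U V W). Qed.

Lemma tmap_id U V (t : tensor U V) : tmap idfun idfun t = t.
Proof.
by elim/tensor_indD: t => [u v|x y IHx IHy]; rewrite ?tmapE // linearD /= IHx IHy.
Qed.

Lemma tmap_comp U V U' V' U'' V'' (f' : {linear U' -> U''}) (f : {linear U -> U'})
   (g' : {linear V' -> V''}) (g : {linear V -> V'}) t :
  tmap f' g' (tmap f g t) = tmap (f' \o f) (g' \o g) t.
Proof.
by elim/tensor_indD: t => [u v|x y IHx IHy]; rewrite ?tmapE // !linearD /= IHx IHy.
Qed.

Lemma eq_tmap U V U' V' (f f' : {linear U -> U'}) (g g' : {linear V -> V'}) t :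
  f =1 f' -> g =1 g' -> tmap f g t = tmap f' g' t.
Proof. by move=> ff' gg'; apply: eq_tlift => u v; rewrite /tpair ff' gg'. Qed.

Lemma tmap_can U V W (f : {linear U -> V}) (g : {linear V -> U}) :
  cancel f g -> cancel (tmap f (@idfun W)) (tmap g idfun).
Proof.
by move=> fK t; rewrite tmap_comp (eq_tmap (f' := idfun) (g' := idfun)) ?tmap_id.
Qed.
End LinearityPredicates.

(** Linearity is proved by descending into the expression, bilinearity as
    linearity in each argument. *)
Ltac lin_step :=
  match goal with
  | H : forall _, _ |- linear _ => solve [exact: H]
  | H : linear ?F |- linear ?F => exact: H
  | H : linear ?F |- linear (fun x => ?F (@?g x)) =>
      apply: (lin_comp H)
  | |- bilin _ => split; intro
  | |- forall _, _ => intro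
  | |- is_true _ => done
  | |- linear (fun x => x) => exact: lin_id
  | |- linear (tlift _) => apply: (@lin_tlift _ _ _ _ _ _ (fun t => t))
  | |- linear (fun x => tlift (@?F x) (@?f x)) =>
      first [ apply: lin_tliftF | apply: lin_tlift ]
  | |- linear (fun x => @?f x + @?g x) => apply: lin_add
  | |- linear (fun x => - @?f x) => apply: lin_opp
  | |- _ => first
    [ exact: linearP | apply: lin_app | apply: lin_bil1 | apply: lin_bil2
    | apply: lin_scale | apply: lin_scalel | assumption ]
  end.
Ltac lin := repeat (cbv beta; lin_step).

(** * Algebras and modules *)

Definition mklrmorphism (k : fieldType) (A B : algType k) (f : A -> B)
    (fL : linear f) (fM : monoid_morphism f) : {lrmorphism A -> B} :=
  HB.pack f (GRing.isLinear.Build k A B _ f fL)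
    (GRing.isMonoidMorphism.Build A B f fM).

Section TensorAlgebra.
Variables (k : fieldType) (A B : algType k).

(** A name of its own for the tensor product, so that the product of two
    algebras is not imposed on the tensor products of plain vector spaces. *)
Definition talg : Type := tensor A B.
HB.instance Definition _ := GRing.Lmodule.copy talg (tensor A B).

Definition talg_mul (x y : talg) : talg := tmap2 *%R *%R x y.

Fact talg_mulDl : left_distributive talg_mul +%R.
Proof. by move=> x y z; rewrite /talg_mul linearDl. Qed.
Fact talg_mulDr : right_distributive talg_mul +%R.
Proof. by move=> x y z; rewrite /talg_mul linearDr. Qed.
Fact talg_mul1 : left_id (1 ⊗ 1 : talg) talg_mul.
Proof.
move=> x; elim/tensor_indD: x => [a b|x y IHx IHy].
  by rewrite /talg_mul tmap2E /= !mul1r.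
by rewrite talg_mulDr IHx IHy.
Qed.
Fact talg_1mul : right_id (1 ⊗ 1 : talg) talg_mul.
Proof.
move=> x; elim/tensor_indD: x => [a b|x y IHx IHy].
  by rewrite /talg_mul tmap2E /= !mulr1.
by rewrite talg_mulDl IHx IHy.
Qed.
Fact talg_mulA : associative talg_mul.
Proof.
move=> x y z; elim/tensor_indD: x => [a b|x x' IHx IHx']; last first.
  by rewrite !talg_mulDl IHx IHx'.
elim/tensor_indD: y => [a' b'|y y' IHy IHy']; last first.
  by rewrite !(talg_mulDl, talg_mulDr) IHy IHy'.
elim/tensor_indD: z => [a'' b''|z z' IHz IHz']; last first.
  by rewrite !talg_mulDr IHz IHz'.
by rewrite /talg_mul !tmap2E /= ?tmap2E /= !mulrA.
Qed.
Fact talg_one_neq0 : (1 ⊗ 1 : talg) != 0.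
Proof.
have [f f1] := functional_at (oner_neq0 A).
have [g g1] := functional_at (oner_neq0 B).
apply/eqP => /(congr1 ((@trunit k k^o) \o tmap f g)) /eqP.
by rewrite linear0 /= tmapE f1 g1 trunitE scale1r oner_eq0.
Qed.

HB.instance Definition _ := GRing.Zmodule_isNzRing.Build talg
  talg_mulA talg_mul1 talg_1mul talg_mulDl talg_mulDr talg_one_neq0.

Fact talg_scalerAl (a : k) (x y : talg) : a *: (x * y) = (a *: x) * y.
Proof. by rewrite /GRing.mul /= /talg_mul linearZl_LR. Qed.
HB.instance Definition _ := GRing.Lmodule_isLalgebra.Build k talg talg_scalerAl.
Fact talg_scalerAr (a : k) (x y : talg) : a *: (x * y) = x * (a *: y).
Proof. by rewrite /GRing.mul /= /talg_mul linearZr_LR. Qed.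
HB.instance Definition _ := GRing.Lalgebra_isAlgebra.Build k talg talg_scalerAr.

Lemma talg_mulE (a a' : A) (b b' : B) :
  (a ⊗ b : talg) * (a' ⊗ b' : talg) = (a * a') ⊗ (b * b').
Proof. exact: tmap2E. Qed.
End TensorAlgebra.

Section OppositeAlgebra.
Variables (k : fieldType) (A : algType k).

Definition opalg : Type := A.
HB.instance Definition _ := GRing.Lmodule.on opalg.
Definition opalg_mul (x y : opalg) : opalg := (y : A) * x.

Fact opalg_mulA : associative opalg_mul.
Proof. by move=> x y z; rewrite /opalg_mul mulrA. Qed.
Fact opalg_mulDl : left_distributive opalg_mul +%R.
Proof. by move=> x y z; rewrite /opalg_mul mulrDr. Qed.
Fact opalg_mulDr : right_distributive opalg_mul +%R.
Proof. by move=> x y z; rewrite /opalg_mul mulrDl. Qed.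
Fact opalg_mul1 : left_id (1 : A) opalg_mul.
Proof. by move=> x; rewrite /opalg_mul mulr1. Qed.
Fact opalg_1mul : right_id (1 : A) opalg_mul.
Proof. by move=> x; rewrite /opalg_mul mul1r. Qed.
HB.instance Definition _ := GRing.Zmodule_isNzRing.Build opalg opalg_mulA
  opalg_mul1 opalg_1mul
  opalg_mulDl opalg_mulDr (oner_neq0 A).
Fact opalg_scalerAl (a : k) (x y : opalg) :
  a *: (x * y : opalg) = (a *: x : opalg) * y.
Proof. exact: (@scalerAr k A). Qed.
HB.instance Definition _ :=
  GRing.Lmodule_isLalgebra.Build k opalg opalg_scalerAl.
Fact opalg_scalerAr (a : k) (x y : opalg) :
  a *: (x * y : opalg) = x * (a *: y : opalg).
Proof. exact: (@scalerAl k A). Qed.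
HB.instance Definition _ :=
  GRing.Lalgebra_isAlgebra.Build k opalg opalg_scalerAr.

Lemma opalg_mulE (x y : opalg) : x * y = ((y : A) * (x : A) : A).
Proof. by []. Qed.
End OppositeAlgebra.

Definition restr_along (S T : nzRingType) (f : {rmorphism S -> T})
  (M : lmodType T) : Type := M.

Section Restriction.
Variables (S T : nzRingType) (f : {rmorphism S -> T}) (M : lmodType T).

Local Notation restr := (restr_along f M).
HB.instance Definition _ := GRing.Zmodule.on restr.
Definition restr_scale (a : S) (x : restr) : restr := f a *: (x : M).
Fact restr_scaleA a b x : restr_scale a (restr_scale b x) = restr_scale (a * b) x.
Proof. by rewrite /restr_scale scalerA rmorphM. Qed.
Fact restr_scale1 : left_id 1 restr_scale.
Proof. by move=> x; rewrite /restr_scale rmorph1 scale1r. Qed.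
Fact restr_scaleDr : right_distributive restr_scale +%R.
Proof. by move=> a x y; rewrite /restr_scale scalerDr. Qed.
Fact restr_scaleDl x : {morph restr_scale^~ x : a b / a + b}.
Proof. by move=> a b; rewrite /restr_scale rmorphD scalerDl. Qed.
HB.instance Definition _ := GRing.Zmodule_isLmodule.Build S restr
  restr_scaleA restr_scale1 restr_scaleDr restr_scaleDl.
Definition restr_mod : lmodType S := restr.

Lemma restrE a (x : restr_mod) : a *: x = (f a *: (x : M) : M).
Proof. by []. Qed.
End Restriction.

Lemma restr_linear (S T : nzRingType) (f : {rmorphism S -> T}) (M N : lmodType T)
  (g : {linear M -> N}) : linear (g : restr_mod f M -> restr_mod f N).
Proof. by move=> a x y; rewrite [LHS](linearP g). Qed.

Section Modules.
Variable k : fieldType.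

(** A module over an algebra carries no scalars of k by itself; they are
    recovered through the structure map of the algebra. *)
Definition kmod (A : algType k) (N : lmodType A) : lmodType k :=
  restr_mod (GRing.in_alg A) N.

Lemma kmodE (A : algType k) (N : lmodType A) c (x : kmod N) :
  c *: x = (c%:A : A) *: (x : N).
Proof. by []. Qed.

Lemma kmod_linear (A : algType k) (M N : lmodType A) (g : {linear M -> N}) :
  linear (g : kmod M -> kmod N).
Proof. exact: restr_linear. Qed.

Section Action.
Variables (A : algType k) (N : lmodType A).
Definition kact (a : A) (n : kmod N) : kmod N := a *: (n : N).
Fact kact_bilinear : bilinear_for *:%R *:%R kact.
Proof.
split=> [n c a b|a c m n]; rewrite /kact /= ?kmodE.
  by rewrite scalerDl scalerA -scalerAl mul1r.
by rewrite scalerDr !scalerA -scalerAl mul1r -scalerAr mulr1.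
Qed.
HB.instance Definition _ :=
  bilinear_isBilinear.Build k A (kmod N) (kmod N) _ _ kact kact_bilinear.
HB.instance Definition _ a :=
  GRing.isLinear.Build k (kmod N) (kmod N) _ (kact a) (kact_bilinear.2 a).
End Action.

Section FreeModule.
Variables (A : algType k) (V : lmodType k).
Definition freemod : Type := tensor A V.
HB.instance Definition _ := GRing.Zmodule.copy freemod (tensor A V).
Definition free_scale (a : A) (t : freemod) : freemod :=
  tlift (fun b v => (a * b) ⊗ v) t.
Let B a : bilin (fun (b : A) (v : V) => (a * b) ⊗ v). Proof. by lin. Qed.
Lemma free_scaleE0 a b v : free_scale a (b ⊗ v) = (a * b) ⊗ v.
Proof. by rewrite /free_scale tliftP. Qed.
Fact free_scaleDr : right_distributive free_scale +%R.
Proof. by move=> a x y; rewrite /free_scale [LHS](tliftD _ _ (B a)). Qed.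
Fact free_scaleDl x : {morph free_scale^~ x : a b / a + b}.
Proof.
move=> a b; elim/tensor_indD: x => [c v|x y IHx IHy].
  by rewrite !free_scaleE0 mulrDl linearDl.
by rewrite !free_scaleDr IHx IHy addrACA.
Qed.
Fact free_scaleA a b x : free_scale a (free_scale b x) = free_scale (a * b) x.
Proof.
elim/tensor_indD: x => [c v|x y IHx IHy].
  by rewrite !free_scaleE0 mulrA.
by rewrite !free_scaleDr IHx IHy.
Qed.
Fact free_scale1 : left_id 1 free_scale.
Proof.
move=> x; elim/tensor_indD: x => [c v|x y IHx IHy].
  by rewrite !free_scaleE0 mul1r.
by rewrite !free_scaleDr IHx IHy.
Qed.
HB.instance Definition _ := GRing.Zmodule_isLmodule.Build A freemod
  free_scaleA free_scale1 free_scaleDr free_scaleDl.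

Lemma freemodE a b v : a *: (b ⊗ v : freemod) = ((a * b) ⊗ v : freemod).
Proof. exact: free_scaleE0. Qed.
Lemma free_kscale c (t : tensor A V) :
  c%:A *: (t : freemod) = (c *: t : tensor A V).
Proof.
elim/tensor_indD: t => [b v|x y IHx IHy]; last by rewrite !scalerDr IHx IHy.
by rewrite freemodE -scalerAl mul1r linearZl_LR.
Qed.
End FreeModule.

Section ExternalTensor.
Variables (A B : algType k) (N : lmodType A) (M : lmodType B).
Definition extmod : Type := tensor (kmod N) (kmod M).
HB.instance Definition _ :=
  GRing.Zmodule.copy extmod (tensor (kmod N) (kmod M)).
Definition ext_scale (t : talg A B) (x : extmod) : extmod :=
  tmap2 (@kact A N) (@kact B M) t x.
Fact ext_scaleDr : right_distributive ext_scale +%R.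
Proof. by move=> a x y; rewrite /ext_scale [LHS]linearDr. Qed.
Fact ext_scaleDl x : {morph ext_scale^~ x : a b / a + b}.
Proof. by move=> a b; rewrite /ext_scale [LHS]linearDl. Qed.
Fact ext_scaleA a b x : ext_scale a (ext_scale b x) = ext_scale (a * b) x.
Proof.
elim/tensor_indD: a => [a c|a a' IHa IHa']; last first.
  by rewrite mulrDl !ext_scaleDl IHa IHa'.
elim/tensor_indD: b => [b d|b b' IHb IHb']; last first.
  by rewrite mulrDr !(ext_scaleDl, ext_scaleDr) IHb IHb'.
elim/tensor_indD: x => [n m|x y IHx IHy]; last first.
  by rewrite !ext_scaleDr IHx IHy.
by rewrite talg_mulE /ext_scale !tmap2E /= ?tmap2E /= /kact !scalerA.
Qed.
Fact ext_scale1 : left_id 1 ext_scale.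
Proof.
move=> x; elim/tensor_indD: x => [n m|x y IHx IHy]; last first.
  by rewrite ext_scaleDr IHx IHy.
by rewrite /ext_scale tmap2E /= /kact !scale1r.
Qed.
HB.instance Definition _ := GRing.Zmodule_isLmodule.Build (talg A B) extmod
  ext_scaleA ext_scale1 ext_scaleDr ext_scaleDl.

End ExternalTensor.
End Modules.

(** * Exactness, induction along a coaction, free modules *)

Section TensorExact.
Variable k : fieldType.
Implicit Types U V W X : lmodType k.

Lemma linear_section U V (p : {linear U -> V}) :
  surj p -> exists s : {linear V -> U}, cancel s p.
Proof.
move=> ps; have ex := ker_short_exact ps.
have [r rK] := linear_retraction (@ker_val_inj _ _ _ p).
have fL : linear (fun x => x - ker_val (r x)) by lin.
have [|s sP] := short_exact_descend (f := mklin fL) ex.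
  by move=> y /=; rewrite rK subrr.
exists s => v; have [u <-] := ps v.
by rewrite sP /= (linearB p) ker_val0 subr0.
Qed.

(** Over a field the sequence splits, and tensoring preserves split exact
    sequences. *)
Lemma tmap_short_exact U V W X (i : {linear U -> V}) (p : {linear V -> W}) :
  short_exact i p ->
  short_exact (tmap i (idfun : {linear X -> X}))
    (tmap p (idfun : {linear X -> X})).
Proof.
move=> ex; have [ii ps ip] := ex; have [s sK] := linear_section ps.
have [r [rK rP]] := split_retraction ex sK.
split=> [|y|x].
- apply: (can_inj (g := tmap r idfun)) => x.
  by rewrite /= tmap_comp (eq_tmap (f' := idfun) (g' := idfun)) ?tmap_id.
- exists (tmap s idfun y).
  by rewrite /= tmap_comp (eq_tmap (f' := idfun) (g' := idfun)) ?tmap_id.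
- split=> [px|[y <-]]; last first.
    rewrite /= tmap_comp (eq_tmap (f' := \0) (g' := idfun)) //=; last first.
      by move=> u; apply/ip; exists u.
    rewrite (@tmap_linearl _ _ _ _ _ (-1) \0 \0 \0 idfun).
      by rewrite scaleN1r addNr.
    by move=> u; rewrite /= scaler0 addr0.
  exists (tmap r idfun x).
  rewrite /= tmap_comp -[RHS]tmap_id.
  rewrite (@tmap_linearl _ _ _ _ _ 1 (i \o r) (s \o p) idfun idfun); last first.
    by move=> v; rewrite scale1r /= -rP.
  rewrite scale1r -[X in _ + X]/(tmap (s \o p) (idfun \o idfun) x).
  by rewrite -(tmap_comp s p) px linear0 addr0.
Qed.
End TensorExact.

Section Induction.
Variables (k : fieldType) (A Q : algType k) (rho : {lrmorphism Q -> talg A Q}).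
Variable X : lmodType Q.

(** The external tensor product restricted along a coaction Q -> A ⊗ Q. For Q =
    A and the comultiplication this is the tensor product of A-modules; for a
    Galois coaction it is the module induced along an embedding of A into Q. *)
Definition ind (N : lmodType A) : lmodType Q := restr_mod rho (extmod N X).

Lemma indE N q (t : ind N) : q *: t = tmap2 (@kact _ A N) (@kact _ Q X) (rho q) t.
Proof. by []. Qed.

Lemma ind_linear N (Y : lmodType Q) (f : ind N -> Y) :
  {morph f : s t / s + t} ->
  (forall q n x, f (tmap2 (@kact _ A N) (@kact _ Q X) (rho q) (n ⊗ x)) =
     q *: f (n ⊗ x)) ->
  linear f.
Proof.
move=> fD fZ a s t; rewrite fD; congr (_ + _).
elim/tensor_indD: s => [n x|x y IHx IHy]; first exact: fZ.
by rewrite scalerDr fD IHx IHy -scalerDr -fD.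
Qed.

Definition kmap (N N' : lmodType A) (f : N -> N') : kmod N -> kmod N' := f.
HB.instance Definition _ (N N' : lmodType A) (f : {linear N -> N'}) :=
  GRing.isLinear.Build k (kmod N) (kmod N') _ (kmap f) (kmod_linear f).

Fact ind_map_linear (N N' : lmodType A) (f : {linear N -> N'}) :
  linear (tmap (kmap f) idfun : ind N -> ind N').
Proof.
apply: ind_linear => [s t|q n x]; first exact: linearD.
rewrite tmapE indE.
elim/tensor_indD: (rho q) => [a p|s t IHs IHt].
  by rewrite !tmap2E tmapE; congr (_ ⊗ _); apply: (linearZZ f).
by rewrite !linearDl linearD /= IHs IHt.
Qed.
Definition ind_map (N N' : lmodType A) (f : N -> N') : ind N -> ind N' :=
  tmap (kmap f) idfun.
HB.instance Definition _ (N N' : lmodType A) (f : {linear N -> N'}) :=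
  GRing.isLinear.Build Q (ind N) (ind N') _ (ind_map f) (ind_map_linear f).

Lemma ind_short_exact (K P N : lmodType A) (i : {linear K -> P}) (p : {linear P -> N}) :
  short_exact i p -> short_exact (ind_map i) (ind_map p).
Proof.
move=> ex; apply: (@tmap_short_exact _ _ _ _ _ (kmap i) (kmap p)).
by case: ex.
Qed.

Lemma pd_le_ind m (N : lmodType A) :
  (forall P : lmodType A, projective P -> projective (ind P)) ->
  pd_le m N -> pd_le m (ind N).
Proof.
move=> indP; elim: m N => [|m IHm] N /=; first exact: indP.
move=> [P [K [i [p [ex Pp Km]]]]].
exists (ind P), (ind K), (ind_map i), (ind_map p).
by split; [apply: ind_short_exact|apply: indP|apply: IHm].
Qed.

Lemma ind_retract (M N : lmodType A) : retract M N -> retract (ind M) (ind N).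
Proof.
move=> [s [r rK]]; exists (ind_map s), (ind_map r) => t.
rewrite [LHS](tmap_comp (kmap r) (kmap s)).
by rewrite (eq_tmap (f' := idfun) (g' := idfun)) ?tmap_id.
Qed.
End Induction.

Section FreeProjective.
Variables (k : fieldType) (A : algType k).

Lemma free_linear V (N : lmodType A) (f : freemod A V -> N) :
  {morph f : s t / s + t} ->
  (forall a b v, f ((a * b) ⊗ v) = a *: f (b ⊗ v)) -> linear f.
Proof.
move=> fD fZ a s t; rewrite fD; congr (_ + _).
elim/tensor_indD: s => [b v|x y IHx IHy]; first by rewrite freemodE fZ.
by rewrite scalerDr fD IHx IHy -scalerDr -fD.
Qed.

Lemma free_lift (V : lmodType k) (N : lmodType A) (f : {linear V -> kmod N}) :
  exists h : {linear freemod A V -> N}, forall a v, h (a ⊗ v) = a *: (f v : N).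
Proof.
pose F (a : A) (v : V) : kmod N := kact a (f v).
have FB : bilin F by rewrite /F; lin.
have hL : linear (tlift F : freemod A V -> N).
  apply: free_linear => [s t|a b v]; first exact: (tliftD _ _ FB).
  by rewrite !(tliftP _ _ FB) /F /kact scalerA.
by exists (mklin hL) => a v /=; rewrite (tliftP _ _ FB).
Qed.

Lemma free_ext (V : lmodType k) (N : lmodType A)
    (g h : {linear freemod A V -> N}) :
  (forall v, g (1 ⊗ v) = h (1 ⊗ v)) -> g =1 h.
Proof.
move=> gh; elim/tensor_indD => [a v|x y IHx IHy]; last by rewrite !linearD IHx IHy.
have -> : a ⊗ v = a *: (1 ⊗ v : freemod A V) by rewrite freemodE mulr1.
by rewrite !linearZ gh.
Qed.

Lemma free_unit_linear (V : lmodType k) (N : lmodType A)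
    (h : {linear freemod A V -> N}) : linear (fun v : V => h (1 ⊗ v) : kmod N).
Proof.
move=> c v w; rewrite kmodE -linearP; congr (h _).
rewrite free_kscale; exact: linearPr.
Qed.

(** A lifting problem out of A ⊗ V is one for linear maps out of V, which a
    linear section solves. *)
Lemma free_projective (V : lmodType k) : projective (freemod A V).
Proof.
move=> M N g f gs.
have [s sK] := linear_section (p := kmap g) gs.
have [h hP] := free_lift (s \o mklin (free_unit_linear f)).
exists h; apply: (free_ext (g := g \o h)) => v.
by rewrite /= hP scale1r /=; apply: sK.
Qed.

Lemma free_cover (N : lmodType A) :
  exists h : {linear freemod A (kmod N) -> N}, surj h.
Proof.
have [h hP] := free_lift (idfun : {linear kmod N -> kmod N}).
by exists h => n; exists (1 ⊗ (n : kmod N)); rewrite hP scale1r.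
Qed.

Lemma projective_retract_free (N : lmodType A) :
  projective N -> retract N (freemod A (kmod N)).
Proof.
move=> Np; have [h hs] := free_cover N.
by have [s sK] := projective_section Np hs; exists s, h.
Qed.
End FreeProjective.

(** * Sweedler calculus *)

Section Sweedler.
Variables (k : fieldType) (A : hopfAlg k).
Implicit Types (U W : lmodType k) (h : A).

(** This common value is what the notation h_(1), h_(2), h_(3) stands for. *)
Lemma sw_coassoc U (F : A -> A -> A -> U) h :
  (forall b c, linear (fun a => F a b c)) ->
  (forall a c, linear (fun b => F a b c)) ->
  (forall a b, linear (fun c => F a b c)) ->
  tlift (fun x c => tlift (fun a b => F a b c) (hcomul A x)) (hcomul A h) =
  tlift (fun a x => tlift (fun b c => F a b c) (hcomul A x)) (hcomul A h).
Proof.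
move=> F1 F2 F3.
have := congr1 (tlift (fun u y => tlift (F u) y)) (hcomulA h).
rewrite tlift_tassoc; [|by lin..].
by rewrite !tlift_tmap; [|by lin..].
Qed.

Lemma sw_antipodel U (F : A -> U) h : linear F ->
  tlift (fun a b => F (hantipode A a * b)) (hcomul A h) = F (hcounit A h *: 1).
Proof.
by move=> FL; rewrite -hantipodel (tlift_lin _ _ FL) tlift_tmap //; lin.
Qed.

Lemma sw_antipoder U (F : A -> U) h : linear F ->
  tlift (fun a b => F (a * hantipode A b)) (hcomul A h) = F (hcounit A h *: 1).
Proof.
by move=> FL; rewrite -hantipoder (tlift_lin _ _ FL) tlift_tmap //; lin.
Qed.

Lemma sw_counitl U (F : A -> U) h : linear F ->
  tlift (fun a b => (hcounit A a : k) *: F b) (hcomul A h) = F h.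
Proof.
move=> FL; rewrite -[in RHS](hcounitl h) (tlift_lin _ _ FL) tlift_tmap; last by lin.
by apply: eq_tlift => a b; rewrite /scalel (linZ FL).
Qed.

Lemma sw_counitr U (F : A -> U) h : linear F ->
  tlift (fun a b => (hcounit A b : k) *: F a) (hcomul A h) = F h.
Proof.
move=> FL; rewrite -[in RHS](hcounitr h) (tlift_lin _ _ FL) tlift_tmap; last by lin.
by apply: eq_tlift => a b; rewrite /scaler (linZ FL).
Qed.
End Sweedler.

(** * Galois comodule algebras and induction *)

Section Orbit.
Variables (k : fieldType) (Q : algType k) (X : lmodType Q) (x0 : X).
Definition orbit_map (q : Q) : kmod X := kact q (x0 : kmod X).
Fact orbit_map_linear : linear orbit_map.
Proof. by rewrite /orbit_map; lin. Qed.
HB.instance Definition _ :=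
  GRing.isLinear.Build k Q (kmod X) _ orbit_map orbit_map_linear.
End Orbit.

(** The last three fields say that q |-> q_(-1) ⊗ q_(0) x0 is a bijection from Q
    to A ⊗ X. The main example is Q = R ⊗ R^op acting on X = R with x0 = 1,
    where the bijection is x ⊗ y |-> x_(-1) ⊗ x_(0) y, the canonical map of a
    left A-Galois algebra R. *)
Record galois (k : fieldType) (A : hopfAlg k) (Q : algType k) (X : lmodType Q)
    (x0 : X) := Galois {
  grho : {linear Q -> tensor A Q};
  grhoM : monoid_morphism (grho : Q -> talg A Q);
  grhoA : forall q,
    tassoc (tmap (hcomul A) idfun (grho q)) = tmap idfun grho (grho q);
  grho1 : forall q, tlunit (tmap (hcounit A) idfun (grho q)) = q;
  gcaninv : {linear tensor A (kmod X) -> Q};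
  gcanK : forall q, gcaninv (tmap idfun (orbit_map x0) (grho q)) = q;
  gcaninvK : forall t, tmap idfun (orbit_map x0) (grho (gcaninv t)) = t
}.

Section Galois.
Variables (k : fieldType) (A : hopfAlg k) (Q : algType k) (X : lmodType Q).
Variables (x0 : X) (g : galois A x0).

Let rho := grho g.
Let caninv := gcaninv g.

Fact grhoL : linear (rho : Q -> talg A Q).
Proof. exact: linearP. Qed.
Definition grho_alg : {lrmorphism Q -> talg A Q} :=
  mklrmorphism grhoL (grhoM g).

Definition gcan (q : Q) : tensor A (kmod X) := tmap idfun (orbit_map x0) (rho q).
Fact gcan_linear : linear gcan. Proof. by rewrite /gcan; lin. Qed.
HB.instance Definition _ :=
  GRing.isLinear.Build k Q (tensor A (kmod X)) _ gcan gcan_linear.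

Lemma rhoM q q' : rho (q * q') = tmap2 *%R *%R (rho q) (rho q').
Proof. exact: (grhoM g).2. Qed.

Lemma rho_one : rho 1 = 1 ⊗ 1.
Proof. exact: (grhoM g).1. Qed.

Lemma gcanM q q' : gcan (q * q') = tmap2 *%R (@kact _ Q X) (rho q) (gcan q').
Proof.
rewrite /gcan rhoM.
elim/tensor_indD: (rho q) => [a p|s t IHs IHt]; last first.
  by rewrite !linearDl linearD /= IHs IHt.
elim/tensor_indD: (rho q') => [b p'|s t IHs IHt]; last first.
  by rewrite linearDr !linearD /= linearDr IHs IHt.
by rewrite !tmap2E !tmapE tmap2E /= /orbit_map /kact scalerA.
Qed.

Lemma gcan1 : gcan 1 = 1 ⊗ (x0 : kmod X).
Proof. by rewrite /gcan rho_one tmapE /= /orbit_map /kact scale1r. Qed.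

Lemma gcan_orbit q : q *: x0 = tlunit (tmap (hcounit A) idfun (gcan q)) :> X.
Proof.
rewrite -[in LHS](grho1 g q) /gcan -/rho.
elim/tensor_indD: (rho q) => [a p|s t IHs IHt]; last first.
  by rewrite !linearD /= scalerDl IHs IHt.
rewrite !tmapE !tlunitE /= kmodE /orbit_map /kact scalerA.
by rewrite -scalerAl mul1r.
Qed.

(** As [gcan] is injective, an identity in A ⊗ Q may be tested in A ⊗ (A ⊗ X);
    this computes the side that contains the coaction. *)
Lemma gcan_coassoc q :
  tmap idfun gcan (rho q) = tassoc (tmap (hcomul A) idfun (gcan q)).
Proof.
have -> : tmap idfun gcan (rho q) =
    tmap idfun (tmap idfun (orbit_map x0)) (tmap idfun rho (rho q)).
  by rewrite tmap_comp; apply: eq_tmap.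
rewrite -grhoA /gcan -/rho.
elim/tensor_indD: (rho q) => [a p|s t IHs IHt]; last first.
  by rewrite !linearD /= IHs IHt.
rewrite !tmapE /=.
elim/tensor_indD: (hcomul A a) => [b c|s t IHs IHt].
  by rewrite !tassocE tmapE /= tmapE.
by rewrite !linearDl !linearD /= IHs IHt.
Qed.

Lemma tmap_gcan_inj (t s : tensor A Q) :
  tmap idfun gcan t = tmap idfun gcan s -> t = s.
Proof.
apply: (can_inj (g := tmap idfun caninv)) => r.
rewrite tmap_comp (eq_tmap (f' := idfun) (g' := idfun)) ?tmap_id // => q.
exact: gcanK.
Qed.

Lemma gcan_inj : injective gcan. Proof. exact: can_inj (gcanK g). Qed.

(** The translation map, an algebra embedding of A into Q. For Q = A ⊗ A^op it
    is a |-> a_(1) ⊗ S(a_(2)). *)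
Definition kappa (a : A) : Q := caninv (a ⊗ (x0 : kmod X)).
(** A section of q |-> q x0 with values in the coinvariants of Q. *)
Definition sigma (x : kmod X) : Q := caninv (1 ⊗ x).
Fact kappa_linear : linear kappa. Proof. by rewrite /kappa; lin. Qed.
HB.instance Definition _ := GRing.isLinear.Build k A Q _ kappa kappa_linear.
Fact sigma_linear : linear sigma. Proof. by rewrite /sigma; lin. Qed.
HB.instance Definition _ :=
  GRing.isLinear.Build k (kmod X) Q _ sigma sigma_linear.

Lemma gcan_kappa a : gcan (kappa a) = a ⊗ (x0 : kmod X).
Proof. exact: gcaninvK. Qed.
Lemma gcan_sigma x : gcan (sigma x) = 1 ⊗ x. Proof. exact: gcaninvK. Qed.

Lemma kappa_orbit a : kact (kappa a) x0 = (hcounit A a : k) *: (x0 : kmod X).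
Proof. by rewrite [LHS]gcan_orbit gcan_kappa tmapE tlunitE. Qed.

Lemma sigma_orbit x : kact (sigma x) x0 = x.
Proof. by rewrite [LHS]gcan_orbit gcan_sigma tmapE tlunitE /= rmorph1 scale1r. Qed.

Lemma rho_kappa a : rho (kappa a) = tmap idfun kappa (hcomul A a).
Proof.
apply: tmap_gcan_inj; rewrite gcan_coassoc gcan_kappa tmapE /=.
elim/tensor_indD: (hcomul A a) => [b c|s t IHs IHt].
  by rewrite tassocE !tmapE /= gcan_kappa.
by rewrite linearDl !linearD /= IHs IHt.
Qed.

Lemma rho_sigma x : rho (sigma x) = 1 ⊗ sigma x.
Proof.
apply: tmap_gcan_inj; rewrite gcan_coassoc gcan_sigma tmapE hcomul1 /=.
by rewrite tassocE tmapE /= gcan_sigma.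
Qed.

(** The products of values of [sigma] and [kappa] thus fill Q, and the action of
    Q on an induced module is known from the two factors. *)
Lemma sigma_kappa x a : sigma x * kappa a = caninv (a ⊗ x).
Proof.
apply: gcan_inj; rewrite gcanM gcan_kappa rho_sigma tmap2E /= mul1r sigma_orbit.
by rewrite [RHS]gcaninvK.
Qed.

(** Through [kappa], A acts on n ⊗ x0 by acting on n, because [kappa a] scales
    x0 by the counit. *)
Lemma rho_kappa_act (N : lmodType A) (a : A) (n : kmod N) :
  tmap2 (@kact _ A N) (@kact _ Q X) (rho (kappa a)) (n ⊗ (x0 : kmod X)) =
  kact a n ⊗ (x0 : kmod X).
Proof.
rewrite rho_kappa -[in RHS](hcounitr a).
elim/tensor_indD: (hcomul A a) => [b c|s t IHs IHt].
  rewrite !tmapE tmap2E /= kappa_orbit trunitE linearZr_LR /=.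
  by rewrite (linearZl_LR _ _ (hcounit A c : k)) /= linearZl_LR.
by rewrite !linearD linearDl /= IHs IHt /= linearDl linearDl.
Qed.

Fact kappa_monoid : monoid_morphism kappa.
Proof.
split=> [|a b]; apply: gcan_inj; first by rewrite gcan_kappa gcan1.
rewrite gcanM !gcan_kappa rho_kappa -[in LHS](hcounitr a).
elim/tensor_indD: (hcomul A a) => [c d|s t IHs IHt].
  rewrite !tmapE tmap2E /= kappa_orbit trunitE linearZr_LR /=.
  by rewrite -scalerAl linearZl_LR.
by rewrite !linearD !linearDl /= -IHs -IHt.
Qed.
Definition kappa_alg : {lrmorphism A -> Q} :=
  mklrmorphism kappa_linear kappa_monoid.

Local Notation Ind := (ind grho_alg X).
Local Notation Res := (restr_mod kappa_alg).

Lemma ind_unit_linear (N : lmodType A) :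
  linear (fun n : N => (n : kmod N) ⊗ (x0 : kmod X) : Res (Ind N)).
Proof.
move=> a m n; rewrite linearDl /=; congr (_ + _).
by rewrite [RHS]rho_kappa_act.
Qed.
Definition ind_unit (N : lmodType A) : {linear N -> Res (Ind N)} :=
  mklin (@ind_unit_linear N).

Lemma sigma_act (N : lmodType A) (n : kmod N) (x : kmod X) :
  tmap2 (@kact _ A N) (@kact _ Q X) (rho (sigma x)) (n ⊗ (x0 : kmod X)) = n ⊗ x.
Proof. by rewrite rho_sigma tmap2E /= sigma_orbit /orbit_map /kact scale1r. Qed.

Lemma ind_ext (N : lmodType A) (M : lmodType Q) (f h : {linear Ind N -> M}) :
  (forall n : N, f (ind_unit N n) = h (ind_unit N n)) -> f =1 h.
Proof.
move=> fh; elim/tensor_indD => [n x|s t IHs IHt]; last by rewrite !linearD IHs IHt.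
have -> : n ⊗ x = sigma x *: ind_unit N n :> Ind N by rewrite -sigma_act.
by rewrite !linearZ fh.
Qed.

Lemma res_klinear (N : lmodType A) (M : lmodType Q) (f : {linear N -> Res M}) :
  linear (f : kmod N -> kmod M).
Proof.
move=> c m n.
have kc : kappa_alg c%:A = c%:A by rewrite linearZZ /= kappa_monoid.1.
rewrite kmodE linearP restrE; congr (_ + _).
exact: (congr1 (fun q => q *: (f m : M)) kc).
Qed.

(** The adjunction between induction and restriction along [kappa]. As n ⊗ x is
    sigma x (n ⊗ x0), a Q-linear map extending f has to send it to sigma x (f
    n). *)
Lemma ind_lift (N : lmodType A) (M : lmodType Q) (f : {linear N -> Res M}) :
  exists h : {linear Ind N -> M}, forall n, h (ind_unit N n) = f n.
Proof.
pose f' : {linear kmod N -> kmod M} := mklin (res_klinear f).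
pose F (n : kmod N) (x : kmod X) : kmod M := kact (sigma x) (f' n).
have FB : bilin F by rewrite /F; lin.
have FE n a x : F (kact a n) x = kact (caninv (a ⊗ x)) (f' n).
  have fE : f' (kact a n) = kact (kappa a) (f' n) := linearZZ f a n.
  by rewrite /F fE -sigma_kappa /kact scalerA.
have hL : linear (tlift F : Ind N -> M).
  apply: ind_linear => [s t|q n x]; first exact: (tliftD _ _ FB).
  have -> : tlift F (tmap2 (@kact _ A N) (@kact _ Q X) (rho q) (n ⊗ x)) =
      kact (caninv (tmap2 *%R (@kact _ Q X) (rho q) (1 ⊗ x))) (f' n).
    elim/tensor_indD: (rho q) => [a p|s t IHs IHt]; last first.
      by rewrite !linearDl linearD /= (tliftD _ _ FB) linearDl IHs IHt.
    by rewrite !tmap2E (tliftP _ _ FB) /= FE mulr1.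
  rewrite -gcan_sigma -gcanM gcanK (tliftP _ _ FB) /F.
  by rewrite /orbit_map /kact scalerA.
exists (mklin hL) => n; rewrite /= (tliftP _ _ FB) /F /sigma.
by rewrite -gcan1 gcanK /orbit_map /kact scale1r.
Qed.

(** Induction is left adjoint to an exact functor. *)
Lemma ind_projective (P : lmodType A) : projective P -> projective (Ind P).
Proof.
move=> Pp M N p f ps.
pose p' : {linear Res M -> Res N} := mklin (restr_linear (f := kappa_alg) p).
pose f' : {linear Res (Ind P) -> Res N} := mklin (restr_linear (f := kappa_alg) f).
have [h hP] := Pp _ _ p' (f' \o ind_unit P) ps.
have [h' h'P] := ind_lift h.
exists h'; apply: (ind_ext (f := p \o h')) => n.
by rewrite /= h'P; apply: hP.
Qed.

(** The induced sequence splits over Q by some v : Ind P -> Ind K. Extend K -> M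
    to w : Ind K -> M by adjunction. The composite of P -> Ind P, v, w and the
    retraction M -> K is A-linear and is the identity on K, so the original
    sequence splits. *)
Lemma ind_projective_descent (K P L : lmodType A) (i : {linear K -> P})
    (p : {linear P -> L}) (M : lmodType Q) :
  short_exact i p -> projective P -> projective (Ind L) ->
  retract K (Res M) -> projective L.
Proof.
move=> ex Pp ILp [s [r rK]].
have exI := ind_short_exact grho_alg X ex; have [_ Ips _] := exI.
have [u uK] := projective_section ILp Ips.
have [v [vK _]] := split_retraction exI uK.
have [w wP] := ind_lift s.
pose w' : {linear Res (Ind P) -> Res M} :=
  mklin (restr_linear (f := kappa_alg) (w \o v)).
pose t : {linear P -> K} := r \o (w' \o ind_unit P).
have tK y : t (i y) = y.
  have iy : ind_unit P (i y) = ind_map i (ind_unit K y).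
    by rewrite [RHS]tmapE.
  have -> : t (i y) = r (w (v (ind_unit P (i y)))) by [].
  by rewrite iy vK wP rK.
have fL : linear (fun x => x - i (t x)).
  by move=> a x y; rewrite (linearP t) (linearP i) scalerBr opprD addrACA.
have [|z zP] := short_exact_descend (f := mklin fL) ex.
  by move=> y; rewrite -[LHS]/(i y - i (t (i y))) tK subrr.
have [_ ps ip] := ex.
apply: projective_retract Pp; exists z, p => y; have [x <-] := ps y.
rewrite zP /= (linearB p) (_ : p (i _) = 0) ?subr0 //.
by apply/ip; exists (t x).
Qed.
End Galois.

(** * Trivial modules and descent of projective dimension *)

Definition trivmod (k : fieldType) (A : hopfAlg k) : Type := k.
Section Trivial.
Variables (k : fieldType) (A : hopfAlg k).
HB.instance Definition _ := GRing.Zmodule.on (trivmod A).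
Definition triv_scale (a : A) (c : trivmod A) : trivmod A :=
  (hcounit A a : k) * (c : k).
Fact triv_scaleA a b x : triv_scale a (triv_scale b x) = triv_scale (a * b) x.
Proof. by rewrite /triv_scale rmorphM mulrA. Qed.
Fact triv_scale1 : left_id 1 triv_scale.
Proof. by move=> x; rewrite /triv_scale rmorph1 mul1r. Qed.
Fact triv_scaleDr : right_distributive triv_scale +%R.
Proof. by move=> a x y; rewrite /triv_scale mulrDr. Qed.
Fact triv_scaleDl x : {morph triv_scale^~ x : a b / a + b}.
Proof. by move=> a b; rewrite /triv_scale raddfD mulrDl. Qed.
HB.instance Definition _ := GRing.Zmodule_isLmodule.Build A (trivmod A)
  triv_scaleA triv_scale1 triv_scaleDr triv_scaleDl.
Lemma trivE (a : A) (c : trivmod A) : a *: c = ((hcounit A a : k) * (c : k) : k).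
Proof. by []. Qed.
Lemma triv_kscale (c : k) (x : kmod (trivmod A)) : c *: x = (c * (x : k) : k).
Proof.
rewrite kmodE trivE; congr (_ * _).
by rewrite linearZZ rmorph1 /=; apply: mulr1.
Qed.
End Trivial.

Section IndTrivial.
Variables (k : fieldType) (A : hopfAlg k) (Q : algType k) (X : lmodType Q).
Variable rho : {lrmorphism Q -> talg A Q}.
Hypothesis rho1 : forall q, tlunit (tmap (hcounit A) idfun (rho q)) = q.

(** The counit axiom of the coaction makes c ⊗ x |-> c x a Q-linear map. *)
Lemma ind_triv : exists f : {linear ind rho X (trivmod A) -> X},
  injective f /\ surj f.
Proof.
pose F (c : kmod (trivmod A)) (x : kmod X) : kmod X := (c : k) *: x.
pose one : kmod (trivmod A) := (1 : k).
have FB : bilin F.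
  split=> [x a b c|c]; last by rewrite /F; lin.
  by rewrite /F triv_kscale scalerDl scalerA.
have fL : linear (tlift F : ind rho X (trivmod A) -> X).
  apply: ind_linear => [s t|q c x]; first exact: (tliftD _ _ FB).
  have -> : q *: (tlift F (c ⊗ x) : X) = kact q (tlift F (c ⊗ x)) by [].
  rewrite -[in RHS](rho1 q) (tliftP _ _ FB).
  elim/tensor_indD: (rho q) => [a p|s t IHs IHt]; last first.
    by rewrite !linearDl (tliftD _ _ FB) IHs IHt !linearD linearDl.
  rewrite tmap2E (tliftP _ _ FB) tmapE tlunitE /F /=.
  by rewrite [RHS]linearZl_LR /= linearZr_LR /= scalerA.
exists (mklin fL); split=> [|x] /=; last first.
  by exists (one ⊗ (x : kmod X)); rewrite (tliftP _ _ FB) /F scale1r.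
apply: (can_inj (g := fun x : X => one ⊗ (x : kmod X))).
elim/tensor_indD => [c x|s t IHs IHt]; last first.
  by rewrite (tliftD _ _ FB) linearDr /= IHs IHt.
rewrite (tliftP _ _ FB) /F linearZr_LR /= -linearZl_LR /=; congr (_ ⊗ _).
by rewrite triv_kscale mulr1.
Qed.
End IndTrivial.

Section Descent.
Variables (k : fieldType) (A : hopfAlg k) (Q : algType k) (X : lmodType Q).
Variables (x0 : X) (g : galois A x0).
Local Notation Ind := (ind (grho_alg g) X).
Local Notation Res := (restr_mod (kappa_alg g)).

Lemma pd_le_ind_galois m (N : lmodType A) : pd_le m N -> pd_le m (Ind N).
Proof. by apply: pd_le_ind => P; apply: ind_projective. Qed.

(** For m = 0, climb a finite resolution of N from its end. Since Ind N is
    projective, Ind K is a summand of Ind P; so K is projective by induction on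
    the length, and then N is projective by the previous lemma. For m > 0, pass
    to a syzygy. *)
Lemma pd_le_descent m (N : lmodType A) :
  (forall K : lmodType A, projective K ->
     exists M : lmodType Q, retract K (Res M)) ->
  pd_le m (Ind N) -> forall n, pd_le n N -> pd_le m N.
Proof.
move=> Kret; elim: m N => [|m IHm] N IN n Nn.
  elim: n N IN Nn => [|n IHn] N //= IN [P [K [i [p [ex Pp Kn]]]]].
  have exI := ind_short_exact (grho_alg g) X ex; have [_ Ips _] := exI.
  have [u uK] := projective_section IN Ips.
  have [v [vK _]] := split_retraction exI uK.
  have Kp : projective K.
    apply: IHn Kn; rewrite -[pd_le 0 _]/(projective (Ind K)).
    have IKP : retract (Ind K) (Ind P) by exists (ind_map i), v.
    exact: projective_retract IKP (ind_projective (g := g) Pp).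
  have [M KM] := Kret K Kp.
  exact: ind_projective_descent ex Pp IN KM.
have [h hs] := free_cover N.
have ex := ker_short_exact hs.
have Pp := @free_projective _ A (kmod N).
exists (freemod A (kmod N)), (kermod h), ker_val, h; split=> //.
apply: (IHm _ _ n).
  exact: pd_le_syzygy (ind_short_exact (grho_alg g) X ex)
    (ind_projective (g := g) Pp) IN.
exact: pd_le_syzygy ex Pp (pd_leS Nn).
Qed.

(** Here the syzygy of a free cover is itself a summand of a restricted module,
    and the splitting descends at the first step. *)
Lemma pd_le_descent_all m (N : lmodType A) :
  (forall K : lmodType A, exists M : lmodType Q, retract K (Res M)) ->
  pd_le m (Ind N) -> pd_le m N.
Proof.
move=> Kret; elim: m N => [|m IHm] N IN; have [h hs] := free_cover N;
  have ex := ker_short_exact hs; have Pp := @free_projective _ A (kmod N).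
  by have [M KM] := Kret (kermod h); apply: ind_projective_descent ex Pp IN KM.
exists (freemod A (kmod N)), (kermod h), ker_val, h; split=> //.
apply: IHm; exact: pd_le_syzygy (ind_short_exact (grho_alg g) X ex)
    (ind_projective (g := g) Pp) IN.
Qed.
End Descent.

(** * Twisting by the antipode *)

Section Twist.
Variables (k : fieldType) (A : hopfAlg k) (M : lmodType k).
Variable act : {bilinear A -> M -> M}.
Hypothesis act1 : forall m, act 1 m = m.
Hypothesis actM : forall a b m, act (a * b) m = act a (act b m).

(** The map a ⊗ m |-> a_(1) ⊗ a_(2) m, which carries the action of A on the left
    factor to the diagonal one. The antipode inverts it. *)
Definition twist : tensor A M -> tensor A M :=
  tlift (fun a m => tlift (fun b c => b ⊗ act c m) (hcomul A a)).
Definition untwist : tensor A M -> tensor A M :=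
  tlift (fun a m => tlift (fun b c => b ⊗ act (hantipode A c) m) (hcomul A a)).

Let twB : bilin (fun a m => tlift (fun b c => b ⊗ act c m) (hcomul A a)).
Proof. by lin. Qed.
Let untwB :
  bilin (fun a m => tlift (fun b c => b ⊗ act (hantipode A c) m) (hcomul A a)).
Proof. by lin. Qed.

Lemma twistE a m : twist (a ⊗ m) = tlift (fun b c => b ⊗ act c m) (hcomul A a).
Proof. exact: tliftP. Qed.
Lemma untwistE a m :
  untwist (a ⊗ m) = tlift (fun b c => b ⊗ act (hantipode A c) m) (hcomul A a).
Proof. exact: tliftP. Qed.
Fact twist_linear : linear twist.
Proof. exact: lin_tlift twB _. Qed.
Fact untwist_linear : linear untwist.
Proof. exact: lin_tlift untwB _. Qed.
HB.instance Definition _ := GRing.isLinear.Build k _ _ _ twist twist_linear.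
HB.instance Definition _ := GRing.isLinear.Build k _ _ _ untwist untwist_linear.

Lemma twistK : cancel twist untwist.
Proof.
elim/tensor_indD => [a m|x y IHx IHy]; last by rewrite !linearD /= IHx IHy.
rewrite twistE tlift_app /=.
under eq_tlift => b c do rewrite untwistE.
rewrite (sw_coassoc (F := fun b c d => b ⊗ act (hantipode A c) (act d m)));
  try by lin.
under eq_tlift => b c.
  under eq_tlift => d e do rewrite -actM.
  rewrite (sw_antipodel (F := fun x => b ⊗ act x m)); last by lin.
  rewrite linearZl_LR /= act1 linearZr_LR.
  over.
by rewrite (sw_counitr (F := fun x => x ⊗ m)) //; lin.
Qed.

Lemma untwistK : cancel untwist twist.
Proof.
elim/tensor_indD => [a m|x y IHx IHy]; last by rewrite !linearD /= IHx IHy.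
rewrite untwistE tlift_app /=.
under eq_tlift => b c do rewrite twistE.
rewrite (sw_coassoc (F := fun b c d => b ⊗ act c (act (hantipode A d) m)));
  try by lin.
under eq_tlift => b c.
  under eq_tlift => d e do rewrite -actM.
  rewrite (sw_antipoder (F := fun x => b ⊗ act x m)); last by lin.
  rewrite linearZl_LR /= act1 linearZr_LR.
  over.
by rewrite (sw_counitr (F := fun x => x ⊗ m)) //; lin.
Qed.
End Twist.

(** * Freeness over the Hopf algebra; tensor products of modules *)

Section FreeOverGalois.
Variables (k : fieldType) (A : hopfAlg k) (Q : algType k) (X : lmodType Q).
Variables (x0 : X) (g : galois A x0).
Local Notation kappa := (kappa g).
Local Notation sigma := (sigma g).

Definition kappa_act (a : A) (x : kmod X) : kmod X := kact (kappa a) x.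
Fact kappa_act_bilinear : bilinear_for *:%R *:%R kappa_act.
Proof. by split; rewrite /kappa_act; lin. Qed.
HB.instance Definition _ := bilinear_isBilinear.Build k A (kmod X) (kmod X) _ _
  kappa_act kappa_act_bilinear.

Lemma kappa_act1 x : kappa_act 1 x = x.
Proof. by rewrite /kappa_act (kappa_monoid g).1 /kact scale1r. Qed.
Lemma kappa_actM a b x : kappa_act (a * b) x = kappa_act a (kappa_act b x).
Proof. by rewrite /kappa_act (kappa_monoid g).2 /kact scalerA. Qed.

Definition kappa_sigma : tensor A (kmod X) -> Q :=
  tlift (fun a x => kappa a * sigma x).
Let ksB : bilin (fun a x => kappa a * sigma x). Proof. by lin. Qed.

Let ksD s t : kappa_sigma (s + t) = kappa_sigma s + kappa_sigma t.
Proof. exact: tliftD. Qed.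

(** The right side is bijective in t, so a ⊗ x |-> kappa a * sigma x makes Q a
    free left A-module on X. *)
Lemma gcan_kappa_sigma t : gcan g (kappa_sigma t) = twist kappa_act t.
Proof.
elim/tensor_indD: t => [a x|s t IHs IHt]; last first.
  by rewrite /kappa_sigma (tliftD _ _ ksB) !linearD /= -IHs -IHt.
rewrite /kappa_sigma (tliftP _ _ ksB) twistE gcanM gcan_sigma rho_kappa.
elim/tensor_indD: (hcomul A a) => [b c|s t IHs IHt]; last first.
  rewrite linearD linearDl /= IHs IHt [RHS]tliftD //; last by lin.
by rewrite tmapE tmap2E /= mulr1 tliftP //; lin.
Qed.

Lemma orbit_neq0 : (x0 : kmod X) != 0.
Proof.
apply/eqP => x00.
have orbit0 p : orbit_map x0 p = 0.
  by rewrite /orbit_map /kact (x00 : x0 = 0) [LHS]scaler0.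
have can0 q : gcan g q = 0.
  rewrite /gcan; elim/tensor_indD: (grho g q) => [a p|s t IHs IHt].
    rewrite tmapE /= (orbit0 p); exact: (linear0 (ptens a)).
  by rewrite linearD /= IHs IHt addr0.
have := gcan_inj (g := g) (etrans (can0 1) (esym (can0 0))).
by apply/eqP; exact: oner_neq0.
Qed.

(** The coordinate of Q = A ⊗ X along a functional with value 1 at x0; it makes
    A a summand of the left A-module Q. *)
Lemma kappa_coordinate : exists r : {linear Q -> A},
  r 1 = 1 /\ forall a q, r (kappa a * q) = a * r q.
Proof.
have [phi phi1] := functional_at orbit_neq0.
pose r q : A := trunit (tmap idfun phi (untwist kappa_act (gcan g q))).
have rL : linear r by rewrite /r; lin.
have twK := twistK kappa_act1 kappa_actM.
have untwK := untwistK kappa_act1 kappa_actM.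
exists (mklin rL); split => [|a q] /=.
  rewrite /r; have -> : gcan g 1 = twist kappa_act (1 ⊗ (x0 : kmod X)).
    by rewrite twistE hcomul1 tliftP ?gcan1 /= ?kappa_act1 //; lin.
  by rewrite twK tmapE /= phi1 trunitE scale1r.
have [t tE] : exists t, q = kappa_sigma t.
  exists (untwist kappa_act (gcan g q)).
  by apply: (gcan_inj (g := g)); rewrite gcan_kappa_sigma untwK.
have aL : linear (fun b : A => a * b) by lin.
have -> : kappa a * q = kappa_sigma (tmap (mklin aL) idfun t).
  rewrite tE; elim/tensor_indD: (t) => [b x|u v IHu IHv].
    by rewrite tmapE /kappa_sigma !(tliftP _ _ ksB) /= (kappa_monoid g).2 mulrA.
  by rewrite (linearD (tmap (mklin aL) idfun)) !ksD mulrDr IHu IHv.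
rewrite tE /r !gcan_kappa_sigma !twK.
elim/tensor_indD: (t) => [b x|u v IHu IHv]; last first.
  by rewrite !linearD /= IHu IHv mulrDr.
by rewrite !tmapE !trunitE /= scalerAr.
Qed.

(** K is a summand of A ⊗ K, which is a summand of the restriction of Q ⊗ K
    because A is one of Q. *)
Lemma projective_restriction (K : lmodType A) : projective K ->
  exists M : lmodType Q, retract K (restr_mod (kappa_alg g) M).
Proof.
move=> Kp; exists (freemod Q (kmod K)).
apply: retract_trans (projective_retract_free Kp) _.
have [r [r1 rM]] := kappa_coordinate.
have sL : linear (tmap kappa idfun :
    freemod A (kmod K) -> restr_mod (kappa_alg g) (freemod Q (kmod K))).
  apply: free_linear => [s t|a b v]; first exact: linearD.
  by rewrite restrE /= !tmapE /= freemodE (kappa_monoid g).2.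
have rL : linear (tmap r idfun :
    restr_mod (kappa_alg g) (freemod Q (kmod K)) -> freemod A (kmod K)).
  move=> a s t; rewrite linearD; congr (_ + _).
  elim/tensor_indD: s => [q v|x y IHx IHy]; last first.
    by rewrite scalerDr !linearD /= IHx IHy scalerDr.
  by rewrite restrE /= freemodE !tmapE /= rM freemodE.
exists (mklin sL), (mklin rL) => t /=.
rewrite tmap_comp (eq_tmap (f' := idfun) (g' := idfun)) ?tmap_id // => a /=.
by rewrite -[kappa a]mulr1 rM r1 mulr1.
Qed.
End FreeOverGalois.

Section TensorModules.
Variables (k : fieldType) (A : hopfAlg k) (M : lmodType A).

Fact comul_linear : linear (hcomul A : A -> talg A A).
Proof. exact: linearP. Qed.
Fact comul_monoid : monoid_morphism (hcomul A : A -> talg A A).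
Proof. by split; [exact: hcomul1|exact: hcomulM]. Qed.
Definition comul_alg : {lrmorphism A -> talg A A} :=
  mklrmorphism comul_linear comul_monoid.

Variable V : lmodType k.

Definition mid_act (a : A) (w : tensor V (kmod M)) : tensor V (kmod M) :=
  tmap idfun (@kact _ A M a) w.
Fact mid_act_bilinear : bilinear_for *:%R *:%R mid_act.
Proof.
split=> [w a x y|a]; last exact: linearP.
rewrite /mid_act; apply: tmap_linearr => m.
exact: (kact_bilinear M).1.
Qed.
HB.instance Definition _ := bilinear_isBilinear.Build k A _ _ _ _
  mid_act mid_act_bilinear.
Lemma mid_act1 w : mid_act 1 w = w.
Proof.
rewrite /mid_act (eq_tmap (f' := idfun) (g' := idfun)) ?tmap_id // => m.
by rewrite /= /kact scale1r.
Qed.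
Lemma mid_actM a b w : mid_act (a * b) w = mid_act a (mid_act b w).
Proof.
rewrite /mid_act tmap_comp; apply: eq_tmap => // m.
by rewrite /= /kact scalerA.
Qed.

Local Notation FV := (freemod A V).

Fact kmod_free_linear : linear (id : kmod FV -> tensor A V).
Proof. by move=> c s t; rewrite kmodE free_kscale. Qed.

Fact free_kmod_linear : linear (id : tensor A V -> kmod FV).
Proof. by move=> c s t; rewrite kmodE free_kscale. Qed.

(** The twist identifies the diagonal module (A ⊗ V) ⊗ M with the free module on
    V ⊗ M. *)
Lemma free_tensor_projective : projective (ind comul_alg M FV).
Proof.
pose F (v : V) (m : kmod M) : kmod (ind comul_alg M FV) :=
  ((1 ⊗ v : tensor A V) : kmod FV) ⊗ m.
(* The k-structure of the diagonal module is that of the tensor product. *)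
have zE c (t : kmod (ind comul_alg M FV)) :
    c *: t = (c *: (t : tensor (kmod FV) (kmod M)) : tensor (kmod FV) (kmod M)).
  rewrite kmodE; set t' : ind comul_alg M FV := t.
  rewrite indE linearZZ rmorph1 linearZl_LR /=.
  apply: (congr1 (fun u : tensor (kmod FV) (kmod M) => c *: u)).
  exact: (scale1r (t' : extmod FV M)).
have FB : bilin F.
  split=> [m a v w|v a m n]; rewrite /F /= zE.
    rewrite -linearPl; congr (_ ⊗ _); rewrite kmodE free_kscale.
    by rewrite linearPr.
  by rewrite linearPr.
have [h hE] := free_lift (mklin (linearP (tlift (mkbilin FB)))).
pose u : {linear kmod FV -> tensor A V} := mklin kmod_free_linear.
pose u' : {linear tensor A V -> kmod FV} := mklin free_kmod_linear.
pose theta : {linear tensor (kmod FV) (kmod M) -> tensor A (tensor V (kmod M))} :=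
  @tassoc k A V (kmod M) \o tmap u idfun.
have theta_inj : injective theta.
  have uK : cancel u u' by [].
  apply: inj_comp (@tassoc_inj _ _ _ _) (can_inj (tmap_can uK)).
have thetaE t : theta (h t) = twist mid_act t.
  elim/tensor_indD: t => [a w|s t IHs IHt]; last by rewrite !linearD IHs IHt.
  elim/tensor_indD: w => [v m|s t IHs IHt]; last first.
    by rewrite linearDr !linearD IHs IHt.
  have FE : mklin (linearP (tlift (mkbilin FB))) (v ⊗ m) = F v m.
    exact: (tliftP _ _ FB).
  rewrite hE FE twistE.
  have -> : (a *: (F v m : ind comul_alg M FV) : ind comul_alg M FV) =
    tmap2 (@kact _ A FV) (@kact _ A M) (hcomul A a) (F v m) by [].
  elim/tensor_indD: (hcomul A a) => [b c|s t IHs IHt]; last first.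
    rewrite [RHS]tliftD; last by lin.
    by rewrite -IHs -IHt -(linearD theta) -linearDl.
  rewrite [RHS]tliftP; last by lin.
  have th0 (n : kmod FV) (x : kmod M) :
    theta (n ⊗ x) = tassoc ((n : tensor A V) ⊗ x) := congr1 _ (tmapE u idfun n x).
  have kE : kact b ((1 ⊗ v : tensor A V) : kmod FV) = (b ⊗ v : tensor A V).
    by rewrite /kact freemodE mulr1.
  by rewrite tmap2E th0 /= kE tassocE /mid_act tmapE.
have h_inj : injective h.
  move=> s t /(congr1 theta); rewrite !thetaE.
  exact: (can_inj (twistK mid_act1 mid_actM)).
have h_surj : surj h.
  move=> t; exists (untwist mid_act (theta t)).
  by apply: theta_inj; rewrite thetaE (untwistK mid_act1 mid_actM).
exact: projective_retract (retract_bij h_inj h_surj) (@free_projective _ _ _).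
Qed.
End TensorModules.

(** M is k ⊗ M with the diagonal action, so a resolution of k tensored with M is
    one of M. *)
Lemma pd_le_triv_all (k : fieldType) (A : hopfAlg k) m :
  pd_le m (trivmod A : lmodType A) -> forall M : lmodType A, pd_le m M.
Proof.
move=> Tm M.
have rho1 q : tlunit (tmap (hcounit A) idfun (comul_alg A q)) = q.
  exact: hcounitl.
have [f [fi fs]] := ind_triv M rho1.
apply: (pd_le_iso fi fs); apply: pd_le_ind Tm => P Pp.
have PR := ind_retract (comul_alg A) M (projective_retract_free Pp).
exact: projective_retract PR (@free_tensor_projective _ _ _ _).
Qed.

(** * The opposite Hopf algebra *)

Section OppositeHopf.
Variables (k : fieldType) (A : hopfAlg k).
Local Notation Aop := (opalg A).

Definition op_comul (h : Aop) : tensor Aop Aop :=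
  tlift (fun a b : A => (b : Aop) ⊗ (a : Aop)) (hcomul A h).
Let opB : bilin (fun a b : A => (b : Aop) ⊗ (a : Aop)).
Proof. by split=> [w a x y|w a x y]; rewrite ?[LHS]linearPl ?[LHS]linearPr. Qed.
Fact op_comul_linear : linear op_comul.
Proof.
by move=> a x y; rewrite /op_comul -(linearP (tlift (mkbilin opB))) -linearP.
Qed.
HB.instance Definition _ :=
  GRing.isLinear.Build k Aop (tensor Aop Aop) _ op_comul op_comul_linear.

Definition op_counit (h : Aop) : k^o := hcounit A h.
Fact op_counit_linear : linear op_counit.
Proof. by move=> a x y; rewrite /op_counit -linearP. Qed.
Fact op_counit_monoid : monoid_morphism op_counit.
Proof.
split=> [|a b]; first exact: rmorph1.
by rewrite /op_counit opalg_mulE rmorphM; apply: mulrC.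
Qed.
HB.instance Definition _ :=
  GRing.isLinear.Build k Aop k^o _ op_counit op_counit_linear.
HB.instance Definition _ :=
  GRing.isMonoidMorphism.Build Aop k^o op_counit op_counit_monoid.

Definition op_antipode (h : Aop) : Aop := hantipode A h.
Fact op_antipode_linear : linear op_antipode.
Proof. by move=> a x y; rewrite /op_antipode -linearP. Qed.
HB.instance Definition _ :=
  GRing.isLinear.Build k Aop Aop _ op_antipode op_antipode_linear.

Fact op_comulA h :
  tassoc (tmap op_comul idfun (op_comul h)) = tmap idfun op_comul (op_comul h).
Proof.
have DE (b : Aop) :
  op_comul b = tlift (fun a b : A => (b : Aop) ⊗ (a : Aop)) (hcomul A b).
  by [].
have F1 b c : linear (fun a : A => (c : Aop) ⊗ ((b : Aop) ⊗ (a : Aop))).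
  by move=> e x y; rewrite [X in _ ⊗ X]linearPr [LHS]linearPr.
have F2 a c : linear (fun b : A => (c : Aop) ⊗ ((b : Aop) ⊗ (a : Aop))).
  by move=> e x y; rewrite [X in _ ⊗ X]linearPl [LHS]linearPr.
have F3 a b : linear (fun c : A => (c : Aop) ⊗ ((b : Aop) ⊗ (a : Aop))).
  by move=> e x y; rewrite [LHS]linearPl.
rewrite !DE !(tlift_app (tmap _ _)) (tlift_app (@tassoc k Aop Aop Aop)) /=.
transitivity (tlift (fun a x =>
  tlift (fun b c => (c : Aop) ⊗ ((b : Aop) ⊗ (a : Aop))) (hcomul A x))
  (hcomul A h)).
  apply: eq_tlift => a b; rewrite tmapE /= DE.
  have L : linear (fun t : tensor Aop Aop => tassoc (t ⊗ a)) by lin.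
  by rewrite (tlift_lin _ _ L); apply: eq_tlift => c d; rewrite tassocE.
rewrite -sw_coassoc //; apply: eq_tlift => a b; rewrite tmapE /= DE.
by rewrite (tlift_app (ptens (b : Aop))).
Qed.

Fact op_counitl h : tlunit (tmap op_counit idfun (op_comul h)) = h.
Proof.
rewrite /op_comul (tlift_app (tmap _ _)) (tlift_app (@tlunit k Aop)) /=.
rewrite -[RHS](hcounitr h) -[in RHS](tlift_ptens (hcomul A h)).
rewrite (tlift_app (tmap _ _)) (tlift_app (@trunit k A)) /=.
by apply: eq_tlift => a b; rewrite !tmapE tlunitE trunitE.
Qed.

Fact op_counitr h : trunit (tmap idfun op_counit (op_comul h)) = h.
Proof.
rewrite /op_comul (tlift_app (tmap _ _)) (tlift_app (@trunit k Aop)) /=.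
rewrite -[RHS](hcounitl h) -[in RHS](tlift_ptens (hcomul A h)).
rewrite (tlift_app (tmap _ _)) (tlift_app (@tlunit k A)) /=.
by apply: eq_tlift => a b; rewrite !tmapE tlunitE trunitE.
Qed.

Fact op_comul1 : op_comul 1 = 1 ⊗ 1.
Proof. by rewrite /op_comul hcomul1 (tliftP _ _ opB). Qed.

Fact op_comulM a b : op_comul (a * b) = tmap2 *%R *%R (op_comul a) (op_comul b).
Proof.
rewrite /op_comul opalg_mulE hcomulM.
elim/tensor_indD: (hcomul A a) => [c d|s t IHs IHt]; last first.
  by rewrite linearDr !(tliftD _ _ opB) linearDl /= IHs IHt.
elim/tensor_indD: (hcomul A b) => [e f|s t IHs IHt]; last first.
  by rewrite linearDl !(tliftD _ _ opB) linearDr /= IHs IHt.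
by rewrite tmap2E !(tliftP _ _ opB) tmap2E.
Qed.

Fact op_antipodel h :
  tlift *%R (tmap op_antipode idfun (op_comul h)) = op_counit h *: 1.
Proof.
rewrite /op_comul (tlift_app (tmap _ _)) (tlift_app (tlift _)) /=.
rewrite -[RHS](hantipoder h) -[in RHS](tlift_ptens (hcomul A h)).
rewrite (tlift_app (tmap _ _)) (tlift_app (tlift _)) /=.
by apply: eq_tlift => a b; rewrite !tmapE !tliftE.
Qed.

Fact op_antipoder h :
  tlift *%R (tmap idfun op_antipode (op_comul h)) = op_counit h *: 1.
Proof.
rewrite /op_comul (tlift_app (tmap _ _)) (tlift_app (tlift _)) /=.
rewrite -[RHS](hantipodel h) -[in RHS](tlift_ptens (hcomul A h)).
rewrite (tlift_app (tmap _ _)) (tlift_app (tlift _)) /=.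
by apply: eq_tlift => a b; rewrite !tmapE !tliftE.
Qed.

(** Opposing the product and the coproduct together keeps the antipode, whereas
    opposing one of them would call for its inverse. The left modules of
    [op_hopf A] are the right modules of A. *)
Definition op_hopf : hopfAlg k :=
  @HopfAlg k Aop op_comul op_counit op_antipode op_comulA op_counitl op_counitr
    op_comul1 op_comulM op_antipodel op_antipoder.
End OppositeHopf.

(** * Bi-Galois algebras *)

Section Bimodule.
Variables (k : fieldType) (R : algType k).

Definition envalg : algType k := talg R (opalg R).

Definition regbimod : Type := R.
HB.instance Definition _ := GRing.Zmodule.on regbimod.
Definition bimod_scale (t : envalg) (z : regbimod) : regbimod :=
  tlift (fun (x : R) (y : opalg R) => x * (z : R) * (y : R)) t.
Let scaleB (z : R) : bilin (fun (x : R) (y : opalg R) => x * z * (y : R)).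
Proof.
split=> [y c u v|x c u v]; first by rewrite !mulrDl -!scalerAl.
by rewrite [LHS]mulrDr -scalerAr.
Qed.
Lemma bimod_scaleE0 (x y : R) z : bimod_scale (x ⊗ (y : opalg R)) z = x * (z : R) * y.
Proof. exact: (tliftP _ _ (scaleB z)). Qed.
Fact bimod_scaleDl z : {morph bimod_scale^~ z : s t / s + t}.
Proof. by move=> s t; apply: (tliftD _ _ (scaleB z)). Qed.
Fact bimod_scaleDr : right_distributive bimod_scale +%R.
Proof.
move=> t z z'; elim/tensor_indD: t => [x y|s t IHs IHt].
  by rewrite !bimod_scaleE0 -mulrDl -mulrDr.
by rewrite !bimod_scaleDl IHs IHt addrACA.
Qed.
Fact bimod_scaleA s t z : bimod_scale s (bimod_scale t z) = bimod_scale (s * t) z.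
Proof.
elim/tensor_indD: s => [x y|s s' IHs IHs']; last first.
  by rewrite mulrDl !bimod_scaleDl IHs IHs'.
elim/tensor_indD: t => [x' y'|t t' IHt IHt']; last first.
  by rewrite mulrDr !bimod_scaleDl bimod_scaleDr IHt IHt'.
by rewrite talg_mulE opalg_mulE !bimod_scaleE0 !mulrA.
Qed.
Fact bimod_scale1 : left_id 1 bimod_scale.
Proof. by move=> z; rewrite [LHS]bimod_scaleE0 mul1r mulr1. Qed.
HB.instance Definition _ := GRing.Zmodule_isLmodule.Build envalg regbimod
  bimod_scaleA bimod_scale1 bimod_scaleDr bimod_scaleDl.

Lemma bimodE (x y : R) (z : regbimod) :
  (x ⊗ (y : opalg R) : envalg) *: z = (x * (z : R) * y : R).
Proof. exact: bimod_scaleE0. Qed.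

Definition to_bimod (x : R) : kmod regbimod := x.
Definition of_bimod (x : kmod regbimod) : R := x.
Fact to_bimod_linear : linear to_bimod.
Proof.
move=> c x y; congr (_ + _); rewrite kmodE [RHS](_ : _ = bimod_scale (c *: 1) x) //.
by rewrite -linearZl_LR [RHS]bimod_scaleE0 mulr1 -scalerAl mul1r.
Qed.
Fact of_bimod_linear : linear of_bimod.
Proof. by move=> c x y; exact: esym (to_bimod_linear c x y). Qed.
HB.instance Definition _ :=
  GRing.isLinear.Build k R (kmod regbimod) _ to_bimod to_bimod_linear.
HB.instance Definition _ :=
  GRing.isLinear.Build k (kmod regbimod) R _ of_bimod of_bimod_linear.
End Bimodule.

Section LegMultiplication.
Variables (k : fieldType) (R : algType k).

Definition rmul (y z : R) : R := z * y.
Definition lmul (x z : R) : R := x * z.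
Fact rmul_bilinear : bilinear_for *:%R *:%R rmul.
Proof. by split; rewrite /rmul; lin. Qed.
Fact lmul_bilinear : bilinear_for *:%R *:%R lmul.
Proof. by split; rewrite /lmul; lin. Qed.
HB.instance Definition _ y :=
  GRing.isLinear.Build k R R _ (rmul y) (rmul_bilinear.2 y).
HB.instance Definition _ x :=
  GRing.isLinear.Build k R R _ (lmul x) (lmul_bilinear.2 x).

Variable U : lmodType k.
Definition rleg (y : R) (t : tensor U R) : tensor U R := tmap idfun (rmul y) t.
Definition lleg (x : R) (t : tensor R U) : tensor R U := tmap (lmul x) idfun t.

Fact rleg_bilinear : bilinear_for *:%R *:%R rleg.
Proof.
split=> [t a x y|y]; last exact: linearP.
by apply: tmap_linearr => z; apply: rmul_bilinear.1.
Qed.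
Fact lleg_bilinear : bilinear_for *:%R *:%R lleg.
Proof.
split=> [t a x y|x]; last exact: linearP.
by apply: tmap_linearl => z; apply: lmul_bilinear.1.
Qed.
HB.instance Definition _ := bilinear_isBilinear.Build k R (tensor U R)
  (tensor U R) _ _ rleg rleg_bilinear.
HB.instance Definition _ := bilinear_isBilinear.Build k R (tensor R U)
  (tensor R U) _ _ lleg lleg_bilinear.
HB.instance Definition _ y :=
  GRing.isLinear.Build k _ _ _ (rleg y) (rleg_bilinear.2 y).
HB.instance Definition _ x :=
  GRing.isLinear.Build k _ _ _ (lleg x) (lleg_bilinear.2 x).

Lemma rlegE y u z : rleg y (u ⊗ z) = u ⊗ (z * y).
Proof. exact: tmapE. Qed.
Lemma llegE x z u : lleg x (z ⊗ u) = (x * z) ⊗ u.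
Proof. exact: tmapE. Qed.
Lemma rlegM x y t : rleg (x * y) t = rleg y (rleg x t).
Proof. by rewrite /rleg tmap_comp; apply: eq_tmap => // z; rewrite /= /rmul mulrA. Qed.
Lemma llegM x y t : lleg (x * y) t = lleg x (lleg y t).
Proof. by rewrite /lleg tmap_comp; apply: eq_tmap => // z; rewrite /= /lmul mulrA. Qed.
End LegMultiplication.

(** The canonical maps x ⊗ y |-> x_(-1) ⊗ x_(0) y and x ⊗ y |-> x y_(0) ⊗ y_(1)
    are R-linear on one side, so their inverses are recorded by the translation
    maps, the values at a ⊗ 1 and 1 ⊗ b. *)
Record bigalois (k : fieldType) (A B : hopfAlg k) (R : algType k) := BiGalois {
  lco : {linear R -> tensor A R};
  lcoM : monoid_morphism (lco : R -> talg A R);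
  lcoA : forall x, tassoc (tmap (hcomul A) idfun (lco x)) = tmap idfun lco (lco x);
  lco1 : forall x, tlunit (tmap (hcounit A) idfun (lco x)) = x;
  ltr : {linear A -> tensor R R};
  ltrK : forall a, tlift (fun x y => rleg y (lco x)) (ltr a) = a ⊗ 1;
  ltrE : forall x, tlift (fun a y => rleg y (ltr a)) (lco x) = x ⊗ 1;
  rco : {linear R -> tensor R B};
  rcoM : monoid_morphism (rco : R -> talg R B);
  rcoA : forall x, tassoc (tmap rco idfun (rco x)) = tmap idfun (hcomul B) (rco x);
  rco1 : forall x, trunit (tmap idfun (hcounit B) (rco x)) = x;
  rtr : {linear B -> tensor R R};
  rtrK : forall b, tlift (fun x y => lleg x (rco y)) (rtr b) = 1 ⊗ b;
  rtrE : forall x, tlift (fun y b => lleg y (rtr b)) (rco x) = 1 ⊗ x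
}.

Section BiGaloisLeft.
Variables (k : fieldType) (A B : hopfAlg k) (R : algType k).
Variable g : bigalois A B R.
Local Notation Q := (envalg R).
Local Notation X := (regbimod R : lmodType Q).

Definition lg_rho (q : Q) : tensor A Q := tassoc (tmap (lco g) idfun q).
Fact lg_rho_linear : linear lg_rho. Proof. by rewrite /lg_rho; lin. Qed.
HB.instance Definition _ :=
  GRing.isLinear.Build k Q (tensor A Q) _ lg_rho lg_rho_linear.

Lemma lg_rhoE x (y : opalg R) :
  lg_rho (x ⊗ y) = tmap idfun (applyr (@ptens k R (opalg R)) y) (lco g x).
Proof.
rewrite /lg_rho tmapE.
elim/tensor_indD: (lco g x) => [a z|s t IHs IHt]; first by rewrite tassocE tmapE.
by rewrite linearDl !linearD /= IHs IHt.
Qed.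

Fact lg_rho_monoid : monoid_morphism (lg_rho : Q -> talg A Q).
Proof.
split=> [|s t]; first by rewrite [LHS]lg_rhoE (lcoM g).1 tmapE.
elim/tensor_indD: s => [x y|s s' IHs IHs']; last first.
  by rewrite mulrDl !linearD /= IHs IHs' [RHS]mulrDl.
elim/tensor_indD: t => [x' y'|t t' IHt IHt']; last first.
  by rewrite mulrDr !linearD /= IHt IHt' [RHS]mulrDr.
rewrite talg_mulE !lg_rhoE (lcoM g).2 /=.
elim/tensor_indD: (lco g x) => [a z|u u' IHu IHu']; last first.
  by rewrite mulrDl !linearD /= IHu IHu' [RHS]mulrDl.
elim/tensor_indD: (lco g x') => [a' z'|u u' IHu IHu']; last first.
  by rewrite mulrDr !linearD /= IHu IHu' [RHS]mulrDr.
by rewrite talg_mulE !tmapE /= !talg_mulE.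
Qed.

Lemma lg_rhoA q :
  tassoc (tmap (hcomul A) idfun (lg_rho q)) = tmap idfun lg_rho (lg_rho q).
Proof.
elim/tensor_indD: q => [x y|s t IHs IHt]; last by rewrite !linearD /= IHs IHt.
rewrite !lg_rhoE /=.
pose fy : {linear R -> Q} := applyr (@ptens k R (opalg R)) y.
transitivity (tmap idfun (tmap idfun fy) (tassoc (tmap (hcomul A) idfun (lco g x)))).
  elim/tensor_indD: (lco g x) => [a z|u u' IHu IHu']; last first.
    by rewrite !linearD /= IHu IHu'.
  rewrite !tmapE /=.
  elim/tensor_indD: (hcomul A a) => [b c|u u' IHu IHu']; last first.
    by rewrite !(linearDl, linearD) /= IHu IHu'.
  by rewrite !tassocE tmapE /= tmapE.
rewrite lcoA !tmap_comp; apply: eq_tmap => // z /=.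
by rewrite lg_rhoE.
Qed.

Lemma lg_rho1 q : tlunit (tmap (hcounit A) idfun (lg_rho q)) = q.
Proof.
elim/tensor_indD: q => [x y|s t IHs IHt]; last by rewrite !linearD /= IHs IHt.
rewrite lg_rhoE -[in RHS](lco1 g x).
elim/tensor_indD: (lco g x) => [a z|u u' IHu IHu']; last first.
  by rewrite !(linearD, linearDl) /= IHu IHu'.
by rewrite !tmapE !tlunitE /= linearZl_LR.
Qed.

Definition lg_caninv (t : tensor A (kmod X)) : Q :=
  tlift (fun (a : A) (z : kmod X) => rleg (z : R) (ltr g a) : tensor R (opalg R)) t.
Let caninvB : bilin (fun (a : A) (z : kmod X) =>
  rleg (z : R) (ltr g a) : tensor R (opalg R)).
Proof.
split=> [z|a]; first by lin.
exact: (@lin_bil1 _ _ _ _ _ (@rleg k R R) (fun z : kmod X => z : R) (ltr g a)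
  (@of_bimod_linear k R)).
Qed.
Fact lg_caninv_linear : linear lg_caninv.
Proof. exact: lin_tlift caninvB _. Qed.
HB.instance Definition _ :=
  GRing.isLinear.Build k (tensor A (kmod X)) Q _ lg_caninv lg_caninv_linear.

Let x0 : X := (1 : R).
Lemma lg_canE x (y : opalg R) : tmap idfun (orbit_map x0) (lg_rho (x ⊗ y)) =
  tmap idfun (@to_bimod k R) (rleg (y : R) (lco g x)).
Proof.
rewrite lg_rhoE; elim/tensor_indD: (lco g x) => [a z|u u' IHu IHu'].
  by rewrite rlegE !tmapE /= /orbit_map /kact bimodE mulr1.
by rewrite !linearD /= IHu IHu'.
Qed.

Lemma lg_canK q : lg_caninv (tmap idfun (orbit_map x0) (lg_rho q)) = q.
Proof.
elim/tensor_indD: q => [x y|s t IHs IHt]; last by rewrite !linearD /= IHs IHt.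
rewrite lg_canE -[X in X = _]/(lg_caninv _).
have -> : x ⊗ y = rleg (y : R) (x ⊗ 1) by rewrite rlegE mul1r.
rewrite -(ltrE g x) (tlift_app (rleg (y : R))).
elim/tensor_indD: (lco g x) => [a z|u u' IHu IHu'].
  rewrite rlegE tmapE /= /lg_caninv (tliftP _ _ caninvB) tliftP; last by lin.
  by rewrite -rlegM.
rewrite !linearD /= IHu IHu' tliftD //; lin.
Qed.

Lemma lg_caninvK t : tmap idfun (orbit_map x0) (lg_rho (lg_caninv t)) = t.
Proof.
elim/tensor_indD: t => [a z|s t IHs IHt]; last by rewrite !linearD /= IHs IHt.
rewrite /lg_caninv (tliftP _ _ caninvB).
have -> : a ⊗ z = tmap idfun (@to_bimod k R) (rleg (z : R) (a ⊗ 1)).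
  by rewrite rlegE tmapE /= mul1r.
rewrite -(ltrK g a).
elim/tensor_indD: (ltr g a) => [x y|u u' IHu IHu'].
  by rewrite rlegE lg_canE tliftP ?rlegM //; lin.
rewrite tliftD; last by lin.
by rewrite !linearD /= IHu IHu'.
Qed.

Definition bigalois_left : galois A x0 :=
  Galois lg_rho_monoid lg_rhoA lg_rho1 lg_canK lg_caninvK.
End BiGaloisLeft.

Section BiGaloisRight.
Variables (k : fieldType) (A B : hopfAlg k) (R : algType k).
Variable g : bigalois A B R.
Local Notation Q := (envalg R).
Local Notation X := (regbimod R : lmodType Q).
Local Notation Bop := (op_hopf B).

(** The right coaction acts on the opposite factor of R ⊗ R^op; moving B to the
    left there opposes both structures of B. *)
Definition rg_leg (x : R) (t : tensor R B) : tensor Bop Q :=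
  tlift (fun (y : R) (b : B) => (b : Bop) ⊗ (x ⊗ (y : opalg R) : Q)) t.
Let legB x : bilin (fun (y : R) (b : B) => (b : Bop) ⊗ (x ⊗ (y : opalg R) : Q)).
Proof.
split=> [b c y y'|y c b b']; last by rewrite [LHS]linearPl.
by rewrite [X in _ ⊗ X]linearPr [LHS]linearPr.
Qed.
Lemma rg_legE x y b : rg_leg x (y ⊗ b) = (b : Bop) ⊗ (x ⊗ (y : opalg R) : Q).
Proof. exact: (tliftP _ _ (legB x)). Qed.
Fact rg_leg_bilinear : bilinear_for *:%R *:%R rg_leg.
Proof.
split=> [t|x]; last first.
  by move=> c s t; rewrite /rg_leg -(linearP (tlift (mkbilin (legB x)))).
apply: lin_tliftF => y b c x x'.
by rewrite [X in _ ⊗ X]linearPl [LHS]linearPr.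
Qed.
HB.instance Definition _ := bilinear_isBilinear.Build k R (tensor R B)
  (tensor Bop Q) _ _ rg_leg rg_leg_bilinear.
HB.instance Definition _ x :=
  GRing.isLinear.Build k _ _ _ (rg_leg x) (rg_leg_bilinear.2 x).

Definition rg_rho (q : Q) : tensor Bop Q :=
  tlift (fun (x : R) (y : opalg R) => rg_leg x (rco g y)) q.
Let rhoB : bilin (fun (x : R) (y : opalg R) => rg_leg x (rco g y)).
Proof.
split=> [y|x]; first by lin.
by move=> c y y'; rewrite -(linearP (rg_leg x)) -(linearP (rco g)).
Qed.
Fact rg_rho_linear : linear rg_rho.
Proof. exact: lin_tlift rhoB _. Qed.
HB.instance Definition _ :=
  GRing.isLinear.Build k Q (tensor Bop Q) _ rg_rho rg_rho_linear.
Lemma rg_rhoE x (y : opalg R) : rg_rho (x ⊗ y) = rg_leg x (rco g y).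
Proof. exact: tliftP. Qed.

Fact rg_rho_monoid : monoid_morphism (rg_rho : Q -> talg Bop Q).
Proof.
split=> [|s t]; first by rewrite [LHS]rg_rhoE (rcoM g).1 rg_legE.
elim/tensor_indD: s => [x y|s s' IHs IHs']; last first.
  by rewrite mulrDl !linearD /= IHs IHs' [RHS]mulrDl.
elim/tensor_indD: t => [x' y'|t t' IHt IHt']; last first.
  by rewrite mulrDr !linearD /= IHt IHt' [RHS]mulrDr.
rewrite talg_mulE opalg_mulE !rg_rhoE (rcoM g).2 /=.
elim/tensor_indD: (rco g y) => [z b|u u' IHu IHu']; last first.
  by rewrite mulrDr !linearD /= IHu IHu' [RHS]mulrDl.
elim/tensor_indD: (rco g y') => [z' b'|u u' IHu IHu']; last first.
  by rewrite mulrDl !linearD /= IHu IHu' [RHS]mulrDr.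
by rewrite talg_mulE !rg_legE talg_mulE talg_mulE !opalg_mulE.
Qed.

Lemma rg_rho1 q : tlunit (tmap (hcounit Bop) idfun (rg_rho q)) = q.
Proof.
elim/tensor_indD: q => [x y|s t IHs IHt]; last by rewrite !linearD /= IHs IHt.
rewrite rg_rhoE -[in RHS](rco1 g y).
elim/tensor_indD: (rco g y) => [z b|u u' IHu IHu']; last first.
  by rewrite !linearD /= IHu IHu'.
by rewrite rg_legE !tmapE tlunitE trunitE /= [RHS]linearZr_LR.
Qed.

Definition rg_caninv (t : tensor Bop (kmod X)) : Q :=
  tlift (fun (b : Bop) (z : kmod X) => lleg (z : R) (rtr g b) : tensor R (opalg R)) t.
Let caninvB : bilin (fun (b : Bop) (z : kmod X) =>
  lleg (z : R) (rtr g b) : tensor R (opalg R)).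
Proof.
split=> [z|b].
  by move=> c b b'; rewrite -(linearP (lleg _)) -(linearP (rtr g)).
exact: (@lin_bil1 _ _ _ _ _ (@lleg k R R) (fun z : kmod X => z : R) (rtr g b)
  (@of_bimod_linear k R)).
Qed.
Fact rg_caninv_linear : linear rg_caninv.
Proof. exact: lin_tlift caninvB _. Qed.
HB.instance Definition _ :=
  GRing.isLinear.Build k (tensor Bop (kmod X)) Q _ rg_caninv rg_caninv_linear.

Let x0 : X := (1 : R).
Definition rg_flip (t : tensor R B) : tensor Bop (kmod X) :=
  tlift (fun (y : R) (b : B) => (b : Bop) ⊗ (y : kmod X)) t.
Let flipB : bilin (fun (y : R) (b : B) => (b : Bop) ⊗ (y : kmod X)).
Proof.
split=> [b c y y'|y c b b']; last by rewrite [LHS]linearPl.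
by rewrite [X in _ ⊗ X]to_bimod_linear [LHS]linearPr.
Qed.
Fact rg_flip_linear : linear rg_flip.
Proof. exact: lin_tlift flipB _. Qed.
HB.instance Definition _ :=
  GRing.isLinear.Build k (tensor R B) (tensor Bop (kmod X)) _ rg_flip rg_flip_linear.
Lemma rg_flipE y b : rg_flip (y ⊗ b) = (b : Bop) ⊗ (y : kmod X).
Proof. exact: (tliftP _ _ flipB). Qed.

Lemma rg_canE x (y : opalg R) : tmap idfun (orbit_map x0) (rg_rho (x ⊗ y)) =
  rg_flip (lleg x (rco g y)).
Proof.
rewrite rg_rhoE; elim/tensor_indD: (rco g y) => [z b|u u' IHu IHu'].
  by rewrite llegE rg_legE rg_flipE tmapE /= /orbit_map /kact bimodE mulr1.
by rewrite !linearD /= IHu IHu'.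
Qed.

Lemma rg_canK q : rg_caninv (tmap idfun (orbit_map x0) (rg_rho q)) = q.
Proof.
elim/tensor_indD: q => [x y|s t IHs IHt]; last by rewrite !linearD /= IHs IHt.
rewrite rg_canE.
have -> : x ⊗ y = lleg x (1 ⊗ (y : R)) by rewrite llegE mulr1.
rewrite -(rtrE g y) (tlift_app (lleg x)).
elim/tensor_indD: (rco g y) => [z b|u u' IHu IHu'].
  rewrite llegE rg_flipE /rg_caninv (tliftP _ _ caninvB) tliftP; last by lin.
  by rewrite /= llegM.
rewrite !linearD /= IHu IHu' tliftD //; lin.
Qed.

Lemma rg_caninvK t : tmap idfun (orbit_map x0) (rg_rho (rg_caninv t)) = t.
Proof.
elim/tensor_indD: t => [b z|s t IHs IHt]; last by rewrite !linearD /= IHs IHt.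
rewrite /rg_caninv (tliftP _ _ caninvB).
have -> : b ⊗ z = rg_flip (lleg (z : R) (1 ⊗ (b : B))).
  by rewrite llegE rg_flipE mulr1.
rewrite -(rtrK g b).
elim/tensor_indD: (rtr g b) => [x y|u u' IHu IHu'].
  by rewrite llegE rg_canE tliftP ?llegM //; lin.
rewrite tliftD; last by lin.
by rewrite !linearD /= IHu IHu'.
Qed.

Lemma rg_rhoA q :
  tassoc (tmap (hcomul Bop) idfun (rg_rho q)) = tmap idfun rg_rho (rg_rho q).
Proof.
elim/tensor_indD: q => [x y|s t IHs IHt]; last by rewrite !linearD /= IHs IHt.
rewrite !rg_rhoE /=.
pose F (z : R) (a b : B) : tensor Bop (tensor Bop Q) :=
  (b : Bop) ⊗ ((a : Bop) ⊗ (x ⊗ (z : opalg R) : Q)).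
have F1 a b : linear (fun z => F z a b).
  move=> c z z'; rewrite /F [X in _ ⊗ (_ ⊗ X)]linearPr.
  by rewrite [X in _ ⊗ X]linearPr [LHS]linearPr.
have F2 z b : linear (fun a => F z a b).
  by move=> c a a'; rewrite /F [X in _ ⊗ X]linearPl [LHS]linearPr.
have F3 z a : linear (fun b => F z a b).
  by move=> c b b'; rewrite /F [LHS]linearPl.
have FB b : bilin (fun z a => F z a b) by lin.
transitivity (tlift (fun z t => tlift (F z) t) (tmap idfun (hcomul B) (rco g y))).
  elim/tensor_indD: (rco g y) => [z b|s t IHs IHt]; last first.
    rewrite !linearD /= IHs IHt [RHS]tliftD //; lin.
  rewrite rg_legE !tmapE [RHS]tliftP; last by lin.
  rewrite /= /op_comul.
  have L : linear (fun t : tensor Bop Bop =>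
    tassoc (t ⊗ (x ⊗ (z : opalg R) : Q))) by lin.
  by rewrite (tlift_lin _ _ L); apply: eq_tlift => a c; rewrite tassocE.
rewrite -rcoA tlift_tassoc //.
elim/tensor_indD: (rco g y) => [z b|s t IHs IHt]; last first.
  rewrite !linearD /= -IHs -IHt [LHS]tliftD //; lin.
rewrite rg_legE !tmapE tliftP; last by lin.
rewrite /= rg_rhoE /rg_leg (tlift_app (ptens (b : Bop))).
by apply: eq_tlift.
Qed.

Definition bigalois_right : galois Bop x0 :=
  Galois rg_rho_monoid rg_rhoA rg_rho1 rg_canK rg_caninvK.
End BiGaloisRight.

(** * The bi-Galois algebra of a Hopf algebra over itself *)

Section SelfBigalois.
Variables (k : fieldType) (A : hopfAlg k).
Let D := hcomul A.
Let S := hantipode A.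
Let ltr0 (a : A) : tensor A A := tmap idfun S (D a).
Let rtr0 (a : A) : tensor A A := tmap S idfun (D a).
Fact triv_ltr_linear : linear ltr0. Proof. by rewrite /ltr0; lin. Qed.
Fact triv_rtr_linear : linear rtr0. Proof. by rewrite /rtr0; lin. Qed.

Let rlegS (y : A) (t : tensor A A) : rleg y t = tlift (fun b c => b ⊗ (c * y)) t.
Proof. by []. Qed.
Let llegS (y : A) (t : tensor A A) : lleg y t = tlift (fun b c => (y * b) ⊗ c) t.
Proof. by []. Qed.

Fact triv_ltrK a : tlift (fun x y => rleg y (D x)) (ltr0 a) = a ⊗ 1.
Proof.
rewrite tlift_tmap; last by lin.
under eq_tlift => x y do rewrite rlegS.
rewrite (sw_coassoc (F := fun b c y => b ⊗ (c * S y))); try by lin.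
under eq_tlift => b x.
  rewrite (sw_antipoder (F := fun c => b ⊗ c)); last by lin.
  rewrite linearZr_LR /=; over.
by rewrite (sw_counitr (F := fun b => b ⊗ 1)) //; lin.
Qed.

Fact triv_ltrE x : tlift (fun a y => rleg y (ltr0 a)) (D x) = x ⊗ 1.
Proof.
have rS (y a : A) : rleg y (ltr0 a) = tlift (fun b c => b ⊗ (S c * y)) (D a).
  by rewrite rlegS tlift_tmap //; lin.
under eq_tlift => a y do rewrite rS.
rewrite (sw_coassoc (F := fun b c y => b ⊗ (S c * y))); try by lin.
under eq_tlift => b y.
  rewrite (sw_antipodel (F := fun c => b ⊗ c)); last by lin.
  rewrite linearZr_LR /=; over.
by rewrite (sw_counitr (F := fun b => b ⊗ 1)) //; lin.
Qed.

Fact triv_rtrK b : tlift (fun x y => lleg x (D y)) (rtr0 b) = 1 ⊗ b.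
Proof.
rewrite tlift_tmap; last by lin.
under eq_tlift => x y do rewrite llegS.
rewrite -(sw_coassoc (F := fun x b c => (S x * b) ⊗ c)); try by lin.
under eq_tlift => x c.
  rewrite (sw_antipodel (F := fun b => b ⊗ c)); last by lin.
  rewrite linearZl_LR /=; over.
by rewrite (sw_counitl (F := fun b => 1 ⊗ b)) //; lin.
Qed.

Fact triv_rtrE x : tlift (fun y b => lleg y (rtr0 b)) (D x) = 1 ⊗ x.
Proof.
have lS (y a : A) : lleg y (rtr0 a) = tlift (fun b c => (y * S b) ⊗ c) (D a).
  by rewrite llegS tlift_tmap //; lin.
under eq_tlift => a y do rewrite lS.
rewrite -(sw_coassoc (F := fun y b c => (y * S b) ⊗ c)); try by lin.
under eq_tlift => b y.
  rewrite (sw_antipoder (F := fun c => c ⊗ y)); last by lin.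
  rewrite linearZl_LR /=; over.
by rewrite (sw_counitl (F := fun b => 1 ⊗ b)) //; lin.
Qed.

(** The translation maps are a |-> a_(1) ⊗ S(a_(2)) and b |-> S(b_(1)) ⊗ b_(2).
    *)
Definition bigalois_self : bigalois A A A :=
  @BiGalois k A A A D (comul_monoid A) (@hcomulA k A) (@hcounitl k A)
    (mklin triv_ltr_linear) triv_ltrK triv_ltrE D (comul_monoid A) (@hcomulA k A)
    (@hcounitr k A) (mklin triv_rtr_linear) triv_rtrK triv_rtrE.

Local Notation Q := (envalg A).
Local Notation gl := (bigalois_left bigalois_self).
Local Notation gr := (bigalois_right bigalois_self).

(** An algebra map inverting the translation map a |-> a_(1) ⊗ S(a_(2)) on one
    side; through it every left module is restricted from a bimodule. *)
Definition env_left (q : Q) : A := trunit (tmap idfun (@op_counit k A) q).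
Fact env_left_linear : linear env_left. Proof. by rewrite /env_left; lin. Qed.
Lemma env_leftE x (y : opalg A) : env_left (x ⊗ y) = (hcounit A y : k) *: x.
Proof. by rewrite /env_left tmapE trunitE. Qed.
Fact env_left_monoid : monoid_morphism env_left.
Proof.
split=> [|s t]; first by rewrite [LHS]env_leftE rmorph1 scale1r.
elim/tensor_indD: s => [x y|s s' IHs IHs']; last first.
  by rewrite mulrDl !(linD env_left_linear) IHs IHs' [RHS]mulrDl.
elim/tensor_indD: t => [x' y'|t t' IHt IHt']; last first.
  by rewrite mulrDr !(linD env_left_linear) IHt IHt' [RHS]mulrDr.
rewrite talg_mulE !env_leftE opalg_mulE rmorphM -scalerAl -scalerAr scalerA.
by congr (_ *: _); apply: mulrC.
Qed.

Definition env_right (q : Q) : opalg A := tlunit (tmap (hcounit A) idfun q).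
Fact env_right_linear : linear env_right. Proof. by rewrite /env_right; lin. Qed.
Lemma env_rightE x (y : opalg A) : env_right (x ⊗ y) = (hcounit A x : k) *: y.
Proof. by rewrite /env_right tmapE tlunitE. Qed.
Fact env_right_monoid : monoid_morphism env_right.
Proof.
split=> [|s t]; first by rewrite [LHS]env_rightE rmorph1 scale1r.
elim/tensor_indD: s => [x y|s s' IHs IHs']; last first.
  by rewrite mulrDl !(linD env_right_linear) IHs IHs' [RHS]mulrDl.
elim/tensor_indD: t => [x' y'|t t' IHt IHt']; last first.
  by rewrite mulrDr !(linD env_right_linear) IHt IHt' [RHS]mulrDr.
by rewrite talg_mulE !env_rightE rmorphM -scalerAl -scalerAr scalerA.
Qed.

Let eps : {linear kmod (regbimod A) -> k^o} :=
  hcounit A \o @of_bimod k A.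

Lemma env_left_kappa a : env_left (kappa gl a) = a.
Proof.
have E q : env_left q = trunit (tmap idfun eps (gcan gl q)).
  elim/tensor_indD: q => [x y|s t IHs IHt]; last first.
    by rewrite (linD env_left_linear) IHs IHt !linearD.
  rewrite env_leftE /gcan lg_canE -[in LHS](hcounitr x) /=.
  elim/tensor_indD: (D x) => [b c|s t IHs IHt]; last first.
    by rewrite !linearD /= IHs IHt.
  by rewrite rlegE !tmapE !trunitE /= rmorphM scalerA; congr (_ *: _); apply: mulrC.
by rewrite E gcan_kappa tmapE trunitE /= rmorph1 scale1r.
Qed.

Lemma env_right_kappa a : env_right (kappa gr a) = a.
Proof.
have E q : env_right q = trunit (tmap idfun eps (gcan gr q)).
  elim/tensor_indD: q => [x y|s t IHs IHt]; last first.
    by rewrite (linD env_right_linear) IHs IHt !linearD.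
  rewrite env_rightE /gcan rg_canE -[in LHS](hcounitl (y : A)) /=.
  elim/tensor_indD: (D y) => [b c|s t IHs IHt]; last first.
    by rewrite !linearD /= IHs IHt.
  by rewrite llegE rg_flipE !tmapE tlunitE trunitE /= rmorphM [LHS]scalerA.
by rewrite E gcan_kappa tmapE trunitE /= rmorph1 scale1r.
Qed.
End SelfBigalois.

Lemma restr_section (S T : nzRingType) (f : {rmorphism S -> T})
    (h : {rmorphism T -> S}) (K : lmodType S) :
  (forall a, h (f a) = a) -> retract K (restr_mod f (restr_mod h K)).
Proof.
move=> hf.
have sL : linear (id : K -> restr_mod f (restr_mod h K)).
  by move=> a x y; rewrite -[in LHS](hf a).
have rL : linear (id : restr_mod f (restr_mod h K) -> K).
  by move=> a x y; exact: esym (sL a x y).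
by exists (mklin sL), (mklin rL).
Qed.

Section TrivialModules.
Variable k : fieldType.

Lemma pd_le_triv_ind m (A : hopfAlg k) (Q : algType k) (X : lmodType Q) (x0 : X)
    (g : galois A x0) :
  pd_le m X <-> pd_le m (ind (grho_alg g) X (trivmod A)).
Proof.
have [f [fi fs]] := ind_triv X (rho := grho_alg g) (grho1 g).
have [h [fK hK]] := linear_inverse fi fs.
split; last exact: (pd_le_iso fi fs).
by apply: pd_le_iso (can_inj hK) _ => t; exists (f t).
Qed.

(** Both trivial modules induce to the Q-module X. *)
Lemma pd_le_transfer m (A A' : hopfAlg k) (Q : algType k) (X : lmodType Q)
    (x0 : X) (g : galois A x0) (g' : galois A' x0) :
  pd_le m (trivmod A) -> pd_le m (ind (grho_alg g') X (trivmod A')).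
Proof.
by move=> /(pd_le_ind_galois g) /(pd_le_triv_ind m g).2 /(pd_le_triv_ind m g').1.
Qed.

(** Descent along the second coaction, from the end of a finite resolution of
    the second trivial module. *)
Lemma pd_le_transfer_fin m n (A A' : hopfAlg k) (Q : algType k) (X : lmodType Q)
    (x0 : X) (g : galois A x0) (g' : galois A' x0) :
  pd_le m (trivmod A) -> pd_le n (trivmod A') -> pd_le m (trivmod A').
Proof.
move=> Am; apply: pd_le_descent (pd_le_transfer g g' Am) _.
exact: projective_restriction.
Qed.

(** A is a bi-Galois algebra over itself, and every module on either side is
    restricted from a bimodule, so that the descent applies to the first syzygy.
    *)
Lemma pd_le_op m (A : hopfAlg k) :
  pd_le m (trivmod A) <-> pd_le m (trivmod (op_hopf A)).
Proof.
pose gl := bigalois_left (bigalois_self A).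
pose gr := bigalois_right (bigalois_self A).
split=> Am.
  apply: pd_le_descent_all (pd_le_transfer gl gr Am) => K.
  pose pi := mklrmorphism (@env_right_linear k A) (@env_right_monoid k A).
  exists (restr_mod pi K).
  exact: (restr_section (f := kappa_alg gr) (h := pi) K (@env_right_kappa k A)).
apply: pd_le_descent_all (pd_le_transfer gr gl Am) => K.
pose pi := mklrmorphism (@env_left_linear k A) (@env_left_monoid k A).
exists (restr_mod pi K).
exact: (restr_section (f := kappa_alg gl) (h := pi) K (@env_left_kappa k A)).
Qed.

(** The trivial modules of A and of the opposite of B both induce to the
    bimodule R. *)
Lemma gldim_bigalois (A B : hopfAlg k) (R : algType k) :
  bigalois A B R -> gldim A <> None -> gldim B <> None -> gldim A = gldim B.
Proof.
move=> g; have gA := bigalois_left g; have gB := bigalois_right g.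
case EA : (gldim A) => [n|] // _; case EB : (gldim B) => [m|] // _.
have [An nmin] := (leastP _ _).1 EA; have [Bm mmin] := (leastP _ _).1 EB.
have triv (C : hopfAlg k) p : (forall M : lmodType C, projdim_le M p) ->
  pd_le p (trivmod C) by move=> Cp; apply: projdim_pd_le.
have untriv (C : hopfAlg k) p : pd_le p (trivmod C) ->
    forall M : lmodType C, projdim_le M p.
  by move=> Cp M; apply: pd_le_projdim; apply: pd_le_triv_all.
have Bm' := (pd_le_op m B).1 (triv _ _ Bm).
congr Some; apply/eqP; rewrite eqn_leq; apply/andP; split.
  apply: nmin; apply: untriv.
  exact: pd_le_transfer_fin gB gA Bm' (triv _ _ An).
apply: mmin; apply: untriv; apply/pd_le_op.
exact: pd_le_transfer_fin gA gB (triv _ _ An) Bm'.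
Qed.
End TrivialModules.

(** * Linear equivalences and copowers of comodules *)

Section Equivalences.
Variable k : fieldType.
Local Notation "g ∘ f" := (comp g f) (at level 40, left associativity).

Definition faithful (C D : lincat k) (F : linfunctor C D) :=
  forall (X Y : C) (f g : hom X Y), fhom F f = fhom F g -> f = g.
Definition full (C D : lincat k) (F : linfunctor C D) :=
  forall (X Y : C) (h : hom (F X) (F Y)), exists f, fhom F f = h.

Lemma iso_comp_inj (C : lincat k) (X Y Z : C) (e : hom X Y) (f g : hom Y Z) :
  is_iso e -> f ∘ e = g ∘ e -> f = g.
Proof.
by move=> [d [_ ed]] fg; rewrite -[f]compm1 -[g]compm1 -ed !compA fg.
Qed.

Lemma nat_iso_faithful (C D : lincat k) (F : linfunctor C D) (G : linfunctor D C) :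
  nat_isomorphic (compfunctor G F) (idfunctor C) -> faithful F.
Proof.
move=> [eta [eta_iso eta_nat]] X Y f g fg.
have := eta_nat X Y f; rewrite /= fg => e1; have /= e2 := eta_nat X Y g.
by apply: iso_comp_inj (eta_iso X) _; rewrite -e1 -e2.
Qed.

Lemma equivalence_faithful (C D : lincat k) (F : linfunctor C D) :
  is_equivalence F -> faithful F.
Proof. by move=> [G [GF _]]; apply: nat_iso_faithful GF. Qed.

(** Conjugating G h by the isomorphisms between the objects and their images
    under G F gives f with G (F f) = G h, and G is faithful. *)
Lemma equivalence_full (C D : lincat k) (F : linfunctor C D) :
  is_equivalence F -> full F.
Proof.
move=> [G [[eta [eta_iso eta_nat]] FG]] X Y h.
have Gf : faithful G by apply: nat_iso_faithful FG.
have [d [dX Xd]] := eta_iso X.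
pose f : hom X Y := eta Y ∘ fhom G h ∘ d.
exists f; apply: Gf.
have /= e := eta_nat X Y f.
have [dy [dyY Yd]] := eta_iso Y.
have : dy ∘ (eta Y ∘ fhom G (fhom F f)) = dy ∘ (eta Y ∘ fhom G h).
  by rewrite e /f -[eta Y ∘ fhom G h ∘ d ∘ eta X]compA dX compm1.
by rewrite !compA dyY !comp1m.
Qed.

Lemma equivalence_esurj (C D : lincat k) (F : linfunctor C D) :
  is_equivalence F -> forall Y : D, exists X (e : hom (F X) Y), is_iso e.
Proof.
move=> [G [_ [eps [eps_iso _]]]] Y; exists (G Y), (eps Y); exact: eps_iso.
Qed.
End Equivalences.

Section ComodHom.
Variables (k : fieldType) (A : hopfAlg k).

Definition mkcomod_hom (V W : comod A) (f : {linear V -> W})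
    (fP : forall v, coact W (f v) = tmap f idfun (coact V v)) : comod_hom V W :=
  ComodHom (comod_hom_mem fP).

Definition regcomod : comod A := Comod (@hcomulA k A) (@hcounitr k A).

Section Copower.
Variables (V : lmodType k) (X : comod A).
Definition cop_coact (t : tensor V X) : tensor (tensor V X) A :=
  tassocV (tmap idfun (coact X) t).
Fact cop_coact_linear : linear cop_coact.
Proof. by rewrite /cop_coact; lin. Qed.
HB.instance Definition _ := GRing.isLinear.Build k (tensor V X)
  (tensor (tensor V X) A) _ cop_coact cop_coact_linear.
Lemma cop_coactE v x : cop_coact (v ⊗ x) = tmap (ptens v) idfun (coact X x).
Proof.
rewrite /cop_coact tmapE /=.
elim/tensor_indD: (coact X x) => [y a|s t IHs IHt].
  by rewrite tassocVE tmapE.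
by rewrite linearDr !linearD /= IHs IHt.
Qed.

Fact cop_coactA t :
  tassoc (tmap cop_coact idfun (cop_coact t)) = tmap idfun (hcomul A) (cop_coact t).
Proof.
elim/tensor_indD: t => [v x|s t IHs IHt]; last by rewrite !linearD /= IHs IHt.
rewrite cop_coactE.
transitivity (tmap (ptens v) idfun (tassoc (tmap (coact X) idfun (coact X x)))).
  elim/tensor_indD: (coact X x) => [y a|s t IHs IHt]; last first.
    by rewrite !linearD /= IHs IHt.
  rewrite !tmapE /= cop_coactE.
  elim/tensor_indD: (coact X y) => [z b|s t IHs IHt]; last first.
    by rewrite !(linearD, linearDl) /= IHs IHt.
  by rewrite !tmapE !tassocE tmapE.
rewrite coactA.
elim/tensor_indD: (coact X x) => [y a|s t IHs IHt]; last first.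
  by rewrite !linearD /= IHs IHt.
by rewrite !tmapE.
Qed.
Fact cop_coact1 t : trunit (tmap idfun (hcounit A) (cop_coact t)) = t.
Proof.
elim/tensor_indD: t => [v x|s t IHs IHt]; last by rewrite !linearD /= IHs IHt.
rewrite cop_coactE -[in RHS](coact1 x).
elim/tensor_indD: (coact X x) => [y a|s t IHs IHt]; last first.
  by rewrite !(linearD, linearDr) /= IHs IHt.
by rewrite !tmapE !trunitE /= linearZr_LR.
Qed.
(** The coproduct of dim V copies of X, without a choice of basis: the maps out
    of it are the linear families, indexed by V, of maps out of X. Since this is
    a categorical property, equivalences preserve copowers. *)
Definition copower : comod A := Comod cop_coactA cop_coact1.

Fact cop_incP v x : coact copower (v ⊗ x) = tmap (ptens v) idfun (coact X x).
Proof. exact: cop_coactE. Qed.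
Definition cop_inc (v : V) : comod_hom X copower :=
  @mkcomod_hom X copower (ptens v) (cop_incP v).
End Copower.

Lemma copower_homP (V : lmodType k) (X Y : comod A) (f : {linear tensor V X -> Y}) :
  (forall v x, coact Y (f (v ⊗ x)) = tmap f idfun (coact (copower V X) (v ⊗ x))) ->
  forall t, coact Y (f t) = tmap f idfun (coact (copower V X) t).
Proof.
move=> fP; elim/tensor_indD => [v x|s t IHs IHt]; first exact: fP.
by rewrite !linearD /= IHs IHt.
Qed.

Lemma copower_lift (V : lmodType k) (X Y : comod A) (f : V -> comod_hom X Y) :
  (forall x, linear (fun v => f v x : Y)) ->
  exists h : comod_hom (copower V X) Y, forall v x, h (v ⊗ x) = f v x.
Proof.
move=> fL; pose F (v : V) (x : X) : Y := f v x.
have FB : bilin F by split=> // v; exact: linearP.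
have hP t : coact Y (tlift (mkbilin FB) t) =
    tmap (tlift (mkbilin FB)) idfun (coact (copower V X) t).
  apply: copower_homP t => v x.
  rewrite [X in coact Y X](tliftP _ _ FB) comod_homP cop_incP tmap_comp.
  by apply: eq_tmap => // y; rewrite /= (tliftP _ _ FB).
exists (@mkcomod_hom (copower V X) Y (tlift (mkbilin FB)) hP) => v x.
exact: (tliftP _ _ FB).
Qed.
End ComodHom.

(** * The monoidal functor on elements *)

Section Functor.
Variables (k : fieldType) (A B : hopfAlg k).
Variable F : monfunctor (comod_moncat A) (comod_moncat B).
Hypothesis HF : is_equivalence F.

Definition Fo (X : comod A) : comod B := fobj (mfun F) X.
Definition Fh (X Y : comod A) (f : comod_hom X Y) : comod_hom (Fo X) (Fo Y) :=
  @fhom k _ _ (mfun F) X Y f.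

Lemma Fh_id X x : Fh (comod_idm X) x = x.
Proof. by rewrite /Fh (@fhom1 k _ _ (mfun F) X). Qed.
Lemma Fh_comp (X Y Z : comod A) (g : comod_hom Y Z) (f : comod_hom X Y) x :
  Fh g (Fh f x) = Fh (comod_comp g f) x.
Proof.
have e := @fhom_comp k _ _ (mfun F) X Y Z g f.
exact: (congr1 (fun h : comod_hom (Fo X) (Fo Z) => h x) (esym e)).
Qed.
Lemma Fh_lin (X Y : comod A) x : linear (fun f : comod_hom X Y => Fh f x).
Proof.
move=> a f g; have e := @fhom_linear k _ _ (mfun F) X Y a f g.
exact: (congr1 (fun h : comod_hom (Fo X) (Fo Y) => h x) e).
Qed.
Lemma eq_Fh (X Y : comod A) (f g : comod_hom X Y) : f =1 g -> Fh f = Fh g.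
Proof. by move=> fg; rewrite (comod_hom_eq fg). Qed.
Lemma eq_FhE (X Y : comod A) (f g : comod_hom X Y) x : f =1 g -> Fh f x = Fh g x.
Proof. by move=> /eq_Fh ->. Qed.

Lemma Fh_faithful (X Y : comod A) (f g : comod_hom X Y) : Fh f =1 Fh g -> f = g.
Proof. by move=> /comod_hom_eq fg; apply: (equivalence_faithful HF fg). Qed.
Lemma Fh_full (X Y : comod A) (h : comod_hom (Fo X) (Fo Y)) : exists f, Fh f = h.
Proof. exact: (equivalence_full HF (X := X) (Y := Y) h). Qed.
Lemma Fo_esurj (T : comod B) : exists (X : comod A) (e : comod_hom (Fo X) T)
  (d : comod_hom T (Fo X)), cancel e d /\ cancel d e.
Proof.
have [X [e [d [de ed]]]] := equivalence_esurj HF (T : comod_lincat B).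
exists X, e, d; split=> x.
  exact: (congr1 (fun h : comod_hom (Fo X) (Fo X) => h x) de).
exact: (congr1 (fun h : comod_hom T T => h x) ed).
Qed.

Definition phi (X Y : comod A) :
  comod_hom (comod_tensor (Fo X) (Fo Y)) (Fo (comod_tensor X Y)) := mon2 F X Y.
(** The tensor of two elements under the monoidal structure of the functor; in
    terms of it the coherence diagrams become the identities of an algebra. *)
Definition phi_elt (X Y : comod A) (x : Fo X) (y : Fo Y) : Fo (comod_tensor X Y) :=
  phi X Y (x ⊗ y).

Lemma phi_bij (X Y : comod A) :
  exists d : comod_hom (Fo (comod_tensor X Y)) (comod_tensor (Fo X) (Fo Y)),
    cancel (phi X Y) d /\ cancel d (phi X Y).
Proof.
have [d [de ed]] := mon2_iso F X Y; exists d; split=> x.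
  exact: (congr1 (fun h : comod_hom (comod_tensor (Fo X) (Fo Y))
    (comod_tensor (Fo X) (Fo Y)) => h x) de).
exact: (congr1 (fun h : comod_hom (Fo (comod_tensor X Y))
  (Fo (comod_tensor X Y)) => h x) ed).
Qed.

Lemma phi_nat (X X' Y Y' : comod A) (f : comod_hom X X') (g : comod_hom Y Y') x y :
  phi_elt (Fh f x) (Fh g y) = Fh (comod_thom f g) (phi_elt x y).
Proof.
have e := @mon2_nat k _ _ F X X' Y Y' f g.
rewrite /phi_elt -(tmapE (Fh f) (Fh g)).
exact: (congr1 (fun h : comod_hom (comod_tensor (Fo X) (Fo Y))
  (Fo (comod_tensor X' Y')) => h (x ⊗ y)) e).
Qed.

Lemma phi_natl (X X' Y : comod A) (f : comod_hom X X') x (y : Fo Y) :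
  phi_elt (Fh f x) y = Fh (comod_thom f (comod_idm Y)) (phi_elt x y).
Proof. by rewrite -phi_nat Fh_id. Qed.
Lemma phi_natr (X Y Y' : comod A) (g : comod_hom Y Y') (x : Fo X) y :
  phi_elt x (Fh g y) = Fh (comod_thom (comod_idm X) g) (phi_elt x y).
Proof. by rewrite -phi_nat Fh_id. Qed.

Lemma phi_assoc (X Y Z : comod A) (x : Fo X) (y : Fo Y) (z : Fo Z) :
  Fh (comod_assoc X Y Z) (phi_elt (phi_elt x y) z) = phi_elt x (phi_elt y z).
Proof.
have e := @mon_assoc k _ _ F X Y Z.
have e1 : Fh (comod_assoc X Y Z) (phi _ _ (tmap (phi X Y) idfun (x ⊗ y ⊗ z))) =
    phi _ _ (tmap idfun (phi Y Z) (tassoc (x ⊗ y ⊗ z))).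
  exact: (congr1 (fun h : comod_hom
    (comod_tensor (comod_tensor (Fo X) (Fo Y)) (Fo Z))
    (Fo (comod_tensor X (comod_tensor Y Z))) => h (x ⊗ y ⊗ z)) e).
by move: e1; rewrite tassocE !tmapE.
Qed.

Definition unit_map : comod_hom (comod_unit B) (Fo (comod_unit A)) := mon0 F.
Definition unit_elt : Fo (comod_unit A) := unit_map (1 : k^o).

Lemma phi_lunit (X : comod A) (x : Fo X) :
  Fh (comod_lunit X) (phi_elt unit_elt x) = x.
Proof.
have e := @mon_lunit k _ _ F X.
have e1 : Fh (comod_lunit X) (phi _ _ (tmap unit_map idfun ((1 : k^o) ⊗ x))) =
    tlunit ((1 : k^o) ⊗ x).
  exact: (congr1 (fun h : comod_hom (comod_tensor (comod_unit B) (Fo X)) (Fo X) =>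
    h ((1 : k^o) ⊗ x)) e).
by move: e1; rewrite tmapE tlunitE scale1r.
Qed.
Lemma phi_runit (X : comod A) (x : Fo X) :
  Fh (comod_runit X) (phi_elt x unit_elt) = x.
Proof.
have e := @mon_runit k _ _ F X.
have e1 : Fh (comod_runit X) (phi _ _ (tmap idfun unit_map (x ⊗ (1 : k^o)))) =
    trunit (x ⊗ (1 : k^o)).
  exact: (congr1 (fun h : comod_hom (comod_tensor (Fo X) (comod_unit B)) (Fo X) =>
    h (x ⊗ (1 : k^o))) e).
by move: e1; rewrite tmapE trunitE scale1r.
Qed.
End Functor.

(** * Comodule maps around the regular comodule *)

Section ComoduleMaps.
Variables (k : fieldType) (A : hopfAlg k).
Local Notation reg := (regcomod A).

Lemma sw_coact U (X : comod A) (F : X -> A -> A -> U : lmodType k) x :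
  (forall b c, linear (fun v => F v b c)) ->
  (forall v c, linear (fun b => F v b c)) ->
  (forall v b, linear (fun c => F v b c)) ->
  tlift (fun w c => tlift (fun v b => F v b c) (coact X w)) (coact X x) =
  tlift (fun v a => tlift (fun b c => F v b c) (hcomul A a)) (coact X x).
Proof.
move=> F1 F2 F3.
have := congr1 (tlift (fun u y => tlift (F u) y)) (coactA x).
rewrite tlift_tassoc; [|by lin..].
by rewrite !tlift_tmap; [|by lin..].
Qed.

Lemma sw_coact1 (U : lmodType k) (X : comod A) (F : X -> U) x : linear F ->
  tlift (fun v a => (hcounit A a : k) *: F v) (coact X x) = F x.
Proof.
move=> FL; rewrite -[in RHS](coact1 x) (tlift_lin _ _ FL) tlift_tmap; last by lin.
by apply: eq_tlift => a b; rewrite /scaler (linZ FL).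
Qed.

Fact mul_comodP t : coact reg (tlift *%R t) =
  tmap (tlift *%R) idfun (coact (comod_tensor reg reg) t).
Proof.
elim/tensor_indD: t => [a b|s t IHs IHt]; last by rewrite !linearD /= IHs IHt.
rewrite /= tliftE tcoactE /= hcomulM.
elim/tensor_indD: (hcomul A a) => [a1 a2|s t IHs IHt]; last first.
  by rewrite !(linearD, linearDl) /= IHs IHt.
elim/tensor_indD: (hcomul A b) => [b1 b2|s t IHs IHt]; last first.
  by rewrite !(linearD, linearDr) /= IHs IHt.
by rewrite !tmap2E tmapE /= tliftE.
Qed.
Definition mul_comod : comod_hom (comod_tensor reg reg) reg :=
  @mkcomod_hom _ _ (comod_tensor reg reg) reg (tlift *%R) mul_comodP.

Definition unit_fun (c : k^o) : A := (c : k) *: 1.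
Fact unit_fun_linear : linear unit_fun.
Proof. by move=> a x y; rewrite /unit_fun scalerDl scalerA. Qed.
HB.instance Definition _ :=
  GRing.isLinear.Build k k^o A _ unit_fun unit_fun_linear.
Fact unit_comodP (c : k^o) : coact reg (unit_fun c) =
  tmap unit_fun idfun (coact (comod_unit A) c).
Proof.
rewrite [coact (comod_unit A) c]/(c ⊗ (1 : A)).
by rewrite tmapE /= /unit_fun linearZZ hcomul1 -linearZl_LR.
Qed.
Definition unit_comod : comod_hom (comod_unit A) reg :=
  @mkcomod_hom _ _ (comod_unit A) reg unit_fun unit_comodP.

Section Maps.
Variables (V V' : lmodType k) (X Y : comod A).

Fact coact_comodP x : coact (copower X reg) (coact X x) =
  tmap (coact X) idfun (coact X x).
Proof.
have -> : coact (copower X reg) (coact X x) =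
    tassocV (tmap idfun (hcomul A) (coact X x)) by [].
by rewrite -coactA tassocK.
Qed.
Definition coact_comod : comod_hom X (copower X reg) :=
  @mkcomod_hom _ _ X (copower X reg) (coact X) coact_comodP.

Fact cop_mapP (g : comod_hom X Y) t :
  coact (copower V Y) (tmap idfun g t) =
  tmap (tmap idfun g) idfun (coact (copower V X) t).
Proof.
apply: copower_homP t => v x.
rewrite [X in coact (copower V Y) X](tmapE idfun g) !cop_incP comod_homP.
rewrite !tmap_comp.
by apply: eq_tmap => // y /=; rewrite tmapE.
Qed.
Definition cop_map (g : comod_hom X Y) : comod_hom (copower V X) (copower V Y) :=
  @mkcomod_hom _ _ (copower V X) (copower V Y) (tmap idfun g) (cop_mapP g).

Fact cop_fmapP (f : {linear V -> V'}) t :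
  coact (copower V' X) (tmap f idfun t) =
  tmap (tmap f idfun) idfun (coact (copower V X) t).
Proof.
apply: copower_homP t => v x.
rewrite [Z in coact (copower V' X) Z](tmapE f idfun) !cop_incP tmap_comp.
by apply: eq_tmap => // y /=; rewrite tmapE.
Qed.
Definition cop_fmap (f : {linear V -> V'}) :
    comod_hom (copower V X) (copower V' X) :=
  @mkcomod_hom _ _ (copower V X) (copower V' X) (tmap f idfun) (cop_fmapP f).

Lemma tassoc_leg_linear (s : tensor V V') :
  linear (fun x : X => tassoc (s ⊗ x)).
Proof. by lin. Qed.
Fact cop_assocP s x : coact (copower V (copower V' X)) (tassoc (s ⊗ x)) =
  tmap (mklin (tassoc_leg_linear s)) idfun (coact X x).
Proof.
elim/tensor_indD: s => [v w|s t IHs IHt].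
  rewrite tassocE cop_incP cop_incP tmap_comp.
  by apply: eq_tmap => // y; rewrite /= tassocE.
rewrite (@tmap_linearl _ _ _ _ _ 1 (mklin (tassoc_leg_linear s))
  (mklin (tassoc_leg_linear t))); last first.
  by move=> y; rewrite scale1r /= linearDl linearD.
by rewrite scale1r -IHs -IHt linearDl !linearD.
Qed.
Definition cop_assoc s : comod_hom X (copower V (copower V' X)) :=
  @mkcomod_hom _ _ X (copower V (copower V' X)) (mklin (tassoc_leg_linear s))
    (cop_assocP s).

Definition cop_mul_fun (t : tensor (tensor V A) A) : tensor V A :=
  tmap idfun (tlift *%R) (tassoc t).
Fact cop_mul_linear : linear cop_mul_fun.
Proof. by rewrite /cop_mul_fun; lin. Qed.
HB.instance Definition _ := GRing.isLinear.Build k (tensor (tensor V A) A)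
  (tensor V A) _ cop_mul_fun cop_mul_linear.
Lemma cop_mul_funE v a b : cop_mul_fun (v ⊗ a ⊗ b) = v ⊗ (a * b).
Proof. by rewrite /cop_mul_fun tassocE tmapE /= tliftE. Qed.
Fact cop_mulP t : coact (copower V reg) (cop_mul_fun t) =
  tmap cop_mul_fun idfun (coact (comod_tensor (copower V reg) reg) t).
Proof.
elim/tensor_indD: t => [t b|s t IHs IHt]; last by rewrite !linearD /= IHs IHt.
elim/tensor_indD: t => [v a|s t IHs IHt]; last first.
  by rewrite !(linearDl, linearD) /= IHs IHt.
rewrite cop_mul_funE cop_incP /= tcoactE /= cop_coactE hcomulM.
elim/tensor_indD: (hcomul A a) => [a1 a2|s t IHs IHt]; last first.
  by rewrite !(linearD, linearDl) /= IHs IHt.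
elim/tensor_indD: (hcomul A b) => [b1 b2|s t IHs IHt]; last first.
  by rewrite !(linearD, linearDr) /= IHs IHt.
by rewrite tmapE /= !tmap2E !tmapE /= cop_mul_funE.
Qed.
Definition cop_mul : comod_hom (comod_tensor (copower V reg) reg) (copower V reg) :=
  @mkcomod_hom _ _ (comod_tensor (copower V reg) reg) (copower V reg)
    cop_mul_fun cop_mulP.
End Maps.

Let mul2 : tensor A A -> tensor A A -> tensor A A := tmap2 *%R *%R.
Fact cop_mul2P t : coact (copower A reg) (tlift mul2 t) =
  tmap (tlift mul2) idfun
    (coact (comod_tensor (copower A reg) (copower A reg)) t).
Proof.
elim/tensor_indD: t => [s t|s t IHs IHt]; last by rewrite !linearD /= IHs IHt.
elim/tensor_indD: s => [a x|s s' IHs IHs']; last first.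
  by rewrite !(linearDl, linearD) /= IHs IHs'.
elim/tensor_indD: t => [b y|t t' IHt IHt']; last first.
  by rewrite !(linearDr, linearD) /= IHt IHt'.
rewrite tliftE /= /mul2 tmap2E [LHS]cop_coactE tcoactE /= !cop_coactE /= hcomulM.
elim/tensor_indD: (hcomul A x) => [x1 x2|s t IHs IHt]; last first.
  by rewrite !(linearD, linearDl) /= IHs IHt.
elim/tensor_indD: (hcomul A y) => [y1 y2|s t IHs IHt]; last first.
  by rewrite !(linearD, linearDr) /= IHs IHt.
by rewrite tmap2E !tmapE /= tmap2E tmapE /= tliftE /= tmap2E.
Qed.
Definition cop_mul2 :
    comod_hom (comod_tensor (copower A reg) (copower A reg)) (copower A reg) :=
  @mkcomod_hom _ _ (comod_tensor (copower A reg) (copower A reg)) (copower A reg)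
    (tlift mul2) cop_mul2P.

Section Theta.
Variable X : comod A.
(** The map x ⊗ a |-> x_(0) ⊗ x_(1) a turns the diagonal coaction on X ⊗ A into
    the one of a copower of A. The antipode inverts it. *)
Definition theta : comod_hom (comod_tensor X reg) (copower X reg) :=
  comod_comp (cop_mul X) (comod_thom (coact_comod X) (comod_idm reg)).

Definition theta_inv (t : tensor X A) : tensor X A :=
  tlift (fun x a => tlift (fun v b => v ⊗ (hantipode A b * a)) (coact X x)) t.
Let theta_invB :
  bilin (fun x a => tlift (fun v b => v ⊗ (hantipode A b * a)) (coact X x)).
Proof. by lin. Qed.
Fact theta_inv_linear : linear theta_inv.
Proof. exact: lin_tlift theta_invB _. Qed.
HB.instance Definition _ := GRing.isLinear.Build k _ _ _ theta_inv theta_inv_linear.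
Lemma theta_invE x a : theta_inv (x ⊗ a) =
  tlift (fun v b => v ⊗ (hantipode A b * a)) (coact X x).
Proof. exact: tliftP. Qed.
Lemma thetaE x a : theta (x ⊗ a) = tlift (fun v b => v ⊗ (b * a)) (coact X x).
Proof.
have -> : theta (x ⊗ a) = cop_mul_fun (coact X x ⊗ a).
  by rewrite /theta /= (tmapE (coact X) idfun).
elim/tensor_indD: (coact X x) => [v b|s t IHs IHt].
  by rewrite cop_mul_funE tliftP //; lin.
rewrite linearDl linearD /= IHs IHt [RHS]tliftD //; lin.
Qed.
Lemma thetaK : cancel theta theta_inv.
Proof.
elim/tensor_indD => [x a|s t IHs IHt]; last first.
  rewrite (linearD theta) (linearD theta_inv) -[RHS]/(s + t).
  by rewrite -[in RHS]IHs -[in RHS]IHt.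
rewrite thetaE (tlift_app theta_inv) /=.
under eq_tlift => v b do rewrite theta_invE.
rewrite (sw_coact (F := fun v b c => v ⊗ (hantipode A b * (c * a)))); try by lin.
under eq_tlift => v b.
  under eq_tlift => c d do rewrite mulrA.
  rewrite (sw_antipodel (F := fun c => v ⊗ (c * a))); last by lin.
  rewrite -scalerAl mul1r linearZr_LR /=.
  over.
by rewrite (sw_coact1 (F := fun v => v ⊗ a)) //; lin.
Qed.
Lemma theta_invK : cancel theta_inv theta.
Proof.
elim/tensor_indD => [x a|s t IHs IHt]; last first.
  rewrite (linearD theta_inv) (linearD theta) -[RHS]/(s + t).
  by rewrite -[in RHS]IHs -[in RHS]IHt.
rewrite theta_invE.
transitivity (tlift (fun v b => theta (v ⊗ (hantipode A b * a))) (coact X x)).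
  exact: (tlift_app theta).
under eq_tlift => v b do rewrite thetaE.
rewrite (sw_coact (F := fun v b c => v ⊗ (b * (hantipode A c * a)))); try by lin.
under eq_tlift => v b.
  under eq_tlift => c d do rewrite mulrA.
  rewrite (sw_antipoder (F := fun c => v ⊗ (c * a))); last by lin.
  rewrite -scalerAl mul1r linearZr_LR /=.
  over.
by rewrite (sw_coact1 (F := fun v => v ⊗ a)) //; lin.
Qed.
Lemma theta_iso : exists d : comod_hom (copower X reg) (comod_tensor X reg),
  cancel theta d /\ cancel d theta.
Proof.
have [d [de ed]] := comod_iso thetaK theta_invK.
exists d; split=> x.
  exact: (congr1 (fun h : comod_hom (comod_tensor X reg) (comod_tensor X reg)
    => h x) de).
exact: (congr1 (fun h : comod_hom (copower X reg) (copower X reg) => h x) ed).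
Qed.
End Theta.
End ComoduleMaps.

(** * Algebra structures on a vector space *)

(** The image under a functor comes with its vector space, to which only the
    product is added; hence an algebra structure on a given space instead of a
    new carrier. *)
Record algebra_on (k : fieldType) (V : lmodType k) := AlgebraOn {
  amul : V -> V -> V;
  aone : V;
  amul_bilin : bilin amul;
  amulA : associative amul;
  amul1l : left_id aone amul;
  amul1r : right_id aone amul;
  aone_neq0 : aone != 0
}.

Definition alg_carrier (k : fieldType) (V : lmodType k) (S : algebra_on V) : Type := V.
Section AlgebraOfStructure.
Variables (k : fieldType) (V : lmodType k) (S : algebra_on V).
Local Notation T := (alg_carrier S).
HB.instance Definition _ := GRing.Lmodule.on T.
Fact amulDl : left_distributive (amul S : T -> T -> T) +%R.
Proof. by move=> x y z; exact: (linD ((amul_bilin S).1 z)). Qed.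
Fact amulDr : right_distributive (amul S : T -> T -> T) +%R.
Proof. by move=> x y z; exact: (linD ((amul_bilin S).2 x)). Qed.
HB.instance Definition _ := GRing.Zmodule_isNzRing.Build T
  (amulA S) (amul1l S) (amul1r S) amulDl amulDr (aone_neq0 S).
Fact amul_scalerAl (a : k) (x y : T) : a *: (x * y : T) = (a *: x : T) * y.
Proof. exact: esym (linZ ((amul_bilin S).1 y) a x). Qed.
HB.instance Definition _ := GRing.Lmodule_isLalgebra.Build k T amul_scalerAl.
Fact amul_scalerAr (a : k) (x y : T) : a *: (x * y : T) = x * (a *: y : T).
Proof. exact: esym (linZ ((amul_bilin S).2 x) a y). Qed.
HB.instance Definition _ := GRing.Lalgebra_isAlgebra.Build k T amul_scalerAr.
Definition alg_of : algType k := T.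

End AlgebraOfStructure.

Lemma bigalois_of_algebra_on (k : fieldType) (A B : hopfAlg k) (V : lmodType k)
    (S : algebra_on V)
    (lc : {linear V -> tensor A V}) (ltr : {linear A -> tensor V V})
    (rc : {linear V -> tensor V B}) (rtr : {linear B -> tensor V V}) :
  lc (aone S) = 1 ⊗ aone S ->
  (forall x y, lc (amul S x y) = tmap2 *%R (amul S) (lc x) (lc y)) ->
  (forall x, tassoc (tmap (hcomul A) idfun (lc x)) = tmap idfun lc (lc x)) ->
  (forall x, tlunit (tmap (hcounit A) idfun (lc x)) = x) ->
  (forall a, tlift (fun x y => tmap idfun (fun z => amul S z y) (lc x)) (ltr a) =
     a ⊗ aone S) ->
  (forall x, tlift (fun a y => tmap idfun (fun z => amul S z y) (ltr a)) (lc x) =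
     x ⊗ aone S) ->
  rc (aone S) = aone S ⊗ 1 ->
  (forall x y, rc (amul S x y) = tmap2 (amul S) *%R (rc x) (rc y)) ->
  (forall x, tassoc (tmap rc idfun (rc x)) = tmap idfun (hcomul B) (rc x)) ->
  (forall x, trunit (tmap idfun (hcounit B) (rc x)) = x) ->
  (forall b, tlift (fun x y => tmap (fun z => amul S x z) idfun (rc y)) (rtr b) =
     aone S ⊗ b) ->
  (forall x, tlift (fun y b => tmap (fun z => amul S y z) idfun (rtr b)) (rc x) =
     aone S ⊗ x) ->
  exists R : algType k, inhabited (bigalois A B R).
Proof.
(* Once V is a constructor, the vector space underlying [alg_of S] is
   convertible to V. *)
case: V S lc ltr rc rtr => s c S lc ltr rc rtr.
move=> lc1 lcM lcA lce ltrK ltrE rc1 rcM rcA rce rtrK rtrE.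
exists (alg_of S); constructor.
exact: (@BiGalois k A B (alg_of S) lc (pair lc1 lcM) lcA lce ltr ltrK ltrE
  rc (pair rc1 rcM) rcA rce rtr rtrK rtrE).
Qed.

(** * The algebra image of the regular comodule *)

Section FiberAlgebra.
Variables (k : fieldType) (A B : hopfAlg k).
Variable F : monfunctor (comod_moncat A) (comod_moncat B).
Hypothesis HF : is_equivalence F.
Local Notation Fo := (Fo F).
Local Notation Fh := (Fh F).
Local Notation reg := (regcomod A).
Local Notation R := (Fo reg).
Local Notation pe := (@phi_elt k A B F _ _).

Lemma cmap_exists (V : lmodType k) (X : comod A) :
  exists c : comod_hom (copower V (Fo X)) (Fo (copower V X)),
    forall v x, c (v ⊗ x) = Fh (cop_inc X v) x.
Proof.
apply: copower_lift => x a v w; rewrite -Fh_lin; apply: eq_FhE => y /=.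
exact: linearPl.
Qed.
Definition cmap V X := sval (cid (cmap_exists V X)).
Lemma cmapE V X v x : cmap V X (v ⊗ x) = Fh (cop_inc X v) x.
Proof. exact: (svalP (cid (cmap_exists V X))). Qed.

Lemma Fh_cmap V (X Z : comod A) (h : comod_hom (copower V X) Z) v x :
  Fh h (cmap V X (v ⊗ x)) = Fh (comod_comp h (cop_inc X v)) x.
Proof. by rewrite cmapE Fh_comp. Qed.

(** The copower V ⊗ F X is isomorphic to some F Y, and F is fully faithful, so
    its inclusions of F X come from a linear family of maps X -> Y, that is,
    from a map out of the copower V ⊗ X; its image under F is the inverse. *)
Lemma cmap_bij V X : exists d : comod_hom (Fo (copower V X)) (copower V (Fo X)),
  cancel (cmap V X) d /\ cancel d (cmap V X).
Proof.
pose T := copower V (Fo X).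
have [Y [e [d [eK dK]]]] := Fo_esurj HF T.
have [g gP] := choice (fun v => Fh_full HF (comod_comp d (cop_inc (Fo X) v))).
have gE v x : Fh (g v) x = d (v ⊗ x) by rewrite gP.
have gL x : linear (fun v => g v x : Y).
  move=> a v w.
  have -> : g (a *: v + w) = a *: g v + g w.
    apply: (Fh_faithful HF) => y; rewrite (Fh_lin y) !gE.
    by rewrite linearPl linearP.
  by [].
have [h hE] := copower_lift gL.
pose c' := comod_comp e (Fh h).
have cK : cancel (cmap V X) c'.
  elim/tensor_indD => [v x|s t IHs IHt]; last first.
    rewrite (linearD (cmap V X)) (linearD c') -[RHS]/(s + t).
    by rewrite -[in RHS]IHs -[in RHS]IHt.
  rewrite /c' /= Fh_cmap (eq_FhE (F := F) x (g := g v)); last first.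
    by move=> y; rewrite /= hE.
  by rewrite gE dK.
exists c'; split=> // y.
have [q qE] := Fh_full HF (comod_comp (cmap V X) c').
have qinc v : comod_comp q (cop_inc X v) = cop_inc X v.
  apply: (Fh_faithful HF) => x.
  by rewrite -Fh_comp -cmapE qE; exact: (congr1 (cmap V X) (cK (v ⊗ x))).
have q1 : q = comod_idm (copower V X).
  apply: comod_hom_eq; elim/tensor_indD => [v x|s t IHs IHt].
    exact: (congr1 (fun h : comod_hom X (copower V X) => h x) (qinc v)).
  by rewrite [LHS]linearD /= IHs IHt.
have -> : cmap V X (c' y) = Fh q y by rewrite qE.
by rewrite q1 Fh_id.
Qed.
Definition cinv V X := sval (cid (cmap_bij V X)).
Lemma cmapK V X : cancel (cmap V X) (cinv V X).
Proof. by have [] := svalP (cid (cmap_bij V X)). Qed.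
Lemma cinvK V X : cancel (cinv V X) (cmap V X).
Proof. by have [] := svalP (cid (cmap_bij V X)). Qed.
Lemma cmap_inj V X : injective (cmap V X). Proof. exact: can_inj (@cmapK V X). Qed.

(** The product of A is a comodule map, and a monoidal functor transports
    algebras. *)
Definition Rmul (x y : R) : R := Fh (mul_comod A) (pe x y).
Definition Rone : R := Fh (unit_comod A) (unit_elt F).

Lemma Rmul_bilin : bilin Rmul.
Proof. by rewrite /Rmul /phi_elt; lin. Qed.

Lemma RmulA : associative Rmul.
Proof.
move=> x y z; rewrite /Rmul phi_natr phi_natl !Fh_comp -phi_assoc Fh_comp.
apply: eq_FhE; apply: tensor_ext3 => a b c.
rewrite /= tassocE (tmapE idfun (mul_comod A)) (tmapE (mul_comod A) idfun) /=.
by rewrite !tliftE /= mulrA.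
Qed.

Lemma Rmul1l : left_id Rone Rmul.
Proof.
move=> x; rewrite /Rmul /Rone phi_natl Fh_comp -[RHS](phi_lunit (F := F)).
apply: eq_FhE; apply: tensor_ext => c a.
rewrite /= (tmapE (unit_comod A) idfun) /= tliftE /= tlunitE.
by rewrite /unit_fun -scalerAl mul1r.
Qed.
Lemma Rmul1r : right_id Rone Rmul.
Proof.
move=> x; rewrite /Rmul /Rone phi_natr Fh_comp -[RHS](phi_runit (F := F)).
apply: eq_FhE; apply: tensor_ext => a c.
rewrite /= (tmapE idfun (unit_comod A)) /= tliftE /= trunitE.
by rewrite /unit_fun -scalerAr mulr1.
Qed.

Lemma Rone_neq0 : Rone != 0.
Proof.
apply/eqP => R10.
have R0 (x : R) : x = 0.
  by rewrite -[x]Rmul1l R10; exact: (linear0 (mklin (Rmul_bilin.1 x))).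
have : comod_idm reg = 0 :> comod_hom reg reg.
  by apply: (Fh_faithful HF) => x; rewrite [LHS]R0 [RHS]R0.
move=> /(congr1 (fun h : comod_hom reg reg => h (1 : A))) /eqP.
by rewrite -[X in X == _]/(1 : A) -[X in _ == X]/(0 : A) oner_eq0.
Qed.

Definition Ralg : algebra_on R :=
  AlgebraOn Rmul_bilin RmulA Rmul1l Rmul1r Rone_neq0.
End FiberAlgebra.

(** * Canonical maps *)

Section Coactions.
Variables (k : fieldType) (A B : hopfAlg k).
Variable F : monfunctor (comod_moncat A) (comod_moncat B).
Hypothesis HF : is_equivalence F.
Local Notation Fo := (Fo F).
Local Notation Fh := (Fh F).
Local Notation reg := (regcomod A).
Local Notation R := (Fo reg).
Local Notation pe := (@phi_elt k A B F _ _).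
Local Notation Rmul := (@Rmul k A B F).
Local Notation Rone := (Rone F).
Local Notation cmap := (cmap F).

HB.instance Definition _ := bilinear_isBilinear.Build k R R R _ _ Rmul
  (pair (Rmul_bilin F).1 (Rmul_bilin F).2).
Definition Rrmul (y x : R) : R := Rmul x y.
Definition Rlmul (x y : R) : R := Rmul x y.
Fact Rrmul_bilin : bilin Rrmul.
Proof. by split; [exact: (Rmul_bilin F).2|exact: (Rmul_bilin F).1]. Qed.
HB.instance Definition _ y :=
  GRing.isLinear.Build k R R _ (Rrmul y) (Rrmul_bilin.2 y).
HB.instance Definition _ x :=
  GRing.isLinear.Build k R R _ (Rlmul x) ((Rmul_bilin F).2 x).

Definition Rrleg (U : lmodType k) (y : R) (t : tensor U R) : tensor U R :=
  tmap idfun (Rrmul y) t.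
Definition Rlleg (U : lmodType k) (x : R) (t : tensor R U) : tensor R U :=
  tmap (Rlmul x) idfun t.
HB.instance Definition _ U y := GRing.Linear.copy (@Rrleg U y) (tmap idfun (Rrmul y)).
HB.instance Definition _ U x := GRing.Linear.copy (@Rlleg U x) (tmap (Rlmul x) idfun).
Lemma Rrleg_linear U (t : tensor U R) : linear (fun y => Rrleg y t).
Proof. by move=> a x y; apply: tmap_linearr => z; exact: Rrmul_bilin.1. Qed.
Lemma Rlleg_linear U (t : tensor R U) : linear (fun y => Rlleg y t).
Proof. by move=> a x y; apply: tmap_linearl => z; exact: (Rmul_bilin F).1. Qed.
Lemma RrlegE (U : lmodType k) (u : U) z y : Rrleg y (u ⊗ z) = u ⊗ Rmul z y.
Proof. exact: tmapE. Qed.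

Lemma RrlegM (U : lmodType k) (t : tensor U R) x y :
  Rrleg y (Rrleg x t) = Rrleg (Rmul x y) t.
Proof.
by rewrite /Rrleg tmap_comp; apply: eq_tmap => // z; rewrite /= /Rrmul RmulA.
Qed.
Lemma Rrleg1 (U : lmodType k) (t : tensor U R) : Rrleg Rone t = t.
Proof.
rewrite -[RHS]tmap_id; apply: eq_tmap => // z; exact: Rmul1r.
Qed.

(** The coaction is a comodule map from X to the copower of A by the space X;
    its image under F is F X -> X ⊗ R. For X = A this is the left coaction on R.
    *)
Definition delta X : comod_hom (Fo X) (copower (cmod X) R) :=
  comod_comp (cinv HF (cmod X) reg) (Fh (coact_comod X)).
Lemma deltaE X x : cmap (cmod X) reg (delta X x) = Fh (coact_comod X) x.
Proof. exact: cinvK. Qed.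

Lemma delta_nat (X Y : comod A) (f : comod_hom X Y) x :
  delta Y (Fh f x) = tmap f idfun (delta X x).
Proof.
apply: (cmap_inj HF); rewrite deltaE Fh_comp.
have cf (w : tensor (cmod X) R) :
    cmap (cmod Y) reg (tmap f idfun w) =
    Fh (cop_fmap reg (f : {linear cmod X -> cmod Y})) (cmap (cmod X) reg w).
  move: w; apply: tensor_extL => [||v y]; [by lin|by lin|].
  rewrite tmapE Fh_cmap cmapE; apply: eq_FhE => z /=.
  by rewrite tmapE.
rewrite cf deltaE Fh_comp; apply: eq_FhE => y.
exact: comod_homP.
Qed.

Lemma cmap_rleg (V : lmodType k) (w : tensor V R) (y : R) :
  cmap V reg (Rrleg y w) = Fh (cop_mul A V) (pe (cmap V reg w) y).
Proof.
rewrite /phi_elt; move: w; apply: tensor_extL => [||v z]; [by lin|by lin|].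
rewrite -/(phi_elt _ _).
rewrite RrlegE !cmapE /Rmul phi_natl !Fh_comp; apply: eq_FhE.
apply: tensor_ext => a b /=.
by rewrite tliftE (tmapE (cop_inc reg v) idfun) /= cop_mul_funE.
Qed.

(** The map x ⊗ y |-> delta(x) (1 ⊗ y); for X = A, the left canonical map of R.
    *)
Definition can (X : comod A) : tensor (Fo X) R -> tensor (cmod X) R :=
  tlift (fun x y => Rrleg y (delta X x)).
Let canB X : bilin (fun x y => Rrleg y (delta X x)).
Proof. by split=> [y|x]; [lin|exact: Rrleg_linear]. Qed.
Fact can_linear X : linear (@can X).
Proof. exact: lin_tlift (canB X) _. Qed.
HB.instance Definition _ X := GRing.isLinear.Build k _ _ _ (@can X) (@can_linear X).
Lemma canE X x y : can (x ⊗ y) = Rrleg y (delta X x).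
Proof. exact: (tliftP _ _ (canB X)). Qed.

Lemma cmap_can X t : cmap (cmod X) reg (can t) = Fh (theta X) (phi F X reg t).
Proof.
move: t; apply: tensor_extL => [||x y]; [by lin|by lin|].
rewrite canE cmap_rleg deltaE -[phi F X reg _]/(pe x y) phi_natl Fh_comp.
exact: eq_FhE.
Qed.

Lemma can_rleg X t y : can (Rrleg y t) = Rrleg y (can (X := X) t).
Proof.
move: t; apply: tensor_extL => [||x z]; [by lin|by lin|].
by rewrite RrlegE !canE RrlegM.
Qed.

(** Up to the isomorphisms of F with tensor products and copowers, the canonical
    map is the image of the isomorphism [theta]. *)
Lemma can_bij X : exists d : {linear tensor (cmod X) R -> tensor (Fo X) R},
  cancel (@can X) d /\ cancel d (@can X).
Proof.
have [d1 [K1 K1']] := theta_iso X; have [d2 [K2 K2']] := phi_bij F X reg.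
have dL : linear (fun t : tensor (cmod X) R =>
    d2 (Fh d1 (cmap (cmod X) reg t)) : tensor (Fo X) R).
  by move=> a s t; rewrite (linearP (cmap _ _)) (linearP (Fh d1)) (linearP d2).
exists (mklin dL).
have F1 : cancel (Fh (theta X)) (Fh d1).
  by move=> t; rewrite Fh_comp -[RHS](Fh_id (F := F)); apply: eq_FhE; exact: K1.
have F1' : cancel (Fh d1) (Fh (theta X)).
  by move=> t; rewrite Fh_comp -[RHS](Fh_id (F := F)); apply: eq_FhE; exact: K1'.
split=> t; first by rewrite /= cmap_can F1 K2.
by apply: (cmap_inj HF); rewrite cmap_can /= K2' F1'.
Qed.
Definition caninv X := sval (cid (can_bij X)).
Lemma canK X : cancel (@can X) (caninv X).
Proof. by have [] := svalP (cid (can_bij X)). Qed.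
Lemma caninvK X : cancel (caninv X) (@can X).
Proof. by have [] := svalP (cid (can_bij X)). Qed.

Lemma caninv_rleg X t y : caninv X (Rrleg y t) = Rrleg y (caninv X t).
Proof. by apply: (can_inj (@canK X)); rewrite can_rleg !caninvK. Qed.
End Coactions.

(** * The left Galois structure *)

Section LeftGalois.
Variables (k : fieldType) (A B : hopfAlg k).
Variable F : monfunctor (comod_moncat A) (comod_moncat B).
Hypothesis HF : is_equivalence F.
Local Notation Fo := (Fo F).
Local Notation Fh := (Fh F).
Local Notation reg := (regcomod A).
Local Notation R := (Fo reg).
Local Notation pe := (@phi_elt k A B F _ _).
Local Notation Rmul := (@Rmul k A B F).
Local Notation Rone := (Rone F).
Local Notation cmap := (cmap F).
Local Notation delta := (delta HF).
Local Notation can := (can HF).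
Local Notation caninv := (caninv HF).

Lemma deltaEr x : cmap A reg (delta reg x) = Fh (coact_comod reg) x.
Proof. exact: (@deltaE k A B F HF reg x). Qed.

Lemma delta_one : delta reg Rone = (1 : A) ⊗ Rone.
Proof.
apply: (cmap_inj HF); rewrite deltaE cmapE /Rone !Fh_comp; apply: eq_FhE => c /=.
by rewrite /unit_fun linearZZ hcomul1 linearZr_LR.
Qed.

Lemma delta_mul x y :
  delta reg (Rmul x y) = tmap2 *%R Rmul (delta reg x) (delta reg y).
Proof.
apply: (cmap_inj HF (V := A)); rewrite deltaEr /Rmul Fh_comp.
have cM s t : cmap A reg (tmap2 *%R Rmul s t) =
    Fh (cop_mul2 A) (pe (cmap A reg s) (cmap A reg t)).
  rewrite /phi_elt; move: s; apply: tensor_extL => [||a z]; [by lin|by lin|].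
  move: t; apply: tensor_extL => [||b w]; [by lin|by lin|].
  rewrite tmap2E !cmapE -/(phi_elt _ _) phi_nat !Fh_comp; apply: eq_FhE.
  apply: tensor_ext => c d /=.
  rewrite tliftE (tmapE (cop_inc reg a) (cop_inc reg b)) /=.
  by rewrite [RHS]tliftE /= tmap2E.
rewrite cM !deltaEr phi_nat Fh_comp; apply: eq_FhE; apply: tensor_ext => c d /=.
rewrite tliftE (tmapE (coact_comod reg) (coact_comod reg)) /=.
by rewrite [RHS]tliftE /= hcomulM.
Qed.

Lemma delta_coassoc x :
  tassoc (tmap (hcomul A) idfun (delta reg x)) =
  tmap idfun (delta reg) (delta reg x).
Proof.
(* [J] identifies A ⊗ (A ⊗ R) with the image of an iterated copower, where both
   sides become images of comodule maps out of A. *)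
pose J (t : tensor A (tensor A R)) : Fo (copower A (copower A reg)) :=
  cmap A (copower A reg) (tmap idfun (cmap A reg) t).
have J_inj : injective J.
  move=> s t /(cmap_inj HF).
  apply: (can_inj (g := tmap idfun (cinv HF A reg))) => u.
  rewrite tmap_comp -[RHS]tmap_id; apply: eq_tmap => // v.
  exact: cmapK.
apply: J_inj.
have -> : J (tmap idfun (delta reg) (delta reg x)) =
    Fh (cop_map A (coact_comod reg)) (Fh (coact_comod reg) x).
  rewrite -deltaEr /J; move: (delta reg x).
  apply: tensor_extL => [||a y]; [by lin|by lin|].
  rewrite !tmapE cmapE /= deltaEr cmapE !Fh_comp; apply: eq_FhE => z /=.
  by rewrite tmapE.
have [h hE] : exists h : comod_hom (copower A reg) (copower A (copower A reg)),
    forall a y, h (a ⊗ y) = cop_assoc reg (hcomul A a) y.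
  by apply: copower_lift => y /=; lin.
have -> : J (tassoc (tmap (hcomul A) idfun (delta reg x))) =
    Fh h (Fh (coact_comod reg) x).
  rewrite -deltaEr /J; move: (delta reg x).
  apply: tensor_extL => [||a y]; [by lin|by lin|].
  rewrite tmapE -[X in _ ⊗ X]/y Fh_cmap.
  have -> : Fh (comod_comp h (cop_inc reg a)) y =
      Fh (cop_assoc reg (hcomul A a)) y.
    by apply: eq_FhE => z /=; rewrite hE.
  move: (hcomul A a); apply: tensor_extL => [||b c]; first by lin.
    move=> e s t; rewrite -Fh_lin; apply: eq_FhE => z /=.
    by rewrite linearPl linearP.
  rewrite tassocE tmapE cmapE [X in Fh _ X]cmapE Fh_comp; apply: eq_FhE => z /=.
  by rewrite tassocE.
rewrite !Fh_comp; apply: eq_FhE => a /=.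
have e t : h t = tassoc (tmap (hcomul A) idfun t).
  move: t; apply: tensor_extL => [||b c]; [by lin|by lin|].
  by rewrite hE tmapE.
by rewrite e hcomulA.
Qed.

Lemma delta_counit x : tlunit (tmap (hcounit A) idfun (delta reg x)) = x.
Proof.
have [h hE] : exists h : comod_hom (copower A reg) reg,
    forall a y, h (a ⊗ y) = ((hcounit A a : k) *: comod_idm reg) y.
  by apply: copower_lift => y /=; lin.
have -> : tlunit (tmap (hcounit A) idfun (delta reg x)) =
    Fh h (Fh (coact_comod reg) x).
  rewrite -deltaEr; move: (delta reg x).
  apply: tensor_extL => [||a y]; [by lin|by lin|].
  rewrite tmapE tlunitE Fh_cmap.
  transitivity (Fh ((hcounit A a : k) *: comod_idm reg) y).
    by rewrite (linZ (Fh_lin (F := F) y)) Fh_id.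
  by apply: eq_FhE => z /=; rewrite hE.
rewrite Fh_comp -[RHS](Fh_id (F := F)); apply: eq_FhE => a /=.
have e t : h t = tlunit (tmap (hcounit A) idfun t).
  move: t; apply: tensor_extL => [||b c]; [by lin|by lin|].
  by rewrite hE tmapE tlunitE.
by rewrite e hcounitl.
Qed.

Definition ltrans (a : A) : tensor R R := caninv reg (a ⊗ Rone).
Fact ltrans_linear : linear ltrans.
Proof. by rewrite /ltrans; lin. Qed.
HB.instance Definition _ := GRing.isLinear.Build k _ _ _ ltrans ltrans_linear.

Lemma can_ltrans a : can (X := reg) (ltrans a) = a ⊗ Rone.
Proof. exact: caninvK. Qed.

Lemma ltrans_delta x : tlift (fun a y => Rrleg y (ltrans a)) (delta reg x) = x ⊗ Rone.
Proof.
apply: (can_inj (@canK _ _ _ _ HF reg)); rewrite (tlift_app (@can reg)).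
rewrite canE Rrleg1 -[RHS]tlift_ptens; apply: eq_tlift => a y.
by rewrite /= can_rleg can_ltrans RrlegE Rmul1l.
Qed.

(** Applying the counit to the first leg turns the canonical map into the
    product. *)
Lemma ltrans_mul a : tlift Rmul (ltrans a) = (hcounit A a : k) *: Rone.
Proof.
have e t : tlift Rmul t = tlunit (tmap (hcounit A) idfun (can (X := reg) t)).
  move: t; apply: tensor_extL => [||x y]; [by lin|by lin|].
  rewrite tliftE canE -{1}(delta_counit x).
  move: (delta reg x); apply: tensor_extL => [||b z]; [by lin|by lin|].
  by rewrite RrlegE !tmapE !tlunitE linearZl_LR.
by rewrite e can_ltrans tmapE tlunitE.
Qed.
End LeftGalois.

(** * The right Galois structure *)

Section RightGalois.
Variables (k : fieldType) (A B : hopfAlg k).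
Variable F : monfunctor (comod_moncat A) (comod_moncat B).
Hypothesis HF : is_equivalence F.
Local Notation Fo := (Fo F).
Local Notation Fh := (Fh F).
Local Notation reg := (regcomod A).
Local Notation R := (Fo reg).
Local Notation pe := (@phi_elt k A B F _ _).
Local Notation Rmul := (@Rmul k A B F).
Local Notation Rone := (Rone F).
Local Notation cmap := (cmap F).
Local Notation delta := (delta HF).
Local Notation can := (can HF).
Local Notation caninv := (caninv HF).

Lemma coact_one : coact R Rone = Rone ⊗ 1.
Proof.
rewrite /Rone comod_homP /unit_elt comod_homP.
rewrite -[coact (comod_unit B) _]/((1 : k^o) ⊗ 1).
by rewrite !tmapE.
Qed.

Lemma coact_mul x y : coact R (Rmul x y) = tmap2 Rmul *%R (coact R x) (coact R y).
Proof.
rewrite [in LHS]/Rmul comod_homP /phi_elt comod_homP.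
rewrite -[coact (comod_tensor R R) _]/(@tcoact k B R R (x ⊗ y)) tcoactE.
move: (coact R x); apply: tensor_extL => [||z b]; [by lin|by lin|].
move: (coact R y); apply: tensor_extL => [||w c]; [by lin|by lin|].
by rewrite !tmap2E !tmapE.
Qed.

(** Let F X be the regular B-comodule.  Then X plays the role of the inverse of R,
    and there are a comultiplication B -> X ⊗ R ([delta_pre]) and an antipode
    X -> R ([antipode_pre]).  With the comultiplication A -> R ⊗ X coming from
    fullness ([cotensor_map]), the two remaining identities of the right Galois
    structure are S(b_(1)) b_(2) = eps(b) and a_(1) S(a_(2)) = eps(a), read in R. *)
Variables (X : comod A) (e : comod_hom (Fo X) (regcomod B)).
Variable d : comod_hom (regcomod B) (Fo X).
Hypothesis dK : cancel d e.

Local Notation W := (cmod X).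
Definition delta_pre (b : B) : tensor W R := delta X (d b).
Definition counit_pre (x : Fo X) : k^o := hcounit B (e x).
Fact counit_pre_linear : linear counit_pre.
Proof. by move=> a x y; rewrite /counit_pre (linearP e) (linearP (hcounit B)). Qed.
HB.instance Definition _ := GRing.isLinear.Build k _ _ _ counit_pre counit_pre_linear.
Fact delta_pre_linear : linear delta_pre. Proof. by rewrite /delta_pre; lin. Qed.
HB.instance Definition _ := GRing.isLinear.Build k _ _ _ delta_pre delta_pre_linear.

(** The inverse canonical map followed by the counit of B. By R-linearity it is
    w ⊗ z |-> S(w) z, with S its value at z = 1. *)
Definition can_eval (t : tensor W R) : R := tlunit (tmap counit_pre idfun (caninv X t)).
Fact can_eval_linear : linear can_eval. Proof. by rewrite /can_eval; lin. Qed.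
HB.instance Definition _ := GRing.isLinear.Build k _ _ _ can_eval can_eval_linear.
Definition antipode_pre (w : W) : R := can_eval (w ⊗ Rone).
Fact antipode_pre_linear : linear antipode_pre. Proof. by rewrite /antipode_pre; lin. Qed.
HB.instance Definition _ := GRing.isLinear.Build k _ _ _ antipode_pre antipode_pre_linear.

Lemma can_eval_rleg t y : can_eval (Rrleg y t) = Rmul (can_eval t) y.
Proof.
rewrite /can_eval caninv_rleg; move: (caninv X t).
apply: tensor_extL => [||x z]; [by lin|by lin|].
by rewrite RrlegE !tmapE !tlunitE linearZl_LR.
Qed.

Lemma can_evalE t : can_eval t = tlift (fun w z => Rmul (antipode_pre w) z) t.
Proof.
move: t; apply: tensor_extL => [||w z]; [by lin|by lin|].
rewrite tliftP; last by lin.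
by rewrite /antipode_pre -can_eval_rleg RrlegE Rmul1l.
Qed.

Lemma can_delta_pre b z : Rrleg z (delta_pre b) = can (X := X) (d b ⊗ z).
Proof. by rewrite canE. Qed.

Lemma can_eval_delta_pre b z : can_eval (Rrleg z (delta_pre b)) = (hcounit B b : k) *: z.
Proof. by rewrite can_delta_pre /can_eval canK tmapE tlunitE /= /counit_pre dK. Qed.

Lemma can_eval_delta_pre1 b : can_eval (delta_pre b) = (hcounit B b : k) *: Rone.
Proof. by rewrite -can_eval_delta_pre Rrleg1. Qed.

(** The translation map S(b_(1)) ⊗ b_(2). *)
Definition rtrans (b : B) : tensor R R := tmap antipode_pre idfun (delta_pre b).
Fact rtrans_linear : linear rtrans. Proof. by rewrite /rtrans; lin. Qed.

(** By colinearity of b |-> b_(1) ⊗ b_(2), this is S(b_(1)) b_(2) ⊗ b_(3). *)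
Lemma rtransK b : tlift (fun x y => Rlleg x (coact R y)) (rtrans b) = Rone ⊗ b.
Proof.
have LB : bilin (fun x y => Rlleg x (coact R y)).
  by split=> [y|x]; [exact: Rlleg_linear|lin].
rewrite /rtrans tlift_tmap //.
transitivity (tmap can_eval idfun (coact (copower W R) (delta_pre b))).
  move: (delta_pre b); apply: tensor_extL => [||w z]; [|by lin|].
    by apply: lin_tlift => //; split=> [y|x]; [apply: (lin_comp (LB.1 _)); lin|lin].
  rewrite tliftP; last by split=> [y|x]; [apply: (lin_comp (LB.1 _)); lin|lin].
  rewrite cop_incP /Rlleg tmap_comp; apply: eq_tmap => // y.
  by rewrite /= can_evalE tliftP //; lin.
rewrite [coact _ _](comod_homP (comod_comp (delta X) d)) tmap_comp.
rewrite -[in RHS](hcounitl b) -[coact (regcomod B) b]/(hcomul B b).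
move: (hcomul B b); apply: tensor_extL => [||b1 b2]; [by lin|by lin|].
by rewrite !tmapE tlunitE /= -/(delta_pre b1) can_eval_delta_pre1 linearZl_LR linearZr_LR.
Qed.

(** The coaction y |-> y_(0) ⊗ y_(1) of B on R, in R ⊗ F X, that is, in F (R ⊗
    X). Fullness makes it the image of a comodule map tau : A -> R ⊗ X. *)
Definition cotensor_map : comod_hom R (Fo (copower (cmod R) X)) :=
  comod_comp (cmap (cmod R) X)
    (comod_comp (cop_map (cmod R) d) (coact_comod R)).

Section Tau.
Variable tau : comod_hom reg (copower (cmod R) X).
Hypothesis tauE : Fh tau = cotensor_map.

(** Coassociativity of the comultiplications of A, B and R: x_(1) ⊗ x_(2) ⊗
    x_(3) in R ⊗ X ⊗ R is obtained through A and through B. *)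
Lemma tau_delta x : tmap tau idfun (delta reg x) =
  tlift (fun y b => tmap (ptens y) idfun (delta_pre b)) (coact R x).
Proof.
have LB : bilin (fun (y : R) b => tmap (@ptens k R W y) (@idfun R) (delta_pre b)).
  split=> [b|y]; last by lin.
  by move=> a y y'; apply: tmap_linearl => w; rewrite /= linearPl.
rewrite -delta_nat tauE.
have -> : cotensor_map x = cmap (cmod R) X (tmap idfun d (coact R x)) by [].
move: (coact R x); apply: tensor_extL => [||y b]; first by lin.
  by apply: lin_tlift.
rewrite (tmapE idfun d) cmapE delta_nat tliftP //.
Qed.

(** The map y ⊗ w ⊗ z |-> y S(w) z. *)
Definition mul_antipode3 (t : tensor (tensor R W) R) : R :=
  tlift (fun y u => Rmul y (can_eval u)) (tassoc t).
Let mul_antipode3B : bilin (fun y u => Rmul y (can_eval u)). Proof. by lin. Qed.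
Fact mul_antipode3_linear : linear mul_antipode3. Proof. by rewrite /mul_antipode3; lin. Qed.
HB.instance Definition _ := GRing.isLinear.Build k _ _ _ mul_antipode3 mul_antipode3_linear.

Lemma mul_antipode3_leg y u : mul_antipode3 (tmap (ptens y) idfun u) = Rmul y (can_eval u).
Proof.
move: u; apply: tensor_extL => [||w z]; [by lin|by lin|].
by rewrite tmapE /mul_antipode3 tassocE tliftP.
Qed.

(** The map y ⊗ w |-> y S(w). *)
Definition mul_antipode (t : tensor R W) : R := mul_antipode3 (t ⊗ Rone).
Fact mul_antipode_linear : linear mul_antipode. Proof. by rewrite /mul_antipode; lin. Qed.
HB.instance Definition _ := GRing.isLinear.Build k _ _ _ mul_antipode mul_antipode_linear.

Lemma mul_antipodeE y w : mul_antipode (y ⊗ w) = Rmul y (antipode_pre w).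
Proof. by rewrite /mul_antipode /mul_antipode3 tassocE tliftP. Qed.

(** Both sides are x_(1) S(x_(2)) x_(3) z; evaluated through B, the factor
    S(x_(2)) x_(3) is a counit. *)
Lemma mul_antipode3_can t : mul_antipode3 (tmap tau idfun (can (X := reg) t)) = tlift Rmul t.
Proof.
move: t; apply: tensor_extL => [||x z].
- move=> a s t.
  by rewrite (linearP (@can reg)) (linearP (tmap tau idfun)) (linearP mul_antipode3).
- by lin.
rewrite canE tliftE /=.
have -> : tmap tau idfun (Rrleg z (delta reg x)) =
    Rrleg z (tmap tau idfun (delta reg x)).
  by rewrite /Rrleg !tmap_comp; apply: eq_tmap.
rewrite tau_delta (tlift_app (Rrleg z)) (tlift_app mul_antipode3).
rewrite -[RHS](sw_coact1 (F := fun y => Rmul y z)); last by lin.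
apply: eq_tlift => y b /=.
have -> : Rrleg z (tmap (ptens y) idfun (delta_pre b)) =
    tmap (@ptens k R W y) idfun (Rrleg z (delta_pre b)).
  by rewrite /Rrleg !tmap_comp; apply: eq_tmap.
by rewrite mul_antipode3_leg can_eval_delta_pre linearZr_LR.
Qed.

(** This is a_(1) S(a_(2)) = eps(a), from the previous lemma at the translation
    map of a. *)
Lemma mul_antipode_tau a : mul_antipode (tau a) = (hcounit A a : k) *: Rone.
Proof.
rewrite -(ltrans_mul HF) -mul_antipode3_can can_ltrans.
by rewrite (tmapE tau idfun).
Qed.

Lemma rtrans_coact_tau x :
  tlift (fun y b => Rlleg y (rtrans b)) (coact R x) = Rone ⊗ x.
Proof.
transitivity (tmap mul_antipode idfun (tmap tau idfun (delta reg x))).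
  rewrite tau_delta (tlift_app (tmap mul_antipode idfun)); apply: eq_tlift => y b.
  rewrite /rtrans /Rlleg /= !tmap_comp; apply: eq_tmap => // w /=.
  by rewrite mul_antipodeE.
rewrite -[in RHS](delta_counit HF x).
move: (delta reg x); apply: tensor_extL => [||a y].
- move=> a s t.
  by rewrite (linearP (tmap tau idfun)) (linearP (tmap mul_antipode idfun)).
- by lin.
by rewrite (tmapE tau idfun) !tmapE tlunitE /= mul_antipode_tau linearZl_LR linearZr_LR.
Qed.
End Tau.

Lemma rtrans_coact x :
  tlift (fun y b => Rlleg y (rtrans b)) (coact R x) = Rone ⊗ x.
Proof.
have [tau tauE] := Fh_full HF cotensor_map.
exact: rtrans_coact_tau tauE x.
Qed.
End RightGalois.

Lemma monoidally_equivalent_bigalois (k : fieldType) (A B : hopfAlg k) :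
  monoidally_equivalent (comod_moncat A) (comod_moncat B) ->
  exists R : algType k, inhabited (bigalois A B R).
Proof.
move=> [F HF].
have [X [e [d [eK dK]]]] := Fo_esurj HF (regcomod B).
apply: (@bigalois_of_algebra_on k A B (Fo F (regcomod A)) (Ralg HF)
  (delta HF (regcomod A)) (mklin (@ltrans_linear _ _ _ _ HF))
  (coact (Fo F (regcomod A))) (mklin (rtrans_linear HF e d))).
- exact: delta_one.
- exact: delta_mul.
- exact: delta_coassoc.
- exact: delta_counit.
- exact: can_ltrans.
- exact: ltrans_delta.
- exact: coact_one.
- exact: coact_mul.
- exact: coactA.
- exact: coact1.
- exact: rtransK dK.
- exact: rtrans_coact dK.
Qed.

Theorem theorem3p5 (k : fieldType) (A B : hopfAlg k)
    (hAB : monoidally_equivalent (comod_moncat A) (comod_moncat B))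
    (hA : gldim A <> None) (hB : gldim B <> None) :
  gldim A = gldim B.
Proof.
have [R [g]] := monoidally_equivalent_bigalois hAB.
exact: gldim_bigalois g hA hB.
Qed.
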